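(* Let $X_n$ be the random variable for the number of trees in a $D$-forest of size $n$, i.e. $\mathbb{P}[X_n=k]:=\frac{d_{n,k}}{d_n}$. Then, as $n\to\infty$, $$\mathbb{E}X_n=\begin{cases}3+\mu_0+O(n^{-1})\approx 3.2715+O(n^{-1}), & \text{for } n \text{ even},\\ 3+\mu_1+O(n^{-1})\approx 6.7852+O(n^{-1}), & \text{for } n\text{ odd},\end{cases}$$ with $$\mu_0:=\frac{\xi(\sqrt\rho)\gamma(\sqrt\rho)+\xi(-\sqrt\rho)\gamma(-\sqrt\rho)}{\xi(\sqrt\rho)+\xi(-\sqrt\rho)},\qquad \mu_1:=\frac{\xi(\sqrt\rho)\gamma(\sqrt\rho)-\xi(-\sqrt\rho)\gamma(-\sqrt\rho)}{\xi(\sqrt\rho)-\xi(-\sqrt\rho)},$$ $$\xi(z)=\exp\Big(\sum_{i\ge3}\frac{T(z^i)}{i}\Big),\qquad \gamma(z)=\sum_{i\ge3}T(z^i).$$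
   Context: A Pólya tree is a rooted unlabelled non-plane tree; its size is its number of nodes. $T(z)=\sum_{n\ge1}t_nz^n$ is the ordinary generating function of Pólya trees, satisfying $T(z)=z\exp(\sum_{i\ge1}T(z^i)/i)$, and $\rho\approx0.3383219$ is its radius of convergence. A $D$-forest is a multiset $F$ of Pólya trees in which each tree that occurs appears at least twice, with weight $w(F)=|\{\sigma\in\operatorname{Aut}(F):\sigma_1=0\}|/|\operatorname{Aut}(F)|$, where $\sigma_1$ is the number of nodes fixed by the automorphism $\sigma$; its size is its total number of nodes. $d_n$ is the total weight of $D$-forests of size $n$, with generating function $D(z)=\sum_{n\ge0}d_nz^n=\exp(\sum_{i\ge2}T(z^i)/i)$. $d_{n,k}$ is the total weight of $D$-forests of size $n$ consisting of $k$ trees; its bivariate generating function is $$D(z,v)=\sum_{n,k\ge0}d_{n,k}z^nv^k=\exp\Big(\sum_{i\ge2}v^i\frac{T(z^i)}{i}\Big).$$ *)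

(* Defs.v *)
(* Combinatorics over MathComp finite types; analysis over Stdlib's R with
   Coquelicot. *)
From mathcomp Require Import all_boot all_fingroup.
From Stdlib Require Import Reals.
From Coquelicot Require Import Coquelicot.

Set Implicit Arguments.
Unset Strict Implicit.
Unset Printing Implicit Defensive.

Local Open Scope nat_scope.

(* A rooted non-plane forest on the node set 'I_n is given by its parent map,
   roots being mapped to None.  Unlabelled objects are isomorphism classes. *)
Definition parent_map (n : nat) := {ffun 'I_n -> option 'I_n}.

Section Forests.
Variable n : nat.
Implicit Types (p q : parent_map n) (r x : 'I_n).

(* Acyclicity: n steps towards the root leave the forest from every node. *)
Definition is_forest p : bool :=
  [forall x, iter n (obind p) (Some x) == None].

Definition roots p : {set 'I_n} := [set x | p x == None].

Definition is_iso p q (s : 'S_n) : bool :=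
  [forall x, q (s x) == omap s (p x)].

Definition isomorphic p q : bool := [exists s : 'S_n, is_iso p q s].

Definition Aut p : {set 'S_n} := [set s : 'S_n | is_iso p p s].

(* The nodes of the subtree of p hanging at r. *)
Definition subtree p r : {set 'I_n} :=
  [set x | [exists k : 'I_n, iter k (obind p) (Some x) == Some r]].

(* f restricts to an isomorphism of rooted trees from the tree at r to the
   tree at r'; its values outside the tree at r are irrelevant. *)
Definition is_tree_iso p r r' (f : {ffun 'I_n -> 'I_n}) : bool :=
  [&& f r == r', dinjectiveb f (subtree p r),
      f @: subtree p r == subtree p r' &
      [forall x in subtree p r, (x != r) ==> (p (f x) == omap f (p x))]].

Definition tree_isomorphic p r r' : bool :=
  [exists f : {ffun 'I_n -> 'I_n}, is_tree_iso p r r' f].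

(* A forest is the multiset of its trees, the multiplicity of the tree rooted
   at r being the number of roots whose tree is isomorphic to it. *)
Definition is_D_forest p : bool :=
  is_forest p &&
  [forall r in roots p,
     2 <= #|[set r' in roots p | tree_isomorphic p r r']|].

Definition weight p : R :=
  (INR #|[set s in Aut p | [forall x, s x != x]]| / INR #|Aut p|)%R.

Definition polya_trees : {set {set parent_map n}} :=
  equivalence_partition isomorphic
    [set p | is_forest p & #|roots p| == 1].

(* One representative of each isomorphism class of D-forests of size n. *)
Definition D_forests : {set parent_map n} :=
  transversal (equivalence_partition isomorphic [set p | is_D_forest p])
    [set p | is_D_forest p].

End Forests.

Local Open Scope R_scope.

Definition t (n : nat) : R := INR #|polya_trees n|.

Definition d (n : nat) : R := \big[Rplus/0]_(p in D_forests n) weight p.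

Definition d2 (n k : nat) : R :=
  \big[Rplus/0]_(p in D_forests n | #|roots p| == k) weight p.

Definition T (z : R) : R := PSeries t z.

Definition rho : R := real (CV_radius t).

Definition xi (z : R) : R :=
  exp (Series (fun j => T (z ^ (j + 3)) / INR (j + 3))).

Definition gamma (z : R) : R := Series (fun j => T (z ^ (j + 3))).

Definition mu0 : R :=
  (xi (sqrt rho) * gamma (sqrt rho) + xi (- sqrt rho) * gamma (- sqrt rho))
  / (xi (sqrt rho) + xi (- sqrt rho)).

Definition mu1 : R :=
  (xi (sqrt rho) * gamma (sqrt rho) - xi (- sqrt rho) * gamma (- sqrt rho))
  / (xi (sqrt rho) - xi (- sqrt rho)).

(* P [X_n = k] and E X_n. *)
Definition prob_X (n k : nat) : R := d2 n k / d n.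

Definition mean_X (n : nat) : R := Series (fun k => INR k * prob_X n k).

(* Main.v *)
(* Encode a rooted tree by the number of the sorted list of the codes of the
   subtrees hanging at its root; two forests are isomorphic iff their roots have
   the same multiset of codes.  An automorphism fixes a node iff it fixes a
   root, so the weight of a D-forest is the product, over the types of its
   trees, of the proportion of derangements of the trees of that type.  Hence
   D = exp (sum_(i >= 2) T(z^i)/i), and d_n E X_n is the coefficient of z^n in
   (sum_(i >= 2) T(z^i)) D.

   T solves T = x exp T with x = z D, so it is the tree function C = y exp C
   composed with x.  The coefficients of exp (C/2), rescaled by powers of e, are
   on the scale of those of - sqrt (1 - y), by an estimate of their quotients.
   Composition with x preserves this scale: e x(rho z) = Y has nonnegative
   coefficients of sum 1 and converges beyond 1, so 1 - Y = (1 - z)(1 + w) with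
   sqrt (1 + w) converging beyond 1.  The functions exp (T/2) and T exp (T/2)
   are on this scale with constants in the ratio 3 of their derivatives with
   respect to T at T(rho) = 1.  Since D = exp (T(z^2)/2) xi with xi and gamma
   converging beyond sqrt rho, the numerator and the denominator of E X_n are
   governed by the parts of gamma xi and xi of the parity of n at sqrt rho.

   If gamma(+-sqrt rho) = P +- Q and O is the odd part of log xi at sqrt rho,
   then mu0 = P + Q tanh O and mu1 = P + Q coth O.  Here rho is located by
   rho exp (1 + sum_(i >= 2) T(rho^i)/i) = 1; all series are enclosed by partial
   sums, with tails bounded geometrically by means of T(rho) <= 1. *)

(* All asymptotics come from inequalities between real coefficients, without contour integrals. D
   has two dominant singularities, at sqrt rho and - sqrt rho. Both come from T(z^2), so the
   coefficients of a fixed parity are convolutions in the variable z^2, where only the point rho is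
   left; this produces the two cases.

   The obstacle is the error term: a remainder known only by the size of its coefficients has to
   survive composition with Y. It is majorised by (1 - y)^(3/2), whose coefficients are positive
   from degree 2 on and of the order of the remainder. As Y has nonnegative coefficients,
   composition preserves the bound, and (1 - Y)^(3/2) is again (1 - z)^(3/2) times a series
   converging beyond 1.

   The ratio 3 is visible in T exp (T/2) = x exp (3T/2): the coefficients of y exp (3C/2) and exp
   (C/2) have the exact quotient 3 n/(n + 1/2).

   The numerical margin is set by mu1: O is about 0.09, so an error in O is amplified about 39 times
   in Q coth O; hence the tight enclosures of rho and O. *)
From Stdlib Require Import Reals Lra Lia ZArith.
From Stdlib Require Import FunctionalExtensionality IndefiniteDescription.
From Coquelicot Require Import Coquelicot.
From HB Require Import structures.
From mathcomp Require Import all_boot all_fingroup zify.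
Require Import Defs.

Set Implicit Arguments.
Unset Strict Implicit.
Unset Printing Implicit Defensive.

Local Open Scope R_scope.

(** * Finite sums and formal power series *)

HB.instance Definition _ := Monoid.isComLaw.Build R 0 Rplus
  (fun x y z => esym (Rplus_assoc x y z)) Rplus_comm Rplus_0_l.
HB.instance Definition _ := Monoid.isComLaw.Build R 1 Rmult
  (fun x y z => esym (Rmult_assoc x y z)) Rmult_comm Rmult_1_l.
HB.instance Definition _ := Monoid.isMulLaw.Build R 0 Rmult Rmult_0_l Rmult_0_r.
HB.instance Definition _ := Monoid.isAddLaw.Build R Rmult Rplus
  Rmult_plus_distr_r Rmult_plus_distr_l.

Notation "\sum_ ( i <- r | P ) F" := (\big[Rplus/0]_(i <- r | P%B) F) : R_scope.
Notation "\sum_ ( i <- r ) F" := (\big[Rplus/0]_(i <- r) F) : R_scope.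
Notation "\sum_ ( i : t | P ) F" := (\big[Rplus/0]_(i : t | P%B) F) : R_scope.
Notation "\sum_ ( i < n | P ) F" := (\big[Rplus/0]_(i < n | P%B) F) : R_scope.
Notation "\sum_ ( i < n ) F" := (\big[Rplus/0]_(i < n) F) : R_scope.
Notation "\sum_ ( i 'in' A ) F" := (\big[Rplus/0]_(i in A) F) : R_scope.
Notation "\sum_ ( i 'in' A | P ) F" := (\big[Rplus/0]_(i in A | P%B) F) : R_scope.
Notation "\prod_ ( i <- r ) F" := (\big[Rmult/1]_(i <- r) F) : R_scope.

Lemma sum_ge0 (I : Type) (r : seq I) (P : pred I) (F : I -> R) :
  (forall i, P i -> 0 <= F i) -> 0 <= \sum_(i <- r | P i) F i.
Proof. by move=> F0; elim/big_ind: _ => // *; lra. Qed.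

Lemma sum_le (I : Type) (r : seq I) (P : pred I) (F G : I -> R) :
  (forall i, P i -> F i <= G i) ->
  \sum_(i <- r | P i) F i <= \sum_(i <- r | P i) G i.
Proof.
move=> FG; elim/big_ind2: _ => [|x x' y y' Hx Hy|i /FG] //; lra.
Qed.

Lemma sum_abs (I : Type) (r : seq I) (P : pred I) (F : I -> R) :
  Rabs (\sum_(i <- r | P i) F i) <= \sum_(i <- r | P i) Rabs (F i).
Proof.
elim/big_ind2: _ => [|x x' y y' Hx Hy|i _]; first by rewrite Rabs_R0; lra.
  by apply: Rle_trans (Rabs_triang _ _) _; lra.
by lra.
Qed.

Lemma sumN (I : Type) (r : seq I) (P : pred I) (F : I -> R) :
  \sum_(i <- r | P i) - F i = - \sum_(i <- r | P i) F i.
Proof.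
elim/big_ind2: _ => [|x x' y y' -> ->|i _] //; lra.
Qed.

Lemma sumB (I : Type) (r : seq I) (P : pred I) (F G : I -> R) :
  \sum_(i <- r | P i) (F i - G i) =
  \sum_(i <- r | P i) F i - \sum_(i <- r | P i) G i.
Proof. by rewrite /Rminus -sumN -big_split. Qed.

Lemma sum_const (I : Type) (r : seq I) (c : R) :
  \sum_(i <- r) c = INR (size r) * c.
Proof.
elim: r => [|i r IH]; first by rewrite big_nil /=; lra.
by rewrite big_cons IH (S_INR (size r)); lra.
Qed.

Lemma sum_wid n m (F : nat -> R) :
  (n <= m)%N -> (forall i, (n <= i)%N -> (i < m)%N -> F i = 0) ->
  \sum_(i < m) F i = \sum_(i < n) F i.
Proof.
move=> nm F0; rewrite -!(big_mkord xpredT) (@big_cat_nat _ _ _ n) //=.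
rewrite [X in _ + X]big1_seq ?Rplus_0_r // => i /andP[_].
by rewrite mem_index_iota => /andP[]; exact: F0.
Qed.

Lemma sum_recr (F : nat -> R) n : \sum_(i < n.+1) F i = \sum_(i < n) F i + F n.
Proof. by rewrite big_ord_recr. Qed.

Lemma sum_one (F : nat -> R) (n k : nat) :
  \sum_(i < n) (if (i : nat) == k then F i else 0) = if (k < n)%N then F k else 0.
Proof.
rewrite -big_mkcond /=; case: ifP => kn.
  by rewrite (big_pred1 (Ordinal kn)).
by rewrite big_pred0 // => i; apply/eqP=> ik; move: (ltn_ord i); rewrite ik kn.
Qed.

Definition fps := nat -> R.

Definition fzero : fps := fun _ => 0.
Definition fone : fps := fun n => if n == 0%N then 1 else 0.
Definition fX : fps := fun n => if n == 1%N then 1 else 0.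
Definition fadd (a b : fps) : fps := fun n => a n + b n.
Definition fopp (a : fps) : fps := fun n => - a n.
Definition fsub (a b : fps) : fps := fun n => a n - b n.
Definition conv (a b : fps) : fps := fun n => \sum_(i < n.+1) a i * b (n - i)%N.
Definition fscal (c : R) (a : fps) : fps := fun n => c * a n.
Definition theta (a : fps) : fps := fun n => INR n * a n.

Lemma fps_ext (a b : fps) : (forall n, a n = b n) -> a = b.
Proof. exact: functional_extensionality. Qed.

Lemma convC (a b : fps) : conv a b = conv b a.
Proof.
apply: fps_ext => n; rewrite /conv (reindex_inj rev_ord_inj) /=.
apply: eq_bigr => i _; rewrite subSS subKn; last by rewrite -ltnS.
exact: Rmult_comm.
Qed.

Lemma convA (a b c : fps) : conv a (conv b c) = conv (conv a b) c.
Proof.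
apply: fps_ext => n; rewrite [in RHS]convC /conv.
pose F j k := a j * (b (n - k - j)%N * c k).
transitivity (\sum_(j < n.+1) \sum_(k < n.+1 | (k <= n - j)%N) F j k).
  apply: eq_bigr => /= j _; rewrite big_distrr /=.
  rewrite (reindex_inj rev_ord_inj) /=.
  rewrite (big_ord_narrow_leq (leq_subr _ _)) /=; apply: eq_bigr => k _.
  have := ltn_ord k; rewrite ltnS => kn; have := ltn_ord j; rewrite ltnS => jn.
  by rewrite /F; congr (_ * (b _ * c _)); lia.
rewrite (exchange_big_dep predT) //=; apply: eq_bigr => k _.
transitivity (\sum_(j < n.+1 | (j <= n - k)%N) F j k).
  by apply: eq_bigl => j; move: (ltn_ord j) (ltn_ord k) => *; lia.
rewrite (big_ord_narrow_leq (leq_subr _ _)) big_distrr /=.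
by apply: eq_bigr => j _; rewrite /F /=; ring.
Qed.

Lemma conv1l (a : fps) : conv fone a = a.
Proof.
apply: fps_ext => n; rewrite /conv big_ord_recl big1 => [|i _].
  by rewrite /= /fone eqxx subn0; ring.
by rewrite /fone lift0 /=; ring.
Qed.

Lemma convDl (a b c : fps) : conv (fadd a b) c = fadd (conv a c) (conv b c).
Proof.
apply: fps_ext => n; rewrite /fadd /conv -big_split.
by apply: eq_bigr => i _ /=; ring.
Qed.

Lemma fps_ring : ring_theory fzero fone fadd conv fsub fopp (@eq fps).
Proof.
split; try by move=> *; apply: fps_ext => n;
  rewrite /fadd /fzero /fsub /fopp; ring.
- exact: conv1l.
- exact: convC.
- exact: convA.
- exact: convDl.
Qed.
Add Ring fps_ring_inst : fps_ring.

Lemma fscalE c a : fscal c a = conv (fscal c fone) a.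
Proof.
rewrite -[in LHS](conv1l a); apply: fps_ext => n.
by rewrite /fscal /conv big_distrr /=; apply: eq_bigr => i _ /=; ring.
Qed.

Lemma fscal_convl c a b : conv (fscal c a) b = fscal c (conv a b).
Proof. by rewrite fscalE [RHS]fscalE; ring. Qed.

Lemma fscal_convr c a b : conv a (fscal c b) = fscal c (conv a b).
Proof. by rewrite fscalE [RHS]fscalE; ring. Qed.

Lemma conv0 (a b : fps) : conv a b 0%N = a 0%N * b 0%N.
Proof. by rewrite /conv big_ord_recl big_ord0 subn0 /=; ring. Qed.

Lemma conv_fX a n : conv fX a n = if n is m.+1 then a m else 0.
Proof.
case: n => [|n]; first by rewrite conv0 /fX /=; lra.
rewrite /conv (eq_bigr (fun i : 'I_n.+2 =>
  if (i : nat) == 1%N then a (n.+1 - i)%N else 0)); last first.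
  by move=> i _; rewrite /fX; case: eqP => _; lra.
by rewrite (sum_one (fun i => a (n.+1 - i)%N)) /= subn1.
Qed.

Lemma conv_ge0 a b n : (forall i, (i <= n)%N -> 0 <= a i) ->
  (forall i, (i <= n)%N -> 0 <= b i) -> 0 <= conv a b n.
Proof.
move=> a0 b0; apply: sum_ge0 => i _; apply: Rmult_le_pos.
  by apply: a0; rewrite -ltnS.
by apply: b0; rewrite leq_subr.
Qed.

Lemma conv_sum N (f : nat -> R) (v : nat -> fps) (w : fps) m :
  conv (fun i => \sum_(n < N) f n * v n i) w m =
  \sum_(n < N) f n * conv (v n) w m.
Proof.
rewrite /conv (eq_bigr (fun i : 'I_m.+1 =>
   \sum_(n < N) f n * (v n i * w (m - i)%N))); last first.
  by move=> i _; rewrite big_distrl /=; apply: eq_bigr => n _; ring.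
by rewrite exchange_big /=; apply: eq_bigr => n _; rewrite big_distrr.
Qed.

Lemma conv_eq_le (a a' b b' : fps) m :
  (forall i, (i <= m)%N -> a i = a' i) -> (forall i, (i <= m)%N -> b i = b' i) ->
  conv a b m = conv a' b' m.
Proof.
move=> aa' bb'; apply: eq_bigr => i _; rewrite aa' -1?ltnS //.
by rewrite bb' // leq_subr.
Qed.

Fixpoint fpow (u : fps) n : fps := if n is n'.+1 then conv u (fpow u n') else fone.

Lemma fpowD u m n : fpow u (m + n) = conv (fpow u m) (fpow u n).
Proof. by elim: m => [|m IH] /=; [rewrite conv1l | rewrite IH convA]. Qed.

Lemma fpow_conv u v n : fpow (conv u v) n = conv (fpow u n) (fpow v n).
Proof. by elim: n => [|n IH] /=; [rewrite conv1l | rewrite IH; ring]. Qed.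

Lemma fpow_scal c u n : fpow (fscal c u) n = fscal (c ^ n) (fpow u n).
Proof.
elim: n => [|n IH] /=; first by apply: fps_ext => i; rewrite /fscal; lra.
rewrite IH fscal_convl fscal_convr.
by apply: fps_ext => i; rewrite /fscal; lra.
Qed.

Lemma fpow_lt u n m : u 0%N = 0 -> (m < n)%N -> fpow u n m = 0.
Proof.
move=> u0; elim: n m => // n IH m mn /=; rewrite /conv big_ord_recl u0.
rewrite big1 => [|i _]; first by lra.
by rewrite IH ?Rmult_0_r // /= /bump; move: (ltn_ord i) => ?; lia.
Qed.

Lemma fpow_ge0 u n m : (forall i, (i <= m)%N -> 0 <= u i) -> 0 <= fpow u n m.
Proof.
move=> u0; elim: n m u0 => [|n IH] m u0 /=.
  by rewrite /fone; case: eqP => _; lra.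
apply: conv_ge0 => // i im; apply: IH => j ji.
exact: u0 (leq_trans ji im).
Qed.

Lemma fpowX n m : fpow fX n m = if m == n then 1 else 0.
Proof.
by elim: n m => [|n IH] m //=; rewrite conv_fX; case: m.
Qed.

Lemma conv_fpowX n f m : conv (fpow fX n) f m = if (n <= m)%N then f (m - n)%N else 0.
Proof.
elim: n m => [|n IH] m /=; first by rewrite conv1l subn0.
by rewrite -convA conv_fX; case: m => // m; rewrite IH ltnS subSS.
Qed.

(** The series f(u). The sum stops at n = m, which is right when [u 0 = 0], since u^n then starts at
    degree n. *)
Definition comp (f u : fps) : fps := fun m => \sum_(n < m.+1) f n * fpow u n m.

Lemma comp_box f u N m : u 0%N = 0 -> (m <= N)%N ->
  comp f u m = \sum_(n < N.+1) f n * fpow u n m.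
Proof.
move=> u0 mN; rewrite /comp (@sum_wid m.+1 N.+1 (fun n => f n * fpow u n m)) //.
by move=> i mi _; rewrite fpow_lt //; lra.
Qed.

Lemma comp0 f u : comp f u 0%N = f 0%N.
Proof. by rewrite /comp big_ord_recl big_ord0 /= /fone /=; lra. Qed.

Lemma comp_fX u : u 0%N = 0 -> comp fX u = u.
Proof.
move=> u0; apply: fps_ext => -[|m]; first by rewrite comp0 u0.
rewrite /comp (eq_bigr (fun i : 'I_m.+2 =>
   if (i : nat) == 1%N then fpow u i m.+1 else 0)); last first.
  by move=> i _; rewrite /fX; case: eqP => _; lra.
by rewrite (sum_one (fun i => fpow u i m.+1)) /= convC conv1l.
Qed.

Lemma comp_fone u : comp fone u = fone.
Proof.
apply: fps_ext => m.
rewrite /comp (eq_bigr (fun i : 'I_m.+1 =>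
   if (i : nat) == 0%N then fpow u i m else 0)); last first.
  by move=> i _; rewrite /fone; case: eqP => _; lra.
by rewrite (sum_one (fun i => fpow u i m)).
Qed.

Lemma comp_scal c f u : comp (fscal c f) u = fscal c (comp f u).
Proof.
apply: fps_ext => m; rewrite /comp /fscal big_distrr /=.
by apply: eq_bigr => i _; ring.
Qed.

Lemma comp_sub f g u : comp (fsub f g) u = fsub (comp f u) (comp g u).
Proof.
apply: fps_ext => m; rewrite /comp /fsub -sumB /=.
by apply: eq_bigr => i _; ring.
Qed.

(** Both sides sum f_a g_b [z^m] u^(a+b) over the box a, b <= m: the pairs with a + b > m contribute
    nothing because [u 0 = 0]. *)
Lemma comp_conv f g u : u 0%N = 0 ->
  comp (conv f g) u = conv (comp f u) (comp g u).
Proof.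
move=> u0; apply: fps_ext => m.
transitivity (\sum_(a < m.+1) \sum_(b < m.+1) f a * (g b * fpow u (a + b) m)).
  rewrite /comp /conv.
  pose F a n := f a * (g (n - a)%N * fpow u n m).
  transitivity (\sum_(n < m.+1) \sum_(a < m.+1 | (a <= n)%N) F a n).
    apply: eq_bigr => n _; rewrite big_distrl /=.
    have nm : (n <= m)%N by rewrite -ltnS.
    rewrite (big_ord_narrow_leq nm) /=.
    by apply: eq_bigr => i _; rewrite /F /=; ring.
  rewrite (exchange_big_dep predT) //=; apply: eq_bigr => a _.
  have am : (a <= m)%N by rewrite -ltnS.
  rewrite -[RHS](big_mkord xpredT (fun b => f a * (g b * fpow u (a + b) m))).
  rewrite -(@big_mkord _ _ _ m.+1 (fun n => (a <= n)%N) (fun n => F a n)).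
  rewrite (@big_cat_nat _ _ _ a) //= ?(leqW am) //.
  rewrite [X in X + _]big_nat_cond [X in X + _]big1 ?Rplus_0_l; last first.
    by move=> i /andP[/andP[_ ia]]; rewrite leqNgt ia.
  rewrite [RHS](@big_cat_nat _ _ _ (m.+1 - a)%N) //= ?leq_subr //.
  rewrite [X in _ = _ + X]big_nat_cond [X in _ = _ + X]big1 ?Rplus_0_r; last first.
    by move=> i /andP[/andP[Hi _] _]; rewrite fpow_lt //; [lra | lia].
  rewrite -{1}[nat_of_ord a]add0n big_addn big_nat_cond [RHS]big_nat_cond.
  apply: eq_big => [i|i _]; first by rewrite leq_addl andbT.
  by rewrite /F addnK addnC.
rewrite /conv [RHS](eq_bigr (fun i : 'I_m.+1 => \sum_(a < m.+1) \sum_(b < m.+1)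
    f a * (g b * (fpow u a i * fpow u b (m - i)%N)))); last first.
  move=> i _; have im : (i <= m)%N by rewrite -ltnS.
  rewrite (comp_box f u0 im) (comp_box g u0 (leq_subr i m)) big_distrl /=.
  by apply: eq_bigr => a _; rewrite big_distrr /=; apply: eq_bigr => b _; ring.
rewrite [RHS]exchange_big /=; apply: eq_bigr => a _; rewrite [RHS]exchange_big /=.
apply: eq_bigr => b _; rewrite fpowD /conv !big_distrr /=.
by apply: eq_bigr => i _; ring.
Qed.

(** * Euler derivative, first-order equations and exponentials *)

Lemma theta_0 u : theta u 0%N = 0.
Proof. by rewrite /theta /=; lra. Qed.

Lemma theta_conv a b : theta (conv a b) = fadd (conv (theta a) b) (conv a (theta b)).
Proof.
apply: fps_ext => n; rewrite /theta /fadd /conv big_distrr -big_split /=.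
apply: eq_bigr => i _; rewrite minus_INR; first by ring.
by have := ltn_ord i; lia.
Qed.

Lemma theta_fpow u n :
  theta (fpow u n.+1) = fscal (INR n.+1) (conv (fpow u n) (theta u)).
Proof.
elim: n => [|n IH].
  rewrite /= (convC u) !conv1l.
  by apply: fps_ext => i; rewrite /fscal; lra.
have E k : fpow u k.+1 = conv u (fpow u k) by [].
rewrite (E n.+1) theta_conv IH fscal_convr (convA u) -E (convC (theta u)).
apply: fps_ext => i; rewrite /fscal /fadd (S_INR n.+1); ring.
Qed.

Definition fderiv (f : fps) : fps := fun n => INR n.+1 * f n.+1.

Lemma theta_comp f u : u 0%N = 0 -> theta (comp f u) = conv (comp (fderiv f) u) (theta u).
Proof.
move=> u0; apply: fps_ext => m.
transitivity (\sum_(n < m.+1) fderiv f n * conv (fpow u n) (theta u) m); last first.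
  rewrite -conv_sum; apply: conv_eq_le => // i im.
  by rewrite (comp_box _ u0 im).
rewrite /theta /comp big_distrr /=.
rewrite (eq_bigr (fun n : 'I_m.+1 => f n * theta (fpow u n) m)); last first.
  by move=> i _; rewrite /theta; ring.
rewrite big_ord_recl [in RHS]big_ord_recr /=.
rewrite [X in _ = _ + X](_ : _ = 0); last first.
  rewrite /conv big1 ?Rmult_0_r // => i _.
  have := ltn_ord i; rewrite ltnS leq_eqVlt => /orP[/eqP->|lim].
    by rewrite subnn /=; ring.
  by rewrite fpow_lt //; ring.
rewrite (_ : theta fone m = 0) ?Rmult_0_r ?Rplus_0_l ?Rplus_0_r; last first.
  by rewrite /theta /fone; case: eqP => [->|_] /=; lra.
apply: eq_bigr => i _; rewrite /bump leq0n add1n theta_fpow /fderiv /fscal.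
by rewrite /theta add0n; ring.
Qed.

(** As [l 0 = 0], the equation at degree n expresses n F_n through the F_i with i < n. Comparing l
    and l' only up to N suits the finite alphabets [tree_codes N] below, for which identities hold
    up to degree N. *)
Lemma ode_uniq_le (l l' F G : fps) N : l 0%N = 0 ->
  (forall i, (i <= N)%N -> l i = l' i) ->
  theta F = conv l F -> theta G = conv l' G -> F 0%N = G 0%N ->
  forall n, (n <= N)%N -> F n = G n.
Proof.
move=> l0 ll' FE GE FG0; elim/ltn_ind => n IH nN.
case: n IH nN => // n IH nN.
have E1 := congr1 (fun a : fps => a n.+1) FE.
have E2 := congr1 (fun a : fps => a n.+1) GE.
have : INR n.+1 * F n.+1 = INR n.+1 * G n.+1.
  move: E1 E2; rewrite /theta => -> ->; apply: eq_bigr => i _.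
  case: (posnP i) => [i0|i0]; first by rewrite i0 -ll' // l0; ring.
  rewrite ll' ?IH //; try by have := ltn_ord i; lia.
by move=> H; apply: (Rmult_eq_reg_l _ _ _ H); apply: not_0_INR.
Qed.

Lemma ode_uniq (l F G : fps) : l 0%N = 0 ->
  theta F = conv l F -> theta G = conv l G -> F 0%N = G 0%N -> F = G.
Proof.
by move=> l0 FE GE FG; apply: fps_ext => n; exact: (@ode_uniq_le l l F G n).
Qed.

Definition expc (c : R) : fps := fun n => c ^ n / INR (fact n).

Definition Ex (u : fps) : fps := comp (expc 1) u.

Lemma fderiv_expc c : fderiv (expc c) = fscal c (expc c).
Proof.
apply: fps_ext => n; rewrite /fderiv /fscal /expc fact_simpl mult_INR.
have H1 := INR_fact_neq_0 n; have H2 : INR n.+1 <> 0 by apply: not_0_INR.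
by rewrite [_ ^ n.+1]/=; field.
Qed.

Lemma theta_Ex u : u 0%N = 0 -> theta (Ex u) = conv (theta u) (Ex u).
Proof.
move=> u0; rewrite /Ex theta_comp // fderiv_expc convC.
by congr (conv _ (comp _ _)); apply: fps_ext => n; rewrite /fscal; lra.
Qed.

Lemma Ex0 u : Ex u 0%N = 1.
Proof. by rewrite /Ex comp0 /expc /=; field. Qed.

Lemma Ex_add u v : u 0%N = 0 -> v 0%N = 0 -> Ex (fadd u v) = conv (Ex u) (Ex v).
Proof.
move=> u0 v0; apply: (@ode_uniq (theta (fadd u v))); first exact: theta_0.
- by apply: theta_Ex; rewrite /fadd u0 v0; lra.
- rewrite theta_conv !theta_Ex //.
  rewrite (_ : theta (fadd u v) = fadd (theta u) (theta v)); first by ring.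
  by apply: fps_ext => n; rewrite /theta /fadd; ring.
- by rewrite conv0 !Ex0; lra.
Qed.

Lemma Ex_fzero : Ex fzero = fone.
Proof.
apply: (@ode_uniq fzero) => //.
- by rewrite theta_Ex // (_ : theta fzero = fzero) //; apply: fps_ext => n; rewrite /theta /fzero; lra.
- apply: fps_ext => n; rewrite convC /conv big1 => [|i _]; last by rewrite /fzero; lra.
  by rewrite /theta /fone; case: eqP => [->|_] /=; lra.
- by rewrite Ex0.
Qed.

Lemma Ex_scal c u : Ex (fscal c u) = comp (expc c) u.
Proof.
apply: fps_ext => m; rewrite /Ex /comp; apply: eq_bigr => i _.
by rewrite fpow_scal /fscal /expc pow1; field; exact: INR_fact_neq_0.
Qed.

Lemma Ex_pow u n : u 0%N = 0 -> fpow (Ex u) n = Ex (fscal (INR n) u).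
Proof.
move=> u0; elim: n => [|n IH].
  rewrite /= (_ : fscal 0 u = fzero) ?Ex_fzero //.
  by apply: fps_ext => n; rewrite /fscal /fzero; lra.
rewrite [fpow _ _]/= IH -Ex_add //; last by rewrite /fscal u0; lra.
by congr Ex; apply: fps_ext => i; rewrite /fadd /fscal S_INR; lra.
Qed.

(** * Dilation and rescaling *)

(** The series a(z^i). For i = 0 only the constant term survives, since 0 divides only 0. *)
Definition dil (i : nat) (a : fps) : fps :=
  fun n => if (i %| n)%N then a (n %/ i)%N else 0.

Lemma dil_sum i a n (b : nat -> R) : (0 < i)%N ->
  \sum_(j < (i * n).+1) dil i a j * b j = \sum_(j < n.+1) a j * b (i * j)%N.
Proof.
move=> i0; elim: n => [|n IH].
  by rewrite muln0 !big_ord1 /dil dvdn0 div0n muln0.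
rewrite [RHS]big_ord_recr /= -IH mulnS.
rewrite -(big_mkord xpredT (fun j => dil i a j * b j)).
rewrite -(big_mkord xpredT (fun j => dil i a j * b j)).
rewrite (@big_cat_nat _ _ _ (i * n).+1) //=; last by rewrite ltnS leq_addl.
congr (_ + _); rewrite big_nat_recr /=; last by lia.
rewrite big_nat_cond big1 ?Rplus_0_l => [|j /andP[/andP[H1 H2] _]].
  by rewrite /dil -mulnS dvdn_mulr // mulKn.
rewrite /dil; case: ifP => [/dvdnP[k E]|_]; last by lra.
have nk : (n < k)%N by rewrite -(ltn_pmul2l i0) [(i * k)%N]mulnC -E.
have : (k < n.+1)%N by rewrite -(ltn_pmul2l i0) [(i * k)%N]mulnC -E mulnS.
by rewrite ltnS leqNgt nk.
Qed.

Lemma dil_conv i a b : (0 < i)%N -> dil i (conv a b) = conv (dil i a) (dil i b).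
Proof.
move=> i0; apply: fps_ext => n; rewrite {1}/dil; case: ifP => [/dvdnP[m ->]|ni].
  rewrite mulnK // /conv mulnC (dil_sum a m (fun j => dil i b (i * m - j)%N)) //.
  by apply: eq_bigr => j _; rewrite /dil -mulnBr dvdn_mulr // mulKn.
rewrite /conv big1 // => j _; rewrite /dil; case: ifP => ij; last by lra.
case: ifP => ij'; last by lra.
have jn : (j <= n)%N by rewrite -ltnS.
have := dvdn_add ij' ij; rewrite subnK // ni; discriminate.
Qed.

Lemma dil_fpow i u n : (0 < i)%N -> dil i (fpow u n) = fpow (dil i u) n.
Proof.
move=> i0; elim: n => [|n IH] /=; last by rewrite dil_conv // IH.
apply: fps_ext => n; rewrite /dil /fone; case: ifP => [/dvdnP[k ->]|].
  by rewrite mulnK // muln_eq0 (gtn_eqF i0) orbF.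
by case: eqP => // ->; rewrite dvdn0.
Qed.

Lemma dil_comp i f u : (0 < i)%N -> u 0%N = 0 -> dil i (comp f u) = comp f (dil i u).
Proof.
move=> i0 u0; have du0 : dil i u 0%N = 0 by rewrite /dil dvdn0 div0n.
apply: fps_ext => m.
rewrite {2}/comp (eq_bigr (fun n : 'I_m.+1 => f n * dil i (fpow u n) m)); last first.
  by move=> n _; rewrite dil_fpow.
rewrite /dil; case: ifP => [im|_]; last by rewrite big1 // => n _; lra.
by apply: comp_box => //; exact: leq_div.
Qed.

(** The series a(cz); summing it is evaluating a at c. *)
Definition sc (c : R) (a : fps) : fps := fun n => a n * c ^ n.

Lemma sc_conv c a b : sc c (conv a b) = conv (sc c a) (sc c b).
Proof.
apply: fps_ext => n; rewrite /sc /conv big_distrl /=.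
apply: eq_bigr => i _; have in_ : (i <= n)%N by rewrite -ltnS.
have -> : c ^ n = c ^ i * c ^ (n - i) by rewrite -pow_add; congr (c ^ _); lia.
ring.
Qed.

Lemma sc_fpow c u n : sc c (fpow u n) = fpow (sc c u) n.
Proof.
elim: n => [|n IH] /=; last by rewrite sc_conv IH.
by apply: fps_ext => n; rewrite /sc /fone; case: eqP => [->|_] /=; lra.
Qed.

Lemma sc_comp c f u : sc c (comp f u) = comp f (sc c u).
Proof.
apply: fps_ext => m; rewrite {1}/sc /comp big_distrl /=.
by apply: eq_bigr => i _; rewrite -sc_fpow /sc; ring.
Qed.

Local Open Scope nat_scope.

(** * Codes of rooted trees *)

Section Acyclic.
Variables (X : finType) (p : X -> option X).

(** The number of steps is left open, so that the notion applies to the node types built by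
    grafting; [acyclic_height] recovers the number of nodes as a bound. *)
Definition acyclic := exists N, forall x, iter N (obind p) (Some x) = None.

Definition children (w : option X) : seq X := [seq y <- enum X | p y == w].

Lemma mem_children w y : (y \in children w) = (p y == w).
Proof. by rewrite mem_filter mem_enum andbT. Qed.

Lemma children_uniq w : uniq (children w).
Proof. exact: filter_uniq (enum_uniq _). Qed.

Lemma iter_obindNone k : iter k (obind p) None = None.
Proof. by elim: k => //= k ->. Qed.

Lemma parent_ind (P : X -> Prop) : acyclic ->
  (forall x, (forall y, p x = Some y -> P y) -> P x) -> forall x, P x.
Proof.
move=> [N acy] H x; move: (acy x); elim: N {acy} x => // N IH x.
by rewrite iterSr /= => E; apply: H => y pxy; apply: IH; rewrite -pxy.
Qed.

Lemma child_ind (P : X -> Prop) : acyclic ->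
  (forall x, (forall y, p y = Some x -> P y) -> P x) -> forall x, P x.
Proof.
move=> [N acy] H x.
have C0 : forall y, iter N (obind p) (Some y) <> Some x by move=> y; rewrite acy.
elim: N {acy} x C0 => [|N IH] x C; first by have := C x.
apply: H => y pyx; apply: IH => z Ez; apply: (C z).
by rewrite iterS Ez.
Qed.

(** Recursion along the path to the root: the value stops depending on the fuel once the fuel
    exhausts that path, and N steps exhaust all of them. *)
Lemma parent_rec (Y : Type) (F : X -> option Y -> Y) : acyclic ->
  exists f : X -> Y, forall x, f x = F x (omap f (p x)).
Proof.
move=> [N acy].
pose fix f (h : nat) x {struct h} := if h is h'.+1 then F x (omap (f h') (p x)) else F x None.
have stable h x : iter h (obind p) (Some x) = None -> f h x = f h.+1 x.
  elim: h x => // h IH x; rewrite iterSr /=.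
  by case pxy: (p x) => [y|] //= E; rewrite (IH y E).
by exists (f N) => x; rewrite stable.
Qed.

(** Along the path from x to its root the depth takes every value from [dep x] down to 1, so there
    are at least [dep x] nodes. *)
Lemma acyclic_height : acyclic -> forall x, iter #|X| (obind p) (Some x) = None.
Proof.
move=> acy x.
have [dep depE] := @parent_rec nat (fun _ o => if o is Some k then k.+1 else 1) acy.
have iter_dep : iter (dep x) (obind p) (Some x) = None.
  move: x; apply: (parent_ind acy) => x IH; rewrite depE.
  by case pxy: (p x) => [y|] /=; [rewrite -iterS iterSr /= pxy IH | rewrite pxy].
have hit k : k < dep x -> exists y, dep y == k.+1.
  move: x k {iter_dep}; apply: (parent_ind acy) => x IH k; rewrite depE.
  case pxy: (p x) => [y|] /= kd; last first.
    by exists x; rewrite depE pxy; case: k kd.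
  move: kd; rewrite ltnS leq_eqVlt => /orP[/eqP->|]; last exact: IH.
  by exists x; rewrite depE pxy.
have [f fE] := fin_all_exists (fun k : 'I_(dep x) => hit k (ltn_ord k)).
have f_inj : injective f.
  move=> i j fij; apply: val_inj; move: (fE i) (fE j).
  by rewrite fij => /eqP -> /eqP [].
have := leq_card f f_inj; rewrite card_ord => /subnK <-.
by rewrite iterD iter_dep iter_obindNone.
Qed.

(** An equation rather than a function, so that codings on different node types or with different
    fuel can be compared directly. *)
Definition is_coding (c : X -> nat) : Prop :=
  forall x, c x = CodeSeq.code (sort leq [seq c y | y <- children (Some x)]).

Fixpoint ncode h x : nat :=
  if h is h'.+1 then
    CodeSeq.code (sort leq [seq ncode h' y | y <- children (Some x)])
  else 0.

(** Fuel h suffices at x as soon as no node reaches x in exactly h steps. *)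
Lemma ncode_coding N :
  (forall x, iter N (obind p) (Some x) = None) -> is_coding (ncode N).
Proof.
move=> acy; have stable h x :
    (forall y, iter h (obind p) (Some y) <> Some x) -> ncode h x = ncode h.+1 x.
  elim: h x => [|h IH] x C; first by have := C x.
  rewrite [LHS]/= [RHS]/=; congr (CodeSeq.code (sort _ _)).
  apply/eq_in_map => y; rewrite mem_children => /eqP pyx.
  by apply: IH => z Ez; apply: (C z); rewrite iterS Ez.
by move=> x; rewrite stable // => y; rewrite acy.
Qed.

End Acyclic.

Lemma sort_leqP (s1 s2 : seq nat) :
  reflect (sort leq s1 = sort leq s2) (perm_eq s1 s2).
Proof. exact: perm_sortP leq_total leq_trans anti_leq s1 s2. Qed.

(** A code depends only on the subtree below its node: f maps the children of x onto those of f x,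
    so the codes agree by induction from the leaves. This serves isomorphisms, automorphisms,
    grafting and renumbering alike. *)
Lemma coding_embed (X Y : finType) (p : X -> option X) (q : Y -> option Y) c c'
    (f : X -> Y) : acyclic p -> is_coding p c -> is_coding q c' -> injective f ->
  (forall x y, q y = Some (f x) <-> exists2 z, y = f z & p z = Some x) ->
  forall x, c' (f x) = c x.
Proof.
move=> acy cE c'E f_inj fE; apply: (child_ind acy) => x IH.
rewrite c'E cE; congr CodeSeq.code; apply/sort_leqP.
rewrite (_ : [seq c y | y <- _] = [seq c' y | y <- [seq f y | y <- children p (Some x)]]).
  apply: perm_map; apply: uniq_perm; first exact: children_uniq.
    by rewrite map_inj_uniq // children_uniq.
  move=> y; rewrite mem_children; apply/eqP/mapP => [/fE[z -> pz]|[z]].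
    by exists z => //; rewrite mem_children pz.
  by rewrite mem_children => /eqP pz ->; apply/fE; exists z.
rewrite -map_comp; apply/eq_in_map => y; rewrite mem_children => /eqP pyx /=.
by rewrite IH.
Qed.

(* h is fuel; it suffices that h exceeds c. *)
Fixpoint sizef h c : nat :=
  if h is h'.+1 then (sumn [seq sizef h' j | j <- CodeSeq.decode c]).+1 else 0.

Definition csize c := sizef c.+1 c.

Fixpoint canonf h c : bool :=
  if h is h'.+1 then
    path.sorted leq (CodeSeq.decode c) && all (canonf h') (CodeSeq.decode c)
  else true.

(* Sorted at every level: these are exactly the codes of nodes of forests. *)
Definition canonical c := canonf c.+1 c.

(** This makes fuel [c.+1] enough for [csize] and [canonical]: the argument drops strictly at each
    level. *)
Lemma decode_lt c j : j \in CodeSeq.decode c -> j < c.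
Proof.
move=> jc; have := CodeSeq.ltn_code (CodeSeq.decode c).
by rewrite CodeSeq.decodeK => /allP/(_ j jc).
Qed.

Lemma sizef_fuel h h' c : c < h -> c < h' -> sizef h c = sizef h' c.
Proof.
elim: h h' c => // h IH [|h'] c //= ch ch'; congr (sumn _).+1.
apply/eq_in_map => j /decode_lt jc; apply: IH; lia.
Qed.

Lemma canonf_fuel h h' c : c < h -> c < h' -> canonf h c = canonf h' c.
Proof.
elim: h h' c => // h IH [|h'] c //= ch ch'; congr (_ && _).
by apply: eq_in_all => j /decode_lt jc; apply: IH; lia.
Qed.

Lemma csize_code s : csize (CodeSeq.code s) = (sumn [seq csize j | j <- s]).+1.
Proof.
rewrite /csize [LHS]/= CodeSeq.codeK; congr (sumn _).+1.
apply/eq_in_map => j js; apply: sizef_fuel => //.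
by apply: decode_lt; rewrite CodeSeq.codeK.
Qed.

Lemma canonical_code s :
  canonical (CodeSeq.code s) = path.sorted leq s && all canonical s.
Proof.
rewrite /canonical [LHS]/= CodeSeq.codeK; congr (_ && _).
apply: eq_in_all => j js; apply: canonf_fuel => //.
by apply: decode_lt; rewrite CodeSeq.codeK.
Qed.

Lemma csize_gt0 c : 0 < csize c.
Proof. by rewrite -(CodeSeq.decodeK c) csize_code. Qed.

Lemma sort_leq_sorted s : path.sorted leq (sort leq s).
Proof. exact: sort_sorted leq_total s. Qed.

Lemma coding_canonical (X : finType) (p : X -> option X) c :
  acyclic p -> is_coding p c -> forall x, canonical (c x).
Proof.
move=> acy cE; apply: (child_ind acy) => x IH.
rewrite cE canonical_code sort_leq_sorted all_sort; apply/allP => _ /mapP[y + ->].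
by rewrite mem_children => /eqP; apply: IH.
Qed.

(** The size of a tree is 1 plus the sizes of the subtrees at its root. Summed over all nodes, every
    non-root appears once on the right as a child; cancelling these terms leaves the roots. *)
Lemma coding_size (X : finType) (p : X -> option X) c : is_coding p c ->
  sumn [seq csize (c x) | x <- children p None] = #|X|.
Proof.
move=> cE.
have childrenE w (F : X -> nat) :
    sumn [seq F x | x <- children p w] = \sum_(x | p x == w) F x.
  by rewrite sumnE big_map /children big_filter big_enum_cond.
have : \sum_x csize (c x) = #|X| + \sum_(x | p x != None) csize (c x).
  rewrite (eq_bigr (fun x => 1 + \sum_(y | p y == Some x) csize (c y))).
    rewrite big_split /= sum1_card; congr (_ + _).
    rewrite (exchange_big_dep (fun y => p y != None)) /=.
      apply: eq_bigr => y; case: (p y) => // x _.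
      by rewrite (big_pred1 x) // => z; rewrite (inj_eq Some_inj) eq_sym.
    by move=> x y _ /eqP ->.
  move=> x _; rewrite [in LHS]cE csize_code add1n -childrenE; congr S.
  rewrite (map_comp csize c) !sumnE; apply: perm_big; apply: perm_map.
  by rewrite perm_sort.
rewrite childrenE (bigID (fun x => p x == None)) /=; lia.
Qed.

Section Graft.
Variables (X Y : finType) (p : X -> option X) (q : Y -> option Y).

(* The trees of p are hung at a new root, next to the forest q. *)
Definition graft (z : option X + Y) : option (option X + Y) :=
  match z with
  | inl None => None
  | inl (Some x) => Some (inl (p x))
  | inr y => omap inr (q y)
  end.

Lemma graft_acyclic : acyclic p -> acyclic q -> acyclic graft.
Proof.
move=> [N acyN] [M acyM]; exists (N.+1 + M)%N.
have iterY k o : iter k (obind graft) (omap inr o) = omap inr (iter k (obind q) o).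
  by elim: k => //= k ->; case: (iter _ _ _).
have iterX k x : iter k (obind p) (Some x) = None ->
    iter k.+1 (obind graft) (Some (inl (Some x))) = None.
  elim: k x => // k IH x; rewrite iterSr [obind _ _]/= => H; rewrite iterSr [obind _ _]/=.
  case: (p x) H => [y|] H; first exact: IH.
  by rewrite iterSr /= iter_obindNone.
case=> [[x|]|y]; rewrite addnC iterD.
- by rewrite iterX // iter_obindNone.
- by rewrite iterSr /= !iter_obindNone.
- rewrite -iterD addnC iterD -[Some (inr y)]/(omap inr (Some y)) iterY acyM.
  by rewrite iter_obindNone.
Qed.

Lemma graft_codes cp cq c : acyclic p -> acyclic q ->
  is_coding p cp -> is_coding q cq -> is_coding graft c ->
  perm_eq [seq c z | z <- children graft None]
    (CodeSeq.code (sort leq [seq cp x | x <- children p None])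
       :: [seq cq y | y <- children q None]).
Proof.
move=> acyp acyq cpE cqE cE.
have c_p x : c (inl (Some x)) = cp x.
  apply: (coding_embed (f := fun x => inl (Some x)) acyp cpE cE).
    by move=> ? ? [].
  move=> x0 [[y|]|y] /=; split=> [|[z] //].
  - by case=> E; exists y.
  - by case=> -> /= ->.
  - by [].
  - by case: (q y).
have c_q y : c (inr y) = cq y.
  apply: (coding_embed (f := inr) acyq cqE cE); first by move=> ? ? [].
  move=> y0 [[y1|]|y1] /=; split=> [|[z] //] //.
  - by case E: (q y1) => [y2|] //= [<-]; exists y1.
  - by case=> -> /= ->.
have c_r : c (inl None) = CodeSeq.code (sort leq [seq cp x | x <- children p None]).
  rewrite cE; congr CodeSeq.code; apply/sort_leqP.
  rewrite -(eq_map c_p) (map_comp c (fun x => inl (Some x))); apply: perm_map.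
  apply: uniq_perm; first exact: children_uniq.
    by rewrite map_inj_uniq ?children_uniq // => ? ? [].
  case=> [[y|]|y]; rewrite mem_children /=.
  - rewrite (mem_map (_ : injective (fun x => inl (Some x)))); last by move=> ? ? [].
    by rewrite mem_children; apply/eqP/eqP => [[]|->].
  - by symmetry; apply/negP => /mapP[].
  - by rewrite (_ : _ == _ = false); [symmetry; apply/negP => /mapP[] | case: (q y)].
rewrite -c_r -(eq_map c_q) (map_comp c inr) -map_cons; apply: perm_map.
apply: uniq_perm; first exact: children_uniq.
  rewrite cons_uniq map_inj_uniq ?children_uniq ?andbT; last by move=> ? ? [].
  by apply/negP => /mapP[].
case=> [[y|]|y]; rewrite mem_children inE //=.
- by symmetry; apply/negP => /mapP[].
- rewrite (mem_map (_ : injective inr)); last by move=> ? ? [].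
  by rewrite mem_children; case: (q y).
Qed.

End Graft.

(** Induction on the total size: the first code is realized from its decoded list and grafted next
    to a realization of the remaining codes. *)
Lemma realize (s : seq nat) : all canonical s ->
  exists (X : finType) (p : X -> option X) (c : X -> nat),
    [/\ acyclic p, is_coding p c & perm_eq [seq c x | x <- children p None] s].
Proof.
move: {2}(sumn [seq csize j | j <- s]) (leqnn (sumn [seq csize j | j <- s])) => n.
elim: n s => [|n IH] [|a s] //=.
- move=> _ _; exists void, (fun _ => None), (fun _ => 0).
  split; [by exists 0; case | by case | ].
  by rewrite /children enumT /= (_ : Finite.enum void = [::]) //; apply/nilP; rewrite /nilp -enumT -cardE card_void.
- move=> _ _; exists void, (fun _ => None), (fun _ => 0).
  split; [by exists 0; case | by case | ].
  by rewrite /children enumT /= (_ : Finite.enum void = [::]) //; apply/nilP; rewrite /nilp -enumT -cardE card_void.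
have aE := esym (CodeSeq.decodeK a); set l := CodeSeq.decode a in aE.
rewrite aE csize_code canonical_code addSn ltnS => szs /andP[/andP[lsort lcan] scan].
have [X [p [cp [acyp cpE permp]]]] := IH l (leq_trans (leq_addr _ _) szs) lcan.
have [Y [q [cq [acyq cqE permq]]]] := IH s (leq_trans (leq_addl _ _) szs) scan.
have [N acyN] := graft_acyclic acyp acyq.
exists (option X + Y)%type, (graft p q), (ncode (graft p q) N).
have cE := ncode_coding acyN.
split=> //; first by exists N.
apply: perm_trans (graft_codes acyp acyq cpE cqE cE) _.
move/sort_leqP: permp => ->.
by rewrite (sorted_sort leq_trans lsort) perm_cons.
Qed.

(** Greedy matching: the head of s1 takes an element of equal code, which is then removed from s2.
    Outside s1 the map takes the default value [y0]. *)
Lemma code_match (X Y : eqType) (c : X -> nat) (c' : Y -> nat) (y0 : Y)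
    (s1 : seq X) (s2 : seq Y) : uniq s1 -> uniq s2 ->
  perm_eq [seq c x | x <- s1] [seq c' y | y <- s2] ->
  exists f : X -> Y,
    {in s1, forall x, f x \in s2 /\ c' (f x) = c x} /\ {in s1 &, injective f}.
Proof.
elim: s1 s2 => [|x s1 IH] s2 /=; first by exists (fun=> y0).
move=> /andP[xs1 us1] us2 perm12.
have : c x \in [seq c' y | y <- s2] by rewrite -(perm_mem perm12) mem_head.
case/mapP => y ys2 cxy.
have perm' : perm_eq [seq c x | x <- s1] [seq c' y | y <- rem y s2].
  rewrite -(perm_cons (c x)); apply: perm_trans perm12 _.
  by rewrite cxy -map_cons; apply: perm_map; exact: perm_to_rem.
have [f [fs2 finj]] := IH _ us1 (rem_uniq y us2) perm'.
exists (fun z => if z == x then y else f z).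
have fy z : z \in s1 -> f z != y.
  by move=> /fs2[+ _]; rewrite (mem_rem_uniq y us2) inE => /andP[].
have nx z : z \in s1 -> (z == x) = false.
  by move=> zs1; apply/eqP => zx; rewrite -zx zs1 in xs1.
split=> [z|z1 z2].
  rewrite inE; case: eqP => [-> _|_ /= zs1]; first by [].
  by have [/mem_rem ? ?] := fs2 z zs1.
rewrite !inE; case: eqP => [->|_]; case: eqP => [->|_] //=.
- by move=> _ z2s E; have := fy _ z2s; rewrite -E eqxx.
- by move=> z1s _ E; have := fy _ z1s; rewrite E eqxx.
- exact: finj.
Qed.

(** The map is built from the roots downwards. If w goes to a node with the same code, injectivity
    of [CodeSeq.code] makes the children of both nodes carry the same multiset of codes, so they can
    be matched. Isomorphisms between forests and extensions of root permutations to automorphisms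
    both come from this. *)
Lemma extend_roots (X Y : finType) (p : X -> option X) (q : Y -> option Y) c c'
    (r : X -> Y) : acyclic p -> is_coding p c -> is_coding q c' ->
  (forall x, p x = None -> q (r x) = None /\ c' (r x) = c x) ->
  (forall x y, p x = None -> p y = None -> r x = r y -> x = y) ->
  exists f : X -> Y, [/\ injective f, forall x, q (f x) = omap f (p x)
    & forall x, p x = None -> f x = r x].
Proof.
move=> acy cE c'E r_root r_inj.
(* A matching is chosen in advance for every pair of nodes, a dummy one if the codes differ, since f
   is defined only afterwards. *)
have matchP (w : X * Y) : exists m : X -> Y, c w.1 = c' w.2 ->
    {in children p (Some w.1), forall x, m x \in children q (Some w.2) /\ c' (m x) = c x}
    /\ {in children p (Some w.1) &, injective m}.
  case: (c w.1 =P c' w.2) => [ccw|ne]; last by exists (fun=> w.2).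
  have [m mP] : exists m : X -> Y,
    {in children p (Some w.1), forall x, m x \in children q (Some w.2) /\ c' (m x) = c x}
    /\ {in children p (Some w.1) &, injective m}.
    apply: (code_match w.2 (children_uniq _ _) (children_uniq _ _)).
    apply/sort_leqP; apply: (can_inj CodeSeq.codeK).
    by rewrite -cE -c'E.
  by exists m.
have [m mP] := functional_choice _ matchP.
have [f fE] := @parent_rec X p Y (fun x o =>
  if o is Some v then (if p x is Some w then m (w, v) x else r x) else r x) acy.
have f_code x : c' (f x) = c x /\ q (f x) = omap f (p x).
  move: x; apply: (parent_ind acy) => x IH; rewrite fE; case px: (p x) => [w|] /=.
    have [cw _] := IH w px; have [H _] := mP (w, f w) (esym cw).
    have [|H1 H2] := H x; first by rewrite mem_children px.
    by move: H1; rewrite mem_children => /eqP ->.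
  by have [-> ->] := r_root x px.
exists f; split=> [|x|x px]; last by rewrite fE px.
- move=> x y; move: x y; apply: (parent_ind acy) => x IH y fxy.
  have [_ qx] := f_code x; have [_ qy] := f_code y.
  case px: (p x) => [w|]; case py: (p y) => [w'|];
    move: (qx); rewrite fxy qy px py //=.
    case=> fww'; have ww' : w = w' by apply: IH.
    subst w'; move: fxy; rewrite fE px /= [RHS]fE py /=.
    have [cw _] := f_code w; have [_ m_inj] := mP (w, f w) (esym cw).
    by apply: m_inj; rewrite mem_children ?px ?py.
  by move=> _; apply: r_inj => //; move: fxy; rewrite fE px /= [RHS]fE py.
- by case: (f_code x).
Qed.

(** * Forests up to isomorphism are multisets of codes *)

Section ForestCode.
Variable n : nat.
Implicit Types p q : parent_map n.

Lemma is_forestP p : reflect (forall x, iter n (obind p) (Some x) = None) (is_forest p).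
Proof. exact: 'forall_eqP. Qed.

Lemma is_forest_acyclic p : is_forest p -> acyclic p.
Proof. by move/is_forestP => H; exists n. Qed.

Lemma acyclic_is_forest p : acyclic p -> is_forest p.
Proof.
by move/acyclic_height => H; apply/is_forestP => x; rewrite -(H x) card_ord.
Qed.

Definition code p : 'I_n -> nat := ncode p n.

Definition rcodes p : seq nat := [seq code p r | r <- children p None].

Lemma code_coding p : is_forest p -> is_coding p (code p).
Proof. by move/is_forestP/ncode_coding. Qed.

Lemma size_rcodes p : size (rcodes p) = #|Defs.roots p|.
Proof.
rewrite size_map -(card_uniqP (children_uniq p None)); apply: eq_card => x.
by rewrite mem_children inE.
Qed.

Lemma iter_iso p q (s : 'S_n) k o : is_iso p q s ->
  iter k (obind q) (omap s o) = omap s (iter k (obind p) o).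
Proof.
move=> /'forall_eqP pq; elim: k => //= k ->.
by case: (iter k _ _) => //= x; rewrite pq.
Qed.

Lemma iso_rcodes p q : is_forest p -> isomorphic p q ->
  is_forest q /\ perm_eq (rcodes p) (rcodes q).
Proof.
move=> fp /existsP[s iso_s]; have /'forall_eqP pq := iso_s.
have fq : is_forest q.
  apply/is_forestP => x; rewrite -(permKV s x).
  by rewrite (iter_iso n (Some (s^-1%g x)) iso_s); move/is_forestP: fp => ->.
split=> //; have E : forall x, code q (s x) = code p x.
  apply: (coding_embed (is_forest_acyclic fp) (code_coding fp) (code_coding fq)).
    exact: perm_inj.
  move=> x y; split=> [|[z -> pz]]; last by rewrite pq pz.
  rewrite -{1}(permKV s y) pq; exists (s^-1%g y); first by rewrite permKV.
  by case: (p _) H => //= z [/perm_inj ->].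
rewrite /rcodes -(eq_map E) (map_comp (code q) s); apply: perm_map.
apply: uniq_perm; rewrite ?map_inj_uniq ?children_uniq //; first exact: perm_inj.
move=> y; rewrite -(permKV s y) (mem_map (@perm_inj _ s)) !mem_children pq.
by case: (p _).
Qed.

Lemma rcodes_iso p q : is_forest p -> is_forest q ->
  perm_eq (rcodes p) (rcodes q) -> isomorphic p q.
Proof.
move=> fp fq pq; apply/existsP.
case: (pickP 'I_n) => [y0 _|n0]; last first.
  by exists 1%g; apply/forallP => x; have := n0 x.
have [r [r1 r2]] := code_match y0 (children_uniq p None) (children_uniq q None) pq.
have [x px|x y px py|f [f_inj fE _]] :=
  @extend_roots _ _ p q _ _ r (is_forest_acyclic fp) (code_coding fp) (code_coding fq).
- have [|] := r1 x; first by rewrite mem_children px.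
  by rewrite mem_children => /eqP.
- by apply: r2; rewrite mem_children ?px ?py.
exists (perm f_inj); apply/forallP => x; rewrite permE fE; apply/eqP.
by case: (p x) => //= y; rewrite permE.
Qed.

Lemma isomorphicE p q : is_forest p -> is_forest q ->
  isomorphic p q = perm_eq (rcodes p) (rcodes q).
Proof.
move=> fp fq; apply/idP/idP; last exact: rcodes_iso.
by move/(iso_rcodes fp) => [].
Qed.

Lemma rcodes_canonical p : is_forest p -> all canonical (rcodes p).
Proof.
move=> fp; apply/allP => _ /mapP[x _ ->].
exact: coding_canonical (is_forest_acyclic fp) (code_coding fp) x.
Qed.

Lemma rcodes_size p : is_forest p -> sumn [seq csize j | j <- rcodes p] = n.
Proof.
by move=> fp; rewrite -map_comp (coding_size (code_coding fp)) card_ord.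
Qed.

End ForestCode.

Lemma realize_ord (s : seq nat) : all canonical s ->
  exists p : parent_map (sumn [seq csize j | j <- s]),
    is_forest p /\ perm_eq (rcodes p) s.
Proof.
move=> /realize[X [p [c [acy cE perms]]]].
have <- : #|X| = sumn [seq csize j | j <- s].
  rewrite -(coding_size cE) (map_comp csize c) !sumnE.
  by apply: perm_big; apply: perm_map.
pose p' : parent_map #|X| := [ffun i => omap enum_rank (p (enum_val i))].
have p'E x : p' (enum_rank x) = omap enum_rank (p x) by rewrite ffunE enum_rankK.
have fp' : is_forest p'.
  apply: acyclic_is_forest; have [N acyN] := acy; exists N => i.
  rewrite -(enum_valK i) -[Some _]/(omap enum_rank (Some (enum_val i))).
  rewrite (_ : iter _ _ _ = omap enum_rank (iter N (obind p) (Some (enum_val i)))).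
    by rewrite acyN.
  by elim: N {acyN} => //= k ->; case: (iter k _ _) => //= x.
exists p'; split=> //; apply: perm_trans perms.
have E x : code p' (enum_rank x) = c x.
  move: x; apply: (coding_embed acy cE (code_coding fp')); first exact: enum_rank_inj.
  move=> x y; split=> [|[z -> pz]]; last by rewrite p'E pz.
  rewrite -(enum_valK y) p'E; case pz: (p _) => [z|] //= [/enum_rank_inj zx].
  by exists (enum_val y) => //; rewrite pz zx.
rewrite -(eq_map E) (map_comp (code p') enum_rank); apply: perm_map.
apply: uniq_perm; rewrite ?map_inj_uniq ?children_uniq //; try exact: enum_rank_inj.
move=> y; rewrite -(enum_valK y) (mem_map enum_rank_inj) !mem_children p'E.
by case: (p _).
Qed.

(** A finite alphabet for all forests of size at most N. The codes are read off the forests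
    themselves, so finiteness comes for free. *)
Definition tree_codes N : seq nat :=
  undup (flatten [seq flatten [seq rcodes p | p <- enum (@is_forest m)] | m <- iota 0 N.+1]).

Lemma tree_codes_uniq N : uniq (tree_codes N).
Proof. exact: undup_uniq. Qed.

Lemma mem_tree_codes N c : (c \in tree_codes N) = canonical c && (csize c <= N).
Proof.
rewrite mem_undup; apply/flatten_mapP/andP => [[m]|[can_c cN]].
  rewrite mem_iota add0n ltnS => mN /flatten_mapP[p].
  rewrite mem_enum => fp cp; split; first by move/allP: (rcodes_canonical fp); apply.
  apply: leq_trans mN; rewrite -[X in _ <= X](rcodes_size fp).
  by move: cp => /(perm_to_rem) /(perm_map csize) /perm_sumn -> /=; rewrite leq_addr.
have [|p [fp pc]] := @realize_ord [:: c]; first by rewrite /= can_c.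
exists (sumn [seq csize j | j <- [:: c]]).
  by rewrite mem_iota add0n ltnS /= addn0.
by apply/flatten_mapP; exists p; rewrite ?mem_enum // (perm_mem pc) mem_head.
Qed.

(** * Multiplicity vectors *)

(** The multiplicity vectors over U of total size n. The recursion on U is that of a product of
    series, one factor per code. *)
Fixpoint count_vecs (U : seq nat) n : seq (seq nat) :=
  if U is c :: U' then
    flatten [seq [seq m :: v | v <- count_vecs U' (n - m * csize c)]
            | m <- [seq m <- iota 0 n.+1 | m * csize c <= n]]
  else if n == 0 then [:: [::]] else [::].

Definition vec_size (U v : seq nat) : nat := sumn [seq x.1 * csize x.2 | x <- zip v U].

Lemma mem_count_vecs U n v :
  (v \in count_vecs U n) = (size v == size U) && (vec_size U v == n).
Proof.
elim: U n v => [|c U IH] n v.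
  rewrite [count_vecs _ _]/=; case: eqP => [->|n0]; case: v => [|m v] //=.
  by rewrite /vec_size /= eq_sym; symmetry; apply/eqP.
rewrite /count_vecs -/count_vecs.
set L := [seq m <- _ | _]; have memL k : (k \in L) = (k * csize c <= n).
  rewrite mem_filter mem_iota add0n ltnS; apply: andb_idr; apply: leq_trans.
  by rewrite leq_pmulr // csize_gt0.
have consE m w : vec_size (c :: U) (m :: w) = m * csize c + vec_size U w by [].
apply/flatten_mapP/andP => [[m]|].
  rewrite memL => mn /mapP[w].
  by rewrite IH => /andP[/eqP sw /eqP ww] ->; rewrite consE /= sw ww subnKC.
case: v => [|m v] [] // /eqP[sv]; rewrite consE => /eqP vn.
exists m; first by rewrite memL -vn leq_addr.
by apply/mapP; exists v => //; rewrite IH sv -vn addKn !eqxx.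
Qed.

Lemma count_vecs_uniq U n : uniq (count_vecs U n).
Proof.
elim: U n => [|c U IH] n; first by rewrite /=; case: eqP.
rewrite /count_vecs -/count_vecs.
elim: [seq m <- iota 0 n.+1 | m * csize c <= n] (filter_uniq (fun m => m * csize c <= n) (iota_uniq 0 n.+1)) => //= m s IHs /andP[ms us].
rewrite cat_uniq IHs // andbT map_inj_uniq ?IH; last by move=> ? ? [].
apply/hasPn => v /flatten_mapP[m' m's /mapP[w _ ->]]; apply/negP => /mapP[w' _ [E _]].
by rewrite -E m's in ms.
Qed.

Definition counts (U s : seq nat) : seq nat := [seq count_mem c s | c <- U].

Lemma counts_size (U s : seq nat) : uniq U -> {subset s <= U} ->
  vec_size U (counts U s) = sumn [seq csize j | j <- s].
Proof.
move=> uU; rewrite /vec_size /counts.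
have -> w : sumn [seq x.1 * csize x.2 | x <- zip [seq w c | c <- U] U] =
    \sum_(c <- U) w c * csize c.
  rewrite sumnE big_map; elim: (U) => [|c U' IH] /=; first by rewrite !big_nil.
  by rewrite !big_cons IH.
elim: s => [|a s IH] sU /=; first by rewrite big1.
rewrite -IH => [|x xs]; last by apply: sU; rewrite inE xs orbT.
under eq_bigr do rewrite mulnDl; rewrite big_split /=; congr (_ + _).
rewrite (bigD1_seq a) ?sU ?mem_head //= eqxx mul1n big1 ?addn0 // => c.
by rewrite eq_sym => /negbTE ->.
Qed.

Lemma counts_sum (U s : seq nat) : uniq U -> {subset s <= U} ->
  sumn (counts U s) = size s.
Proof.
move=> uU; rewrite /counts sumnE big_map; elim: s => [|a s IH] sU /=; first by rewrite big1.
rewrite -IH => [|x xs]; last by apply: sU; rewrite inE xs orbT.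
rewrite big_split /= (bigD1_seq a) ?sU ?mem_head //= eqxx big1 // => c.
by rewrite eq_sym => /negbTE ->.
Qed.

Lemma counts_perm (U s1 s2 : seq nat) : {subset s1 <= U} -> {subset s2 <= U} ->
  counts U s1 = counts U s2 -> perm_eq s1 s2.
Proof.
move=> s1U s2U /eq_in_map E; apply/allP => x; rewrite mem_cat => H /=.
by apply/eqP/E; case/orP: H => [/s1U|/s2U].
Qed.

Lemma counts_surj (U v : seq nat) : uniq U -> size v = size U ->
  exists s, {subset s <= U} /\ counts U s = v.
Proof.
elim: U v => [|c U IH] [|m v] //=; first by exists [::].
case/andP=> cU uU [sv]; have [s [sU sE]] := IH v uU sv.
exists (nseq m c ++ s); split=> [x|].
  by rewrite mem_cat mem_nseq inE => /orP[/andP[_ ->]|/sU ->]; rewrite ?orbT.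
rewrite count_cat count_nseq /= eqxx mul1n -[in RHS]sE; congr (_ :: _).
  rewrite (count_memPn _) ?addn0 //; apply/negP => /sU; exact/negP.
apply/eq_in_map => x xU; rewrite count_cat count_nseq /=.
by case: eqP xU cU => [<- ->|_ _ _].
Qed.

Lemma rcodes_sub n N (p : parent_map n) : is_forest p -> n <= N ->
  {subset rcodes p <= tree_codes N}.
Proof.
move=> fp nN c cp; rewrite mem_tree_codes; apply/andP; split.
  by move/allP: (rcodes_canonical fp); apply.
apply: leq_trans nN; rewrite -[X in _ <= X](rcodes_size fp).
by move: cp => /(perm_to_rem) /(perm_map csize) /perm_sumn -> /=; rewrite leq_addr.
Qed.

Lemma counts_rcodes n N (p : parent_map n) : is_forest p -> n <= N ->
  counts (tree_codes N) (rcodes p) \in count_vecs (tree_codes N) n.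
Proof.
move=> fp nN; rewrite mem_count_vecs size_map eqxx /=.
rewrite counts_size ?tree_codes_uniq ?rcodes_size //; exact: rcodes_sub.
Qed.

Lemma counts_rcodes_surj n N v : v \in count_vecs (tree_codes N) n ->
  exists p : parent_map n,
    is_forest p /\ counts (tree_codes N) (rcodes p) = v.
Proof.
rewrite mem_count_vecs => /andP[/eqP sv /eqP wv].
have [s [sU sE]] := counts_surj (tree_codes_uniq N) sv.
have [|p [fp ps]] := @realize_ord s.
  by apply/allP => c /sU; rewrite mem_tree_codes => /andP[].
have E : sumn [seq csize j | j <- s] = n.
  by rewrite -(counts_size (tree_codes_uniq N) sU) sE.
move: p fp ps; rewrite E => p fp ps; exists p; split=> //; rewrite -sE.
by apply/eq_map => c; apply/seq.permP.
Qed.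

(** * Counting trees *)

(** The classes are the nonempty fibres of the key. *)
Lemma card_equivalence_partition (A : finType) (r : rel A) (D : {set A})
    (key : A -> nat) : {in D &, forall x y, r x y = (key x == key y)} ->
  #|equivalence_partition r D| = size (undup [seq key x | x <- enum D]).
Proof.
move=> rE; pose g k := [set y in D | k == key y].
have mem_keys k : (k \in undup [seq key x | x <- enum D]) = [exists x in D, k == key x].
  rewrite mem_undup; apply/mapP/exists_inP => [[x]|[x xD /eqP kx]].
    by rewrite mem_enum => xD ->; exists x.
  by exists x; rewrite ?mem_enum.
rewrite -(size_map g) -(card_uniqP _); last first.
  rewrite map_inj_in_uniq ?undup_uniq // => k k'.
  rewrite !mem_keys => /exists_inP[x xD /eqP kx] _ /setP/(_ x).
  by rewrite !inE xD kx eqxx /= => /esym/eqP ->.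
apply: eq_card => B; apply/imsetP/mapP => [[x xD ->]|[k]].
  exists (key x); first by rewrite mem_keys; apply/exists_inP; exists x.
  by apply/setP => y; rewrite !inE; apply: andb_id2l => yD; rewrite rE.
rewrite mem_keys => /exists_inP[x xD /eqP kx] ->; exists x => //.
by apply/setP => y; rewrite !inE kx; apply: andb_id2l => yD; rewrite rE.
Qed.

(** A tree has a single root code, so its isomorphism class amounts to one canonical code of size
    m. *)
Lemma card_polya_trees m N : m <= N ->
  #|polya_trees m| = count (fun c => csize c == m) (tree_codes N).
Proof.
move=> mN; set D := [set p : parent_map m | is_forest p & #|Defs.roots p| == 1].
have rcodes1 (p : parent_map m) : p \in D -> rcodes p = [:: head 0 (rcodes p)].
  rewrite inE -size_rcodes => /andP[_]; by case: (rcodes p) => [|? []].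
rewrite /polya_trees (@card_equivalence_partition _ _ _ (fun p => head 0 (rcodes p))).
  rewrite -size_filter; apply: perm_size; apply: uniq_perm.
  - exact: undup_uniq.
  - exact: filter_uniq (tree_codes_uniq N).
  move=> c; rewrite mem_undup mem_filter mem_tree_codes.
  apply/mapP/and3P => [[p]|[/eqP cm can_c cN]].
    rewrite mem_enum => pD ->; have := rcodes1 p pD.
    move: pD; rewrite inE => /andP[fp _] E.
    move: (rcodes_size fp) (rcodes_canonical fp); rewrite E /= addn0 andbT => -> ->.
    by rewrite eqxx mN.
  have [|p [fp pc]] := @realize_ord [:: c]; first by rewrite /= can_c.
  have Em : sumn [seq csize j | j <- [:: c]] = m by rewrite /= addn0.
  move: p fp pc; rewrite Em => p fp pc; exists p.
    by rewrite mem_enum inE fp -size_rcodes (perm_size pc).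
  by rewrite (perm_small_eq _ pc).
move=> p q pD qD; have := pD; have := qD; rewrite !inE => /andP[fq _] /andP[fp _].
rewrite isomorphicE // (rcodes1 p pD) (rcodes1 q qD) /=.
apply/idP/eqP => [H|->] //; have := perm_mem H (head 0 (rcodes p)).
by rewrite !inE eqxx => /esym/eqP.
Qed.

(** Deleting the root: decoding the code of a tree with n+1 nodes gives the sorted codes of its root
    subtrees, hence a multiplicity vector of size n. This is the functional equation of T before it
    is turned into series. *)
Lemma size_count_vecs n N N' : n <= N -> n < N' ->
  size (count_vecs (tree_codes N) n) = count (fun c => csize c == n.+1) (tree_codes N').
Proof.
move=> nN nN'; rewrite -size_filter.
pose f c := counts (tree_codes N) (CodeSeq.decode c).
have subU c : c \in [seq c <- tree_codes N' | csize c == n.+1] ->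
   [/\ {subset CodeSeq.decode c <= tree_codes N}, path.sorted leq (CodeSeq.decode c)
     & sumn [seq csize j | j <- CodeSeq.decode c] = n].
  rewrite mem_filter mem_tree_codes => /and3P[+ + _].
  rewrite -{1 2}(CodeSeq.decodeK c) csize_code canonical_code eqSS.
  move=> /eqP szc /andP[sc /allP cc]; split=> // j js.
  rewrite mem_tree_codes cc //=; apply: leq_trans nN; rewrite -szc.
  by move: js => /(perm_to_rem) /(perm_map csize) /perm_sumn -> /=; rewrite leq_addr.
rewrite -[RHS](size_map f); apply: perm_size; apply: uniq_perm.
- exact: count_vecs_uniq.
- rewrite map_inj_in_uniq ?filter_uniq ?tree_codes_uniq // => c c' /subU[s1 o1 _] /subU[s2 o2 _].
  move=> /(counts_perm s1 s2) /sort_leqP.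
  rewrite (sorted_sort leq_trans o1) (sorted_sort leq_trans o2).
  exact: (can_inj CodeSeq.decodeK).
move=> v; apply/idP/mapP => [|[c /subU[s1 _ s3] ->]]; last first.
  by rewrite mem_count_vecs size_map eqxx counts_size ?tree_codes_uniq ?s3 ?eqxx.
rewrite mem_count_vecs => /andP[/eqP sv /eqP wv].
have [s [sU sE]] := counts_surj (tree_codes_uniq N) sv.
exists (CodeSeq.code (sort leq s)); last first.
  by rewrite /f CodeSeq.codeK -sE; apply/eq_map => c; apply/seq.permP; rewrite perm_sym perm_sort.
have szs : csize (CodeSeq.code (sort leq s)) = n.+1.
  rewrite csize_code; congr S; rewrite -[RHS]wv -sE counts_size ?tree_codes_uniq //.
  by apply: perm_sumn; apply: perm_map; rewrite perm_sort.
rewrite mem_filter mem_tree_codes szs eqxx nN' canonical_code sort_leq_sorted all_sort !andbT.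
by apply/allP => c /sU; rewrite mem_tree_codes => /andP[].
Qed.

Local Open Scope R_scope.

(** * Derangements and the weight of a forest *)

Definition fones : fps := fun _ => 1.

(* exp(-z)/(1-z): delta m is the proportion of derangements in S_m. *)
Definition delta : fps := conv (expc (-1)) fones.

Lemma comp_id f : comp f fX = f.
Proof.
apply: fps_ext => m; rewrite /comp.
rewrite (eq_bigr (fun i : 'I_m.+1 => if (i : nat) == m then f i else 0)); last first.
  by move=> i _; rewrite fpowX eq_sym; case: eqP => _; ring.
by rewrite (sum_one f) ltnSn.
Qed.

Lemma expc_conv a b : conv (expc a) (expc b) = expc (a + b).
Proof.
rewrite -(comp_id (expc a)) -(comp_id (expc b)) -(comp_id (expc (a + b))) -!Ex_scal.
have fX0 : fX 0%N = 0 by [].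
rewrite -Ex_add; try by rewrite /fscal fX0; ring.
by congr Ex; apply: fps_ext => i; rewrite /fadd /fscal; ring.
Qed.

Lemma expc0 : expc 0 = fone.
Proof.
apply: fps_ext => -[|n]; rewrite /expc /fone /=; first by field.
by rewrite Rmult_0_l /Rdiv Rmult_0_l.
Qed.

(** Coefficientwise, m! is the sum over k of C(m,k) k! delta_k, which is the recursion of the
    derangement numbers. *)
Lemma delta_expc : conv (expc 1) delta = fones.
Proof.
by rewrite /delta convA expc_conv (_ : 1 + -1 = 0) ?expc0 ?conv1l; last ring.
Qed.

Lemma INR_fact n : INR n`! = INR (fact n).
Proof.
by congr INR; elim: n => // n IH; rewrite factS IH -multE.
Qed.

Lemma INR_sum (I : Type) (r : seq I) (P : pred I) (F : I -> nat) :
  INR (\big[addn/0%N]_(i <- r | P i) F i) = \sum_(i <- r | P i) INR (F i).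
Proof.
elim/big_ind2: _ => // x1 x2 y1 y2 <- <-; exact: plus_INR.
Qed.

Lemma sum_subsets (A : finType) (S : {set A}) (F : nat -> R) :
  \sum_(B : {set A} | B \subset S) F #|B| = \sum_(k < #|S|.+1) INR 'C(#|S|, k) * F k.
Proof.
rewrite (partition_big (fun B : {set A} => inord #|B| : 'I_#|S|.+1) predT) //=.
apply: eq_bigr => k _.
rewrite (eq_bigl (fun B => B \in [set B : {set A} | B \subset S & #|B| == k])); last first.
  move=> B; rewrite inE; apply: andb_id2l => BS.
  by rewrite -val_eqE /= inordK // ltnS subset_leq_card.
rewrite (eq_bigr (fun=> F k)) => [|B]; last by rewrite inE => /andP[_ /eqP ->].
by rewrite -big_enum /= sum_const -cardE cards_draws.
Qed.

(** * Permutations preserving a colouring *)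

Section Perms.
Variable A : finType.
Implicit Types (S : {set A}) (s : {perm A}).

Definition derangements S : {set {perm A}} :=
  [set s | perm_on S s & [forall x in S, s x != x]].

Lemma derangements_support S s : (s \in derangements S) = ([set x | s x != x] == S).
Proof.
rewrite inE eqEsubset; congr (_ && _).
  by apply/subsetP/subsetP => H x; have := H x; rewrite !inE.
apply/forall_inP/subsetP => H x xS; first by rewrite inE H.
by have := H x xS; rewrite inE.
Qed.

(** The permutations of S are sorted by the set B of points that they move. *)
Lemma card_perm_sum S :
  INR #|S|`! = \sum_(B : {set A} | B \subset S) INR #|derangements B|.
Proof.
rewrite -card_perm -sum1_card INR_sum.
rewrite (partition_big (fun s => [set x | s x != x]) (fun B : {set A} => B \subset S)) /=.
  apply: eq_bigr => B BS; rewrite -[X in _ = INR X]sum1_card INR_sum /=.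
  apply: eq_bigl => s; rewrite derangements_support; apply: andb_idl => /eqP sB.
  by apply/subsetP => x xs; apply: (subsetP BS); rewrite -sB inE.
by move=> s /subsetP H; apply/subsetP => x; rewrite inE => /H.
Qed.

(** Both sides satisfy the same recursion over subsets; induction settles the proper subsets and
    leaves the term B = S. *)
Lemma card_derangements S :
  INR #|derangements S| = INR #|S|`! * delta #|S|.
Proof.
have [n] := ubnP #|S|; elim: n S => // n IH S; rewrite ltnS => Sn.
have total : INR #|S|`! = \sum_(B : {set A} | B \subset S) INR #|B|`! * delta #|B|.
  rewrite (sum_subsets S (fun k => INR k`! * delta k)).
  have := congr1 (fun a : fps => a #|S|) delta_expc; rewrite convC /conv /fones => E.
  rewrite -[LHS]Rmult_1_r -E big_distrr /=; apply: eq_bigr => k _.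
  have kS : (k <= #|S|)%N by rewrite -ltnS.
  have := congr1 INR (bin_fact kS); rewrite !mult_INR !INR_fact => <-.
  rewrite /expc pow1; field; exact: INR_fact_neq_0.
have := etrans (esym total) (card_perm_sum S).
rewrite (bigD1 S) // [X in _ = X -> _](bigD1 S) //=.
rewrite (eq_bigr (fun B : {set A} => INR #|derangements B|)) => [E|B].
  by apply: (Rplus_eq_reg_r _ _ _ (esym E)).
move=> /andP[BS BnS]; rewrite IH //; apply: leq_trans Sn.
by apply: proper_card; rewrite properEneq BnS.
Qed.

Lemma restrict_perm S s : {in S, forall x, s x \in S} ->
  exists2 u : {perm A}, perm_on S u & {in S, u =1 s}.
Proof.
move=> sS; exists (restr_perm S s); first exact: restr_perm_on.
have sSS : s @: S = S.
  apply/eqP; rewrite eqEcard (card_imset _ (@perm_inj _ s)) leqnn andbT.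
  by apply/subsetP => _ /imsetP[x xS ->]; exact: sS.
move=> x xS; apply: restr_permE => //; apply/astabsP => y.
by rewrite -{1}sSS; apply: mem_imset; exact: perm_inj.
Qed.

(* With b = true only the permutations without fixed point in S are kept. *)
Definition color_perms (b : bool) (c : A -> nat) S : {set {perm A}} :=
  [set s | [&& perm_on S s, [forall x in S, c (s x) == c x]
             & b ==> [forall x in S, s x != x]]].

Lemma color_permsP (b : bool) (c : A -> nat) S s :
  reflect [/\ perm_on S s, {in S, forall x, c (s x) = c x}
            & b -> {in S, forall x, s x != x}] (s \in color_perms b c S).
Proof.
rewrite inE; apply: (iffP and3P) => [[H1 H2 H3]|[H1 H2 H3]]; split=> //.
- by move=> x xS; apply/eqP; exact: (forall_inP H2).
- by move=> bT; apply/forall_inP; rewrite bT in H3.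
- by apply/forall_inP => x xS; apply/eqP; exact: H2.
- by apply/implyP => bT; apply/forall_inP; exact: H3.
Qed.

Lemma color_perms_mono (b : bool) (c : A -> nat) S k : {in S, forall x, c x = k} ->
  INR #|color_perms b c S| = INR #|S|`! * (if b then delta #|S| else 1).
Proof.
move=> cS; have cs s x : perm_on S s -> x \in S -> c (s x) = c x.
  by move=> sS xS; rewrite !cS // perm_closed.
case: b.
  rewrite -card_derangements; congr INR; apply: eq_card => s.
  apply/color_permsP/idP => [[H1 _ H3]|].
    by rewrite inE H1; apply/forall_inP; exact: H3.
  rewrite inE => /andP[H1 /forall_inP H2]; split=> // x; exact: cs.
rewrite Rmult_1_r -card_perm; congr INR; apply: eq_card => s.
apply/color_permsP/idP => [[]//|H1]; split=> // x; exact: cs.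
Qed.

(** No colour occurs in both sets, so a colour-preserving permutation of the union preserves each of
    them and is, in a unique way, the product of its two restrictions. *)
Lemma color_perms_split (b : bool) (c : A -> nat) S1 S2 :
  {in S1 & S2, forall x y, c x != c y} ->
  #|color_perms b c (S1 :|: S2)| = (#|color_perms b c S1| * #|color_perms b c S2|)%N.
Proof.
move=> c12; have dis x : x \in S1 -> x \in S2 -> False.
  by move=> x1 x2; have := c12 x x x1 x2; rewrite eqxx.
have val12 s1 s2 x : perm_on S1 s1 -> perm_on S2 s2 ->
    (x \in S1 -> (s1 * s2)%g x = s1 x) /\ (x \in S2 -> (s1 * s2)%g x = s2 x).
  move=> on1 on2; rewrite permM; split=> xS.
    by rewrite (out_perm on2) //; apply/negP; apply: dis; rewrite perm_closed.
  by rewrite (out_perm on1) //; apply/negP => x1; exact: dis x1 xS.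
rewrite -cardsX -(card_in_imset (f := fun s : {perm A} * {perm A} => (s.1 * s.2)%g)).
  apply: eq_card => s; apply/color_permsP/imsetP => [[on_s cs ds]|[[s1 s2]]].
    have [|u1 on1 u1E] := @restrict_perm S1 s.
      move=> x x1; have xS : x \in S1 :|: S2 by rewrite inE x1.
      have := perm_closed x on_s; rewrite xS inE => /orP[] // s2.
      by have := c12 _ _ x1 s2; rewrite cs // eqxx.
    have [|u2 on2 u2E] := @restrict_perm S2 s.
      move=> x x2; have xS : x \in S1 :|: S2 by rewrite inE x2 orbT.
      have := perm_closed x on_s; rewrite xS inE => /orP[] // s1.
      by have := c12 _ _ s1 x2; rewrite cs // eqxx.
    exists (u1, u2); last first.
      apply/permP => x; have [H1 H2] := val12 _ _ x on1 on2.
      case: (boolP (x \in S1)) => x1; first by rewrite H1 // u1E.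
      case: (boolP (x \in S2)) => x2; first by rewrite H2 // u2E.
      rewrite permM (out_perm on1) // (out_perm on2) // (out_perm on_s) //.
      by rewrite inE negb_or x1.
    rewrite inE /=; apply/andP; split; apply/color_permsP; split=> //.
    - by move=> x xS; rewrite u1E // cs // inE xS.
    - by move=> bT x xS; rewrite u1E // ds // inE xS.
    - by move=> x xS; rewrite u2E // cs // inE xS orbT.
    - by move=> bT x xS; rewrite u2E // ds // inE xS orbT.
  rewrite inE /= => /andP[/color_permsP[on1 c1 d1] /color_permsP[on2 c2 d2]] ->.
  split=> [|x|bT x].
  - apply: perm_onM; [apply: subset_trans on1 _|apply: subset_trans on2 _].
      exact: subsetUl.
    exact: subsetUr.
  - have [H1 H2] := val12 _ _ x on1 on2.
    by rewrite inE => /orP[xS|xS]; [rewrite H1 // c1 | rewrite H2 // c2].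
  - have [H1 H2] := val12 _ _ x on1 on2.
    by rewrite inE => /orP[xS|xS]; [rewrite H1 // d1 | rewrite H2 // d2].
move=> [s1 s2] [t1 t2]; rewrite !inE /= => /andP[/and3P[on1 _ _] /and3P[on2 _ _]].
move=> /andP[/and3P[ton1 _ _] /and3P[ton2 _ _]] /permP E.
congr (_, _); apply/permP => x; have := E x;
  have [H1 H2] := val12 _ _ x on1 on2; have [H3 H4] := val12 _ _ x ton1 ton2.
  case: (boolP (x \in S1)) => x1; first by rewrite H1 // H3.
  by rewrite (out_perm on1) // (out_perm ton1).
case: (boolP (x \in S2)) => x2; first by rewrite H2 // H4.
by rewrite (out_perm on2) // (out_perm ton2).
Qed.

Lemma card_color_perms (b : bool) (c : A -> nat) S (U : seq nat) : uniq U ->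
  INR #|color_perms b c [set x in S | c x \in U]| =
  \prod_(k <- U) (INR #|[set x in S | c x == k]|`!
      * (if b then delta #|[set x in S | c x == k]| else 1)).
Proof.
elim: U => [|k U IH] /=.
  rewrite big_nil (_ : [set x in S | _] = set0); last by apply/setP => x; rewrite !inE andbF.
  rewrite (@color_perms_mono b c set0 0%N) => [|x]; last by rewrite inE.
  have d0 : delta 0%N = 1 by rewrite /delta conv0 /expc /fones /=; field.
  by move=> _; rewrite cards0 d0 /=; case: b; ring.
case/andP=> kU uU; rewrite big_cons -IH //.
rewrite (_ : [set x in S | _] = [set x in S | c x == k] :|: [set x in S | c x \in U]); last first.
  by apply/setP => x; rewrite !inE andb_orr.
rewrite color_perms_split => [|x y].
  rewrite mult_INR (@color_perms_mono b c [set x in S | c x == k] k) // => x.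
  by rewrite inE => /andP[_ /eqP].
rewrite !inE => /andP[_ /eqP ->] /andP[_ cyU]; apply: contraNneq kU => ->; exact: cyU.
Qed.

End Perms.

(** * Automorphisms of a forest and its weight *)

Section Weight.
Variables (n : nat) (p : parent_map n).
Hypothesis fp : is_forest p.

Lemma AutP (s : 'S_n) : reflect (forall x, p (s x) = omap s (p x)) (s \in Aut p).
Proof. by rewrite inE; exact: 'forall_eqP. Qed.

Lemma Aut_code s x : s \in Aut p -> code p (s x) = code p x.
Proof.
move=> /AutP sA; move: x.
apply: (coding_embed (is_forest_acyclic fp) (code_coding fp) (code_coding fp)).
  exact: perm_inj.
move=> x y; split=> [|[z -> pz]]; last by rewrite sA pz.
rewrite -{1}(permKV s y) sA; case E: (p _) => [z|] //= [/perm_inj zx].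
by exists (s^-1%g y); rewrite ?permKV // E zx.
Qed.

Lemma Aut_root s x : s \in Aut p -> (s x \in Defs.roots p) = (x \in Defs.roots p).
Proof. by move=> /AutP sA; rewrite !inE sA; case: (p x). Qed.

Lemma Aut_fixed s : s \in Aut p ->
  [forall x, s x != x] = [forall x in Defs.roots p, s x != x].
Proof.
move=> /AutP sA; apply/forallP/forall_inP => H x; first by move=> _; exact: H.
apply/eqP => sx; move: x sx; apply: (parent_ind (is_forest_acyclic fp)) => x IH sx.
case px: (p x) => [y|].
  by apply: (IH y px); have := sA x; rewrite sx px => -[].
by have := H x; rewrite inE px eqxx sx eqxx => /(_ isT).
Qed.

Definition aut_ext (u : 'S_n) := [set s in Aut p | [forall r in Defs.roots p, s r == u r]].

Lemma aut_extP (u s : 'S_n) : reflect (s \in Aut p /\ {in Defs.roots p, s =1 u}) (s \in aut_ext u).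
Proof.
rewrite [X in reflect _ X]in_set; apply: (iffP andP) => -[H1 H2]; split=> //.
  by move=> x xr; apply/eqP; exact: (forall_inP H2).
by apply/forall_inP => x xr; apply/eqP; exact: H2.
Qed.

(** By [extend_roots], u extends to an automorphism s0, and the automorphisms agreeing with u on the
    roots form the coset of s0 modulo those fixing every root. *)
Lemma card_aut_ext b u : u \in color_perms b (code p) (Defs.roots p) ->
  #|aut_ext u| = #|aut_ext 1%g|.
Proof.
move=> /color_permsP[on_u cu _].
have [x px|x y _ _ /perm_inj //|f [f_inj fE fr]] := @extend_roots _ _ p p _ _ u
  (is_forest_acyclic fp) (code_coding fp) (code_coding fp).
  have xr : x \in Defs.roots p by rewrite inE px.
  split; last exact: cu.
  by have := perm_closed x on_u; rewrite xr inE => /eqP.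
pose s0 := perm f_inj.
have s0A : forall x, p (s0 x) = omap s0 (p x).
  by move=> x; rewrite permE fE; case: (p x) => //= y; rewrite permE.
have s0r : {in Defs.roots p, s0 =1 u}.
  by move=> x; rewrite inE permE => /eqP; exact: fr.
rewrite -(card_imset (mem (aut_ext 1%g)) (mulIg s0)).
apply: eq_card => s; apply/aut_extP/imsetP => [[/AutP sA sr]|[t /aut_extP[/AutP tA tr] ->]].
  have s0VA y : p (s0^-1%g y) = omap s0^-1%g (p y).
    rewrite -{2}(permKV s0 y) s0A; case: (p _) => //= z.
    by rewrite permK.
  exists (s * s0^-1)%g; last by rewrite mulgKV.
  apply/aut_extP; split.
    by apply/AutP => x; rewrite permM s0VA sA; case: (p x) => //= y; rewrite permM.
  by move=> x xr; rewrite permM sr // -(s0r x xr) permK perm1.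
split.
  by apply/AutP => x; rewrite permM s0A tA; case: (p x) => //= y; rewrite permM.
by move=> x xr; rewrite permM tr // perm1 s0r.
Qed.

(** Restriction to the roots has fibres of constant size. This size is the same for both values of
    b, so it cancels in the weight. *)
Lemma card_Aut_roots b :
  #|[set s in Aut p | b ==> [forall x, s x != x]]| =
  (#|color_perms b (code p) (Defs.roots p)| * #|aut_ext 1%g|)%N.
Proof.
rewrite -sum1_card.
pose res s := restr_perm (Defs.roots p) s.
have resE s : s \in Aut p -> perm_on (Defs.roots p) (res s) /\ {in Defs.roots p, res s =1 s}.
  move=> sA; split; first exact: restr_perm_on.
  by move=> x xr; apply: restr_permE => //; apply/astabsP => y; exact: Aut_root.
rewrite (partition_big res (mem (color_perms b (code p) (Defs.roots p)))) /=.
  rewrite -sum_nat_const; apply: eq_bigr => u uC; rewrite -(card_aut_ext uC) -sum1_card.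
  apply: eq_bigl => s; have /color_permsP[on_u cu du] := uC.
  apply/andP/aut_extP => [[]|[sA sr]].
    rewrite inE => /andP[sA _] /eqP <-; split=> // x xr.
    by have [_ ->] := resE s sA.
  have [r1 r2] := resE s sA; split.
    rewrite inE sA /= Aut_fixed //; apply/implyP => bT; apply/forall_inP => x xr.
    by rewrite sr //; exact: du.
  apply/eqP/permP => x; case: (boolP (x \in Defs.roots p)) => xr.
    by rewrite r2 // sr.
  by rewrite (out_perm r1) // (out_perm on_u).
move=> s; rewrite inE => /andP[sA dA]; have [r1 r2] := resE s sA.
apply/color_permsP; split=> // [x xr|bT]; first by rewrite r2 // Aut_code.
by move: dA; rewrite bT /= Aut_fixed // => /forall_inP H x xr; rewrite r2 //; exact: H.
Qed.

Lemma card_roots_code k :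
  #|[set x in Defs.roots p | code p x == k]| = count_mem k (rcodes p).
Proof.
rewrite /rcodes count_map -size_filter -(card_uniqP (filter_uniq _ (children_uniq p None))).
by apply: eq_card => x; rewrite mem_filter mem_children !inE andbC.
Qed.

Lemma prod_div (I : Type) (r : seq I) (F G : I -> R) : (forall i, F i <> 0) ->
  (\prod_(i <- r) (F i * G i)) / (\prod_(i <- r) (F i * 1)) = \prod_(i <- r) G i.
Proof.
move=> F0; elim: r => [|i r IH]; first by rewrite !big_nil; field.
rewrite !big_cons -IH; field; split; last exact: F0.
by elim: (r) => [|j r' IH']; rewrite ?big_nil ?big_cons; [exact: R1_neq_R0 | apply: Rmult_integral_contrapositive; split => //; rewrite Rmult_1_r].
Qed.

(** Codes of the alphabet that do not occur in p contribute [delta 0 = 1], so the product may run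
    over all of [tree_codes N]. *)
Lemma weightE N : (n <= N)%N ->
  weight p = \prod_(m <- counts (tree_codes N) (rcodes p)) delta m.
Proof.
move=> nN.
have rootsU : Defs.roots p = [set x in Defs.roots p | code p x \in tree_codes N].
  apply/setP => x; rewrite [RHS]inE; symmetry; apply: andb_idr => xr.
  apply: (rcodes_sub fp nN); apply: map_f.
  by rewrite mem_children; move: xr; rewrite inE.
have cardE b : INR #|[set s in Aut p | b ==> [forall x, s x != x]]| =
   (\prod_(k <- tree_codes N) (INR (count_mem k (rcodes p))`!
      * (if b then delta (count_mem k (rcodes p)) else 1))) * INR #|aut_ext 1%g|.
  rewrite card_Aut_roots mult_INR {1}rootsU card_color_perms ?tree_codes_uniq //.
  by congr (_ * _); apply: eq_bigr => k _; rewrite card_roots_code.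
have ext0 : INR #|aut_ext 1%g| <> 0.
  apply: not_0_INR; apply/eqP; rewrite -lt0n; apply/card_gt0P; exists 1%g.
  by apply/aut_extP; split=> //; apply/AutP => x; rewrite perm1; case: (p x) => //= y; rewrite perm1.
rewrite /weight; have := cardE true; have := cardE false.
rewrite (_ : [set s in Aut p | false ==> _] = Aut p); last by apply/setP => s; rewrite [LHS]inE andbT.
move=> -> /= ->; rewrite /counts big_map.
rewrite -(@prod_div _ _ (fun k => INR (count_mem k (rcodes p))`!)); last first.
  by move=> k; rewrite INR_fact; exact: INR_fact_neq_0.
set P2 := (X in _ / (X * _)); have P2n0 : P2 <> 0.
  rewrite /P2; elim: (tree_codes N) => [|j r' IH'].
    by rewrite big_nil; exact: R1_neq_R0.
  rewrite big_cons; apply: Rmult_integral_contrapositive; split => //.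
  by rewrite Rmult_1_r INR_fact; exact: INR_fact_neq_0.
set P1 := (X in X * _ / _); change (P1 * INR #|aut_ext 1%g| / (P2 * INR #|aut_ext 1%g|) = P1 / P2).
by field.
Qed.

Lemma Aut_tree_isomorphic s r : s \in Aut p -> tree_isomorphic p r (s r).
Proof.
move=> /AutP sA; have iterE k x y : (iter k (obind p) (Some (s x)) == Some (s y)) =
    (iter k (obind p) (Some x) == Some y).
  rewrite (_ : iter _ _ _ = omap s (iter k (obind p) (Some x))).
    by case: (iter _ _ _) => //= z; rewrite !(inj_eq Some_inj) (inj_eq perm_inj).
  by elim: k => //= k ->; case: (iter _ _ _) => //= z; rewrite sA.
have subE x y : (s x \in subtree p (s y)) = (x \in subtree p y).
  by rewrite !inE; apply: eq_existsb => k; exact: iterE.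
apply/existsP; exists (finfun s); apply/and4P; split.
- by rewrite ffunE.
- by apply/dinjectiveP => x y _ _; rewrite !ffunE => /perm_inj.
- apply/eqP/setP => y; apply/imsetP/idP => [[x xr ->]|yr].
    by rewrite ffunE subE.
  exists (s^-1%g y); last by rewrite ffunE permKV.
  by rewrite -subE permKV.
- apply/forall_inP => x _; apply/implyP => _; rewrite ffunE sA.
  by apply/eqP; case: (p x) => //= y; rewrite ffunE.
Qed.

(** An automorphism without fixed points sends each root to a different root carrying an isomorphic
    tree, which makes p a D-forest. Sums over D-forests thereby extend to all multiplicity
    vectors. *)
Lemma weight_eq0 : ~~ is_D_forest p -> weight p = 0.
Proof.
move=> nD; rewrite /weight (_ : [set s in _ | _] = set0) ?cards0 /=; first by rewrite /Rdiv Rmult_0_l.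
apply/setP => s; rewrite !inE; apply/negP => /andP[iso_s /forallP ds].
have sA : s \in Aut p by rewrite inE.
case/negP: nD; rewrite /is_D_forest fp /=; apply/forall_inP => r rr.
rewrite -[2%N]/(true.+1) -(ds r) -cards2 setUC; apply: subset_leq_card; apply/subsetP => x.
rewrite in_set2 => /orP[] /eqP ->; rewrite inE.
  rewrite rr -{2}[r]perm1; apply: Aut_tree_isomorphic.
  by apply/AutP => y; rewrite perm1; case: (p y) => //= z; rewrite perm1.
by rewrite Aut_root // rr Aut_tree_isomorphic.
Qed.

End Weight.

(** * Generating functions *)

(** Representatives correspond to their multiplicity vectors, and the vectors of other forests have
    weight 0. The function F is 1 for [d] and [INR] for the numerator of the mean. *)
Lemma sum_D_forests n N (F : nat -> R) : (n <= N)%N ->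
  \sum_(p in D_forests n) F #|Defs.roots p| * weight p =
  \sum_(v <- count_vecs (tree_codes N) n) F (sumn v) * \prod_(m <- v) delta m.
Proof.
move=> nN; set D := [set p : parent_map n | is_D_forest p].
pose U := tree_codes N; pose cnt (p : parent_map n) := counts U (rcodes p).
have DF p : p \in D -> is_forest p by rewrite inE => /andP[].
have cntE p q : is_forest p -> is_forest q -> isomorphic p q = (cnt p == cnt q).
  move=> fp fq; rewrite isomorphicE //; apply/idP/eqP => [H|].
    by apply/eq_map => c; apply/seq.permP.
  by apply: counts_perm; exact: rcodes_sub.
have eqrel : {in D & &, equivalence_rel (@isomorphic n)}.
  move=> x y z xD yD zD; rewrite !cntE ?DF // eqxx; split=> // /eqP xy.
  by rewrite xy.
have partP := equivalence_partitionP eqrel.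
have trans := transversalP partP.
have subD p : p \in D_forests n -> p \in D.
  by apply: (subsetP (transversal_sub trans)).
have cnt_inj : {in D_forests n &, injective cnt}.
  move=> p q pD qD E; apply: (pblock_inj trans pD qD).
  apply/eqP; rewrite eq_pblock; first last.
  - by rewrite (cover_partition partP) subD.
  - by case/and3P: partP.
  by rewrite pblock_equivalence_partition ?subD // cntE ?DF ?subD // E.
have cnt_rep p : p \in D -> exists2 q, q \in D_forests n & cnt q = cnt p.
  move=> pD; have BP : pblock (equivalence_partition (@isomorphic n) D) p
      \in equivalence_partition (@isomorphic n) D.
    by apply: pblock_mem; rewrite (cover_partition partP).
  exists (transversal_repr p (D_forests n) (pblock (equivalence_partition (@isomorphic n) D) p)).
    exact: repr_mem_transversal trans p _ BP.
  have := repr_mem_pblock trans p BP; set q := transversal_repr _ _ _ => qB.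
  have qD : q \in D.
    by apply: subD; exact: repr_mem_transversal trans p _ BP.
  by move: qB; rewrite pblock_equivalence_partition // cntE ?DF // => /eqP.
have term p : p \in D_forests n ->
    F #|Defs.roots p| * weight p = F (sumn (cnt p)) * \prod_(m <- cnt p) delta m.
  move=> pD; have fp := DF p (subD p pD).
  rewrite (weightE fp nN) counts_sum ?tree_codes_uniq ?size_rcodes //.
  exact: rcodes_sub.
transitivity (\sum_(v <- count_vecs U n)
    \sum_(p in D_forests n | cnt p == v) F #|Defs.roots p| * weight p); last first.
  rewrite big_seq [RHS]big_seq; apply: eq_bigr => v vU.
  case: (pickP [pred p in D_forests n | cnt p == v]) => [q /andP[qD /eqP qv]|none].
    rewrite (big_pred1 q) => [|p]; first by rewrite term // qv.
    apply/andP/eqP => [[pD /eqP pv]|->]; last by rewrite qD qv.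
    by apply: cnt_inj => //; rewrite pv qv.
  rewrite big_pred0 => [|p]; last exact: none.
  have [p0 [fp0 p0v]] := counts_rcodes_surj vU.
  rewrite -p0v -(weightE fp0 nN) weight_eq0 ?Rmult_0_r //.
  apply/negP => p0D; have [|q qD qv] := cnt_rep p0; first by rewrite inE.
  by have := none q; rewrite /= qD qv /cnt p0v eqxx.
under [RHS]eq_bigr => v _ do rewrite big_mkcondr /=.
rewrite exchange_big /=; apply: eq_bigr => p pD; rewrite -big_mkcond /=.
rewrite (eq_bigl (pred1 (cnt p))) => [|v]; last by rewrite /= eq_sym.
rewrite -big_filter filter_pred1_uniq ?count_vecs_uniq ?big_seq1 //.
by apply: counts_rcodes nN; apply: DF; exact: subD.
Qed.

(** The product of A(z^(csize c)) over c in U, where A is the series of a. *)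
Definition vec_sum (a : nat -> R) (U : seq nat) : fps :=
  fun n => \sum_(v <- count_vecs U n) \prod_(m <- v) a m.

(** The derivative at v = 1 of the same product with every tree marked by v. *)
Definition vec_msum (a : nat -> R) (U : seq nat) : fps :=
  fun n => \sum_(v <- count_vecs U n) INR (sumn v) * \prod_(m <- v) a m.

Lemma conv_dil s a b n : (0 < s)%N ->
  conv (dil s a) b n =
  \sum_(m <- [seq m <- iota 0 n.+1 | (m * s <= n)%N]) a m * b (n - m * s)%N.
Proof.
move=> s0; have iotaE : iota 0 n.+1 = index_iota 0 n.+1 by rewrite /index_iota subn0.
rewrite big_filter iotaE big_mkord.
transitivity (\sum_(m < n.+1 | (m * s <= n)%N) \sum_(j < n.+1 | (j : nat) == (m * s)%N)
    a m * b (n - j)%N); last first.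
  apply: eq_bigr => m mn; have mn' : (m * s < n.+1)%N by [].
  by rewrite (big_pred1 (Ordinal mn')).
rewrite (exchange_big_dep predT) //=; apply: eq_bigr => j _.
rewrite /dil; case: ifP => [sj|nsj]; last first.
  rewrite big_pred0 ?Rmult_0_l // => m; apply/negP => /andP[_ /eqP E].
  by rewrite E dvdn_mull in nsj.
have jn : (j %/ s < n.+1)%N by apply: leq_ltn_trans (leq_div _ _) _.
rewrite (big_pred1 (Ordinal jn)) // => m; rewrite [RHS]/= -val_eqE /=.
apply/andP/eqP => [[_ /eqP ->]|->]; first by rewrite mulnK.
by rewrite divnK // -ltnS ltn_ord eqxx.
Qed.

Lemma count_vecs_cons c U n : count_vecs (c :: U) n =
  [seq m :: v | m <- [seq m <- iota 0 n.+1 | (m * csize c <= n)%N],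
                v <- count_vecs U (n - m * csize c)%N].
Proof. by []. Qed.

Lemma vec_sum_cons a c U : vec_sum a (c :: U) = conv (dil (csize c) a) (vec_sum a U).
Proof.
apply: fps_ext => n; rewrite conv_dil ?csize_gt0 // /vec_sum count_vecs_cons.
rewrite big_allpairs_dep; apply: eq_bigr => m _; rewrite big_distrr /=.
by apply: eq_bigr => v _; rewrite big_cons.
Qed.

Lemma vec_msum_cons a c U : vec_msum a (c :: U) =
  fadd (conv (dil (csize c) (theta a)) (vec_sum a U)) (conv (dil (csize c) a) (vec_msum a U)).
Proof.
apply: fps_ext => n; rewrite /fadd !conv_dil ?csize_gt0 // -big_split /=.
rewrite /vec_msum /vec_sum count_vecs_cons.
rewrite big_allpairs_dep; apply: eq_bigr => m _; rewrite !big_distrr -big_split /=.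
by apply: eq_bigr => v _; rewrite big_cons [sumn _]/= plus_INR /theta; ring.
Qed.

Lemma vec_sum_nil a : vec_sum a [::] = fone.
Proof.
apply: fps_ext => n; rewrite /vec_sum /fone /=.
by case: eqP => _; rewrite ?big_seq1 big_nil.
Qed.

Lemma vec_msum_nil a : vec_msum a [::] = fzero.
Proof.
apply: fps_ext => n; rewrite /vec_msum /fzero /=.
by case: eqP => _; rewrite ?big_seq1 ?big_nil //= Rmult_0_l.
Qed.

Definition fsum (I : Type) (r : seq I) (F : I -> fps) : fps :=
  fun n => \sum_(i <- r) F i n.

Lemma fsum_cons (I : Type) i (r : seq I) F : fsum (i :: r) F = fadd (F i) (fsum r F).
Proof. by apply: fps_ext => n; rewrite /fsum big_cons. Qed.

Lemma fsum_nil (I : Type) (F : I -> fps) : fsum [::] F = fzero.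
Proof. by apply: fps_ext => n; rewrite /fsum big_nil. Qed.

Lemma theta_dil s a : theta (dil s a) = fscal (INR s) (dil s (theta a)).
Proof.
apply: fps_ext => n; rewrite /theta /fscal /dil; case: ifP => [sn|_]; last by ring.
by rewrite -{1}(divnK sn) mult_INR; ring.
Qed.

(* eps plays the role of the logarithmic derivative z a'/a. *)
Lemma theta_vec_sum a eps U : theta a = conv eps a ->
  theta (vec_sum a U) =
  conv (fsum U (fun c => fscal (INR (csize c)) (dil (csize c) eps))) (vec_sum a U).
Proof.
move=> aE; elim: U => [|c U IH].
  rewrite vec_sum_nil fsum_nil; apply: fps_ext => n; rewrite convC conv1l /theta /fone /fzero.
  by case: eqP => [->|_] /=; ring.
rewrite vec_sum_cons theta_conv IH fsum_cons theta_dil aE dil_conv ?csize_gt0 //.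
by rewrite -fscal_convl; ring.
Qed.

Lemma vec_msumE a eps U : theta a = conv eps a ->
  vec_msum a U = conv (fsum U (fun c => dil (csize c) eps)) (vec_sum a U).
Proof.
move=> aE; elim: U => [|c U IH].
  by rewrite vec_msum_nil fsum_nil vec_sum_nil convC conv1l.
rewrite vec_msum_cons vec_sum_cons fsum_cons IH aE dil_conv ?csize_gt0 //.
ring.
Qed.

Lemma t0 : t 0 = 0.
Proof. by rewrite /t (@card_polya_trees 0 0) // (eq_count (a2 := pred0)) ?count_pred0 // => c; rewrite eqn0Ngt csize_gt0. Qed.

(* The series of the omega(i) T(z^i); omega 0 is irrelevant since t 0 = 0. *)
Definition Lam (omega : nat -> R) : fps :=
  fun n => \sum_(i < n.+1) omega i * dil i t n.

Lemma Lam0 omega : Lam omega 0%N = 0.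
Proof. by rewrite /Lam big_ord_recl big_ord0 /dil /= div0n t0; ring. Qed.

Lemma dil_pairs m a k : (0 < k)%N ->
  dil m a k = \sum_(i < k.+1) (if (m * i)%N == k then a i else 0).
Proof.
move=> k0; rewrite -big_mkcond /= /dil; case: ifP => [/dvdnP[j kE]|nmk].
  have m0 : (0 < m)%N by move: k0; rewrite kE muln_gt0 => /andP[].
  have jk : (j < k.+1)%N by rewrite kE ltnS leq_pmulr.
  rewrite (big_pred1 (Ordinal jk)) => [|i]; first by rewrite /= {1}kE mulnK.
  by rewrite [RHS]/= -val_eqE /= [X in _ == X]kE [(j * m)%N]mulnC eqn_pmul2l.
by rewrite big_pred0 // => i; apply/negP => /eqP E; rewrite -E dvdn_mulr in nmk.
Qed.

Lemma sum_tree_codes N (G : nat -> R) :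
  \sum_(c <- tree_codes N) G (csize c) = \sum_(m < N.+1) t m * G m.
Proof.
transitivity (\sum_(c <- tree_codes N) \sum_(m < N.+1) (if csize c == m then G m else 0)).
  rewrite big_seq [RHS]big_seq; apply: eq_bigr => c.
  rewrite mem_tree_codes => /andP[_ cN]; rewrite -ltnS in cN.
  by rewrite -big_mkcond /= (big_pred1 (Ordinal cN)) // => m; rewrite -val_eqE /= eq_sym.
rewrite exchange_big /=; apply: eq_bigr => m _.
rewrite -big_mkcond /= /t (@card_polya_trees m N); last by rewrite -ltnS.
by rewrite -big_filter sum_const size_filter.
Qed.

(** Grouping the codes by size gives the sum over m of t_m eps(z^m), weighted by [om]. A term of
    degree k is a factorization k = i m; reading it from the other factor gives the sum of eps_i
    T(z^i). *)
Lemma fsum_tree_codes N eps (om : nat -> R) k : eps 0%N = 0 -> (k <= N)%N ->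
  fsum (tree_codes N) (fun c => fscal (om (csize c)) (dil (csize c) eps)) k =
  \sum_(i < k.+1) eps i * dil i (fun n => om n * t n) k.
Proof.
move=> eps0 kN; rewrite /fsum.
rewrite (sum_tree_codes N (fun m => fscal (om m) (dil m eps) k)).
case: (posnP k) => [->|k0].
  rewrite big_ord1 eps0 Rmult_0_l big1 // => m _.
  by rewrite /fscal /dil dvdn0 div0n eps0; ring.
transitivity (\sum_(m < N.+1) \sum_(i < k.+1)
    (if (i * m)%N == k then eps i * (om m * t m) else 0)).
  apply: eq_bigr => m _; rewrite /fscal dil_pairs // !big_distrr /=.
  by apply: eq_bigr => i _; rewrite mulnC; case: eqP => _; ring.
rewrite exchange_big /=; apply: eq_bigr => i _.
rewrite dil_pairs // big_distrr /=.
rewrite (@sum_wid k.+1 N.+1 (fun m => if (i * m)%N == k then eps i * (om m * t m) else 0)) //.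
  by apply: eq_bigr => m _; case: eqP => _; ring.
move=> m km _; case: eqP => // E; case: (posnP i) => [i0|i0]; first by rewrite i0 eps0; ring.
by exfalso; nia.
Qed.

Lemma theta_Lam eps : eps 0%N = 0 ->
  theta (Lam (fun i => eps i / INR i)) = (fun k => \sum_(i < k.+1) eps i * dil i (fun n => INR n * t n) k).
Proof.
move=> eps0; apply: fps_ext => k; rewrite /theta /Lam big_distrr /=.
apply: eq_bigr => i _; rewrite /dil; case: ifP => [ik|_]; last by ring.
case: (posnP i) => [i0|i0]; first by rewrite i0 eps0 /Rdiv; ring.
rewrite -{1}(divnK ik) mult_INR; field; apply: not_0_INR.
by apply/eqP; rewrite -lt0n.
Qed.

(** Product and exponential obey the same first-order equation up to degree N, where the truncated
    alphabet is already complete. *)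
Lemma vec_sum_Ex a eps N n : theta a = conv eps a -> eps 0%N = 0 -> a 0%N = 1 ->
  (n <= N)%N -> vec_sum a (tree_codes N) n = Ex (Lam (fun i => eps i / INR i)) n.
Proof.
move=> aE eps0 a0 nN.
apply: (ode_uniq_le (N := N) _ _ (theta_vec_sum (tree_codes N) aE) (theta_Ex (Lam0 _))) => //.
- rewrite (@fsum_tree_codes N eps INR) // big_ord_recl big_ord0 eps0; ring.
- by move=> i iN; rewrite (@fsum_tree_codes N eps INR) // theta_Lam.
rewrite Ex0; elim: (tree_codes N) => [|c U IH]; first by rewrite vec_sum_nil.
by rewrite vec_sum_cons conv0 IH /dil dvdn0 div0n a0; ring.
Qed.

(* from 1 and from 2 are the logarithmic derivatives of fones and delta. *)
Definition from (j : nat) : fps := fun i => if (j <= i)%N then 1 else 0.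

Lemma theta_fones : theta fones = conv (from 1) fones.
Proof.
apply: fps_ext => n; rewrite /theta /conv /fones big_ord_recl /from /=.
rewrite (eq_bigr (fun=> 1)) => [|i _]; last by rewrite /bump /=; ring.
by rewrite -big_enum sum_const /= -cardE card_ord; ring.
Qed.

(** The factor exp(-z) cancels the first term of z/(1-z), the logarithmic derivative of [fones].
    This is why the exponent of D starts at i = 2. *)
Lemma theta_delta : theta delta = conv (from 2) delta.
Proof.
rewrite /delta theta_conv theta_fones (_ : theta (expc (-1)) = conv (fopp fX) (expc (-1))).
  rewrite (_ : from 2 = fadd (from 1) (fopp fX)); first by ring.
  by apply: fps_ext => -[|[|n]]; rewrite /from /fadd /fopp /fX /=; ring.
rewrite -[expc (-1)]comp_id -Ex_scal theta_Ex; last by rewrite /fscal /fX /=; ring.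
congr conv; apply: fps_ext => -[|[|n]]; rewrite /theta /fscal /fopp /fX /=; ring.
Qed.

(** For [fones] every vector has weight 1, so the product counts the forests of size n, that is, the
    trees of size n+1. *)
Lemma t_shift : (fun n => t n.+1) = Ex (Lam (fun i => from 1 i / INR i)).
Proof.
apply: fps_ext => n.
rewrite -(@vec_sum_Ex fones (from 1) n n) ?theta_fones //.
rewrite /t (@card_polya_trees n.+1 n.+1) // -(@size_count_vecs n n n.+1) //.
rewrite /vec_sum (eq_bigr (fun=> 1)) => [|v _]; last first.
  by elim: v => [|m v IH]; rewrite ?big_nil // big_cons IH /fones; ring.
by rewrite sum_const; ring.
Qed.

Lemma d_Ex : d = Ex (Lam (fun i => from 2 i / INR i)).
Proof.
apply: fps_ext => n; rewrite -(@vec_sum_Ex delta (from 2) n n) ?theta_delta //; last first.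
  by rewrite /delta conv0 /expc /fones /=; field.
rewrite /d /vec_sum; under [RHS]eq_bigr => v _ do rewrite -[\big[_/_]_(_ <- v) _]Rmult_1_l.
rewrite -(@sum_D_forests n n (fun=> 1) (leqnn n)); apply: eq_bigr => p _; ring.
Qed.

Lemma sum_d2 n K : (n < K)%N ->
  \sum_(k < K) INR k * d2 n k = conv (Lam (from 2)) d n.
Proof.
move=> nK; transitivity (\sum_(p in D_forests n) INR #|Defs.roots p| * weight p).
  transitivity (\sum_(k < K) \sum_(p in D_forests n)
      if #|Defs.roots p| == k then INR k * weight p else 0).
    by apply: eq_bigr => k _; rewrite /d2 big_distrr big_mkcondr.
  rewrite exchange_big /=; apply: eq_bigr => p _; rewrite -big_mkcond /=.
  have pK : (#|Defs.roots p| < K)%N.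
    by apply: leq_ltn_trans nK; rewrite -[X in (_ <= X)%N]card_ord; exact: max_card.
  by rewrite (big_pred1 (Ordinal pK)) // => k; rewrite -val_eqE /= eq_sym.
rewrite (@sum_D_forests n n) // -/(vec_msum delta (tree_codes n) n).
rewrite (vec_msumE _ theta_delta) d_Ex; apply: conv_eq_le => i ni; last first.
  apply: vec_sum_Ex => //; first exact: theta_delta.
  by rewrite /delta conv0 /expc /fones /=; field.
have := @fsum_tree_codes n (from 2) (fun=> 1) i erefl ni; rewrite /Lam.
rewrite (_ : fsum _ _ i = fsum (tree_codes n) (fun c => dil (csize c) (from 2)) i).
  by move=> ->; apply: eq_bigr => j _; congr (_ * dil _ _ _); apply: fps_ext => k; ring.
by apply: eq_bigr => c _; rewrite /fscal; ring.
Qed.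

Lemma d2_big n k : (n < k)%N -> d2 n k = 0.
Proof.
move=> nk; rewrite /d2 big_pred0 // => p; apply/negP => /andP[_ /eqP pk].
move: nk; rewrite -pk ltnNge -[X in (_ <= X)%N]card_ord; apply/negP/negPn; exact: max_card.
Qed.

(** * Series *)

Lemma sum_nE (a : nat -> R) n : sum_n a n = \sum_(i < n.+1) a i.
Proof.
elim: n => [|n IH]; first by rewrite sum_O big_ord1.
by rewrite [RHS]big_ord_recr sum_Sn IH.
Qed.

Lemma sum_f_R0E (a : nat -> R) n : sum_f_R0 a n = \sum_(i < n.+1) a i.
Proof. by rewrite -sum_n_Reals sum_nE. Qed.

Lemma ex_series_bounded (a : nat -> R) M : (forall n, 0 <= a n) ->
  (forall n, \sum_(i < n) a i <= M) -> ex_series a /\ Series a <= M.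
Proof.
move=> a0 aM.
have [l lE] : ex_finite_lim_seq (sum_n a).
  apply: (ex_finite_lim_seq_incr _ M) => n; last by rewrite sum_nE; exact: aM.
  by rewrite sum_Sn /plus /=; have := a0 n.+1; lra.
have sl : is_series a l by exact: lE.
split; first by exists l.
rewrite (is_series_unique _ _ sl).
have := is_lim_seq_le _ _ l M (fun n => _) lE (is_lim_seq_const M); apply.
by move=> n; rewrite sum_nE; exact: aM.
Qed.

Lemma sum_ord_ge0 (a : nat -> R) n : (forall i, 0 <= a i) -> 0 <= \sum_(i < n) a i.
Proof. by move=> a0; apply: sum_ge0. Qed.

Lemma Series_ge0 (a : nat -> R) : (forall n, 0 <= a n) -> ex_series a -> 0 <= Series a.
Proof.
move=> a0 exa; rewrite -(Rmult_0_l (Series a)) -Series_scal_l.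
by apply: Series_le => // n; have := a0 n; lra.
Qed.

Lemma partial_le_Series (a : nat -> R) n : (forall n, 0 <= a n) -> ex_series a ->
  \sum_(i < n) a i <= Series a.
Proof.
move=> a0 exa; case: n => [|n].
  by rewrite big_ord0; exact: Series_ge0.
have [l lE] := exa; rewrite (is_series_unique _ _ lE).
have H : forall m, (n <= m)%N -> \sum_(i < n.+1) a i <= sum_n a m.
  move=> m nm; rewrite sum_nE -!(big_mkord xpredT) (@big_cat_nat _ _ _ n.+1 0 m.+1) //=.
  have : 0 <= \big[Rplus/0]_(n.+1 <= i < m.+1) a i by apply: sum_ge0.
  lra.
have := is_lim_seq_le_loc (fun=> \sum_(i < n.+1) a i) (sum_n a) _ l _ (is_lim_seq_const _) lE.
by apply; exists n => m nm; apply: H; apply/leP.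
Qed.

Lemma Series_split (a : nat -> R) n : ex_series a ->
  Series a = \sum_(i < n) a i + Series (fun k => a (n + k)%N).
Proof.
move=> exa; case: n => [|n]; first by rewrite big_ord0 Rplus_0_l.
by rewrite (Series_incr_n a n.+1) ?sum_f_R0E //; lia.
Qed.

Lemma ex_series_shift (a : nat -> R) n : ex_series a -> ex_series (fun k => a (n + k)%N).
Proof. by move=> exa; apply/(ex_series_incr_n a n). Qed.

Lemma ex_series_leR (a b : nat -> R) : (forall n, Rabs (a n) <= b n) ->
  ex_series b -> ex_series a.
Proof. exact: (@ex_series_le R_AbsRing R_CompleteNormedModule). Qed.

Lemma Series_tail_le (a g : nat -> R) n : ex_series a -> ex_series g ->
  (forall j, 0 <= g j) -> (forall j, (n <= j)%N -> Rabs (a j) <= g j) ->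
  Rabs (Series a - \sum_(j < n) a j) <= Series g.
Proof.
move=> exa exg g0 ag; rewrite (Series_split n exa).
rewrite (_ : _ + _ - _ = Series (fun k => a (n + k)%N)); last by ring.
have exgn := ex_series_shift n exg.
have ag' k : Rabs (a (n + k)%N) <= g (n + k)%N by apply: ag; rewrite leq_addr.
apply: Rle_trans (Series_Rabs _ _) _.
  by apply: ex_series_leR exgn => k; rewrite Rabs_Rabsolu.
apply: Rle_trans (Series_le _ _ _ exgn) _.
  by move=> k; split; [exact: Rabs_pos | exact: ag'].
by rewrite (Series_split n exg); have := sum_ord_ge0 n g0; lra.
Qed.

Lemma Series_term_le (a : nat -> R) n : (forall n, 0 <= a n) -> ex_series a -> a n <= Series a.
Proof.
move=> a0 exa; apply: Rle_trans (partial_le_Series n.+1 a0 exa).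
rewrite sum_recr; have := sum_ord_ge0 n a0; lra.
Qed.

Lemma Series_mult (a b : nat -> R) :
  ex_series (fun n => Rabs (a n)) -> ex_series (fun n => Rabs (b n)) ->
  is_series (conv a b) (Series a * Series b).
Proof.
move=> exa exb.
have := is_series_mult a b _ _ (Series_correct _ (ex_series_Rabs _ exa))
  (Series_correct _ (ex_series_Rabs _ exb)) exa exb.
by apply: is_series_ext => n; rewrite sum_f_R0E.
Qed.

(* Summability against cubes, all that is needed of the exponentially small
   factors below. *)
Definition wsum (k : nat -> R) := ex_series (fun j => INR j.+1 ^ 3 * Rabs (k j)).

Lemma wsum_Rabs k : wsum k -> ex_series (fun j => Rabs (k j)).
Proof.
apply: ex_series_leR => j; rewrite Rabs_Rabsolu.
have : 1 <= INR j.+1 ^ 3 by apply: pow_R1_Rle; rewrite S_INR; have := pos_INR j; lra.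
by have := Rabs_pos (k j); nra.
Qed.

Lemma wsum_geom k M q : 0 < q < 1 -> (forall j, Rabs (k j) <= M * q ^ j) -> wsum k.
Proof.
move=> q01 kM.
have ex3 : ex_series (fun j => INR j.+1 ^ 3 * q ^ j).
  have pos j : 0 < INR j.+1 ^ 3 * q ^ j.
    by apply: Rmult_lt_0_compat; apply: pow_lt; [exact: lt_0_INR (Nat.lt_0_succ j) | lra].
  apply: (ex_series_ext (fun j => Rabs (INR j.+1 ^ 3 * q ^ j))).
    by move=> j; rewrite Rabs_pos_eq //; have := pos j; lra.
  apply: (ex_series_DAlembert _ q); first lra.
    by move=> j; have := pos j; lra.
  have lim1 : is_lim_seq (fun n => (1 + / INR n.+1) ^ 3 * q) (Rbar.Finite q).
    have -> : Rbar.Finite q = Rbar_mult ((1 + 0) ^ 3) q by rewrite /= ; congr Rbar.Finite; ring.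
    apply: (is_lim_seq_scal_r (fun n => (1 + / INR n.+1) ^ 3) q (Rbar.Finite ((1 + 0) ^ 3))).
    have inv0 : is_lim_seq (fun n => / INR n.+1) 0.
      apply/(is_lim_seq_incr_1 (fun n => / INR n)).
      by apply: (is_lim_seq_inv _ p_infty) => //; exact: is_lim_seq_INR.
    have c3 : continuity_pt (fun x => (1 + x) ^ 3) 0 by apply: derivable_continuous_pt; auto_derive.
    exact: (is_lim_seq_continuous (fun x => (1 + x) ^ 3) (fun n => / INR n.+1) 0 c3 inv0).
  apply: is_lim_seq_ext lim1 => n.
  rewrite Rabs_pos_eq; last first.
    by apply: Rlt_le; apply: Rdiv_lt_0_compat; apply: pos.
  have n0 : INR n.+1 <> 0 by apply: not_0_INR.
  have qn : q ^ n <> 0 by apply: pow_nonzero; lra.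
  rewrite (S_INR n.+1) [q ^ n.+1]/=; field; split=> //.
apply: (@ex_series_leR _ (fun j => scal M (INR j.+1 ^ 3 * q ^ j))); last first.
  exact: (@ex_series_scal_l R_AbsRing R_NormedModule).
move=> j; change (Rabs (INR j.+1 ^ 3 * Rabs (k j)) <= M * (INR j.+1 ^ 3 * q ^ j)).
rewrite Rabs_mult Rabs_Rabsolu.
have p3 : 0 <= INR j.+1 ^ 3 by apply: pow_le; exact: pos_INR.
by rewrite Rabs_pos_eq //; have := kM j; nra.
Qed.

(** * The coefficients of the square root and the asymptotic scale *)

(** The coefficients of sqrt(1 - z) by their quotients; they are negative from degree 1 on. *)
Fixpoint sqc (n : nat) : R :=
  if n is n'.+1 then sqc n' * (INR n' - / 2) / INR n'.+1 else 1.

Lemma sqcS n : sqc n.+1 = sqc n * (INR n - / 2) / INR n.+1.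
Proof. by []. Qed.

Definition bt (n : nat) : R := - sqc n.

Lemma theta_sqc : conv (fsub fone fX) (theta sqc) = conv (fscal (- / 2) fX) sqc.
Proof.
rewrite fscal_convl (_ : conv (fsub fone fX) _ = fsub (theta sqc) (conv fX (theta sqc))); last by ring.
apply: fps_ext => n; rewrite /fsub /fscal !conv_fX /theta.
case: n => [|n]; first by rewrite /=; ring.
rewrite sqcS; field; exact: not_0_INR.
Qed.

(** Both series solve (1 - z) theta F = - z F with constant term 1. *)
Lemma sqc_square : conv sqc sqc = fsub fone fX.
Proof.
have onesK : conv fones (fsub fone fX) = fone.
  rewrite (_ : conv _ _ = fsub fones (conv fX fones)); last by ring.
  by apply: fps_ext => -[|n]; rewrite /fsub conv_fX /fones /fone /=; ring.
have key F : conv (fsub fone fX) (theta F) = conv (fopp fX) F ->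
    theta F = conv (fopp (conv fX fones)) F.
  move=> E; rewrite -[LHS]conv1l -onesK -convA E; ring.
apply: (@ode_uniq (fopp (conv fX fones))).
- by rewrite /fopp conv0 /fX /=; ring.
- apply: key; rewrite theta_conv.
  rewrite (_ : conv (fsub fone fX) _ = fadd (conv (conv (fsub fone fX) (theta sqc)) sqc)
      (conv sqc (conv (fsub fone fX) (theta sqc)))); last by ring.
  rewrite theta_sqc !fscal_convl fscal_convr.
  rewrite -[LHS]/(fun n => _) /fadd /fscal; apply: fps_ext => n.
  rewrite (_ : conv sqc (conv fX sqc) = conv (conv fX sqc) sqc); last by ring.
  rewrite (_ : conv (fopp fX) (conv sqc sqc) = fopp (conv (conv fX sqc) sqc)); last by ring.
  by rewrite /fopp; field.
- apply: key; rewrite (_ : theta (fsub fone fX) = fopp fX); first by ring.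
  by apply: fps_ext => -[|[|n]]; rewrite /theta /fsub /fone /fX /fopp /=; ring.
- by rewrite conv0 /fsub /fone /fX /=; ring.
Qed.

Lemma conv_eq0 (u v : fps) : conv u v = fzero -> v 0%N <> 0 -> u = fzero.
Proof.
move=> uv v0; apply: fps_ext; elim/ltn_ind => n IH.
have := congr1 (fun a : fps => a n) uv; rewrite /conv big_ord_recr /= subnn.
rewrite big1 => [|i _]; last by rewrite IH // /fzero; ring.
by rewrite Rplus_0_l /fzero => /Rmult_integral[].
Qed.

Lemma fps_sqrt_uniq (a b : fps) : conv a a = conv b b -> a 0%N = 1 -> b 0%N = 1 -> a = b.
Proof.
move=> E a0 b0.
have /conv_eq0 H : conv (fsub a b) (fadd a b) = fzero.
  rewrite (_ : conv _ _ = fsub (conv a a) (conv b b)); last by ring.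
  by rewrite E; ring.
have {}H := H (ltac:(rewrite /fadd a0 b0; lra)).
by apply: fps_ext => n; have := congr1 (fun a : fps => a n) H; rewrite /fsub /fzero; lra.
Qed.

Lemma btS n : bt n.+1 = bt n * (INR n - / 2) / INR n.+1.
Proof. by rewrite /bt sqcS /Rdiv; ring. Qed.

Lemma INR_ge1 n : (0 < n)%N -> 1 <= INR n.
Proof. by move=> n0; apply: (le_INR 1); apply/leP. Qed.

Lemma bt1 : bt 1 = / 2.
Proof. by rewrite btS /bt /=; field. Qed.

Lemma bt_gt0 n : (0 < n)%N -> 0 < bt n.
Proof.
elim: n => // -[|n] IH _; first by rewrite bt1; lra.
rewrite btS; apply: Rdiv_lt_0_compat; last exact: lt_0_INR (Nat.lt_0_succ _).
by have := IH isT; have := @INR_ge1 n.+1 isT; nra.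
Qed.

(** With [bt_incr], an elementary substitute for bt n being of order n^(-3/2): the two
    monotonicities compare bt at m - j with bt at m. *)
Lemma bt_decr n m : (0 < n)%N -> (n <= m)%N -> INR m * bt m <= INR n * bt n.
Proof.
move=> n0; elim: m => [|m IH]; first by case: (n) n0.
rewrite leq_eqVlt => /orP[/eqP->|]; first exact: Rle_refl.
rewrite ltnS => nm; apply: Rle_trans (IH nm).
have m0 : (0 < m)%N by apply: leq_trans nm.
rewrite btS (_ : INR m.+1 * _ = bt m * (INR m - / 2)); last by field; exact: not_0_INR.
by have := bt_gt0 m0; nra.
Qed.

Lemma bt_incr n m : (0 < n)%N -> (n <= m)%N -> INR n ^ 2 * bt n <= INR m ^ 2 * bt m.
Proof.
move=> n0; elim: m => [|m IH]; first by case: (n) n0.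
rewrite leq_eqVlt => /orP[/eqP->|]; first exact: Rle_refl.
rewrite ltnS => nm; apply: Rle_trans (IH nm) _.
have m0 : (0 < m)%N by apply: leq_trans nm.
rewrite btS (_ : INR m.+1 ^ 2 * _ = bt m * ((INR m - / 2) * INR m.+1)); last first.
  by field; exact: not_0_INR.
rewrite S_INR; have := bt_gt0 m0; have := INR_ge1 m0.
move=> h1 h2; rewrite Rmult_comm; apply: Rmult_le_compat_l; nra.
Qed.

Lemma bt_half m : (0 < m)%N -> 1 <= 2 * INR m ^ 2 * bt m.
Proof. by move=> m0; have := @bt_incr 1 m isT m0; rewrite bt1 /=; lra. Qed.

Lemma sqc_le1 n : Rabs (sqc n) <= 1.
Proof.
case: n => [|n]; first by rewrite /= Rabs_R1; lra.
have bn := bt_gt0 (ltn0Sn n); have := @bt_decr 1 n.+1 isT isT; rewrite bt1.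
have := @INR_ge1 n.+1 isT; rewrite Rabs_left; last by move: bn; rewrite /bt; lra.
rewrite -/(bt n.+1) [INR 1]/=; nra.
Qed.

(** Leading term c bt m with an error smaller by a factor of order 1/m; for c = 0 it means O(bt m /
    m). *)
Definition asym (a : nat -> R) (c : R) :=
  exists A, forall m, (0 < m)%N -> Rabs (a m - c * bt m) <= A * (bt m / INR m).

Lemma bt_div_gt0 m : (0 < m)%N -> 0 < bt m / INR m.
Proof. by move=> m0; apply: Rdiv_lt_0_compat; [exact: bt_gt0 | have := INR_ge1 m0; lra]. Qed.

Lemma asym_pos a c : asym a c ->
  exists2 A, 0 <= A & forall m, (0 < m)%N -> Rabs (a m - c * bt m) <= A * (bt m / INR m).
Proof.
move=> [A aA]; exists (Rabs A); first exact: Rabs_pos.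
move=> m m0; apply: Rle_trans (aA m m0) _.
by have := bt_div_gt0 m0; have := Rle_abs A; nra.
Qed.

Lemma asym_add a b c e : asym a c -> asym b e -> asym (fun n => a n + b n) (c + e).
Proof.
move=> [A aA] [B bB]; exists (A + B) => m m0.
rewrite (_ : _ - _ = (a m - c * bt m) + (b m - e * bt m)); last by ring.
apply: Rle_trans (Rabs_triang _ _) _; have := aA m m0; have := bB m m0; lra.
Qed.

Lemma asym_scal a c l : asym a c -> asym (fun n => l * a n) (l * c).
Proof.
move=> [A aA]; exists (Rabs l * A) => m m0.
rewrite (_ : _ - _ = l * (a m - c * bt m)); last by ring.
by rewrite Rabs_mult; have := aA m m0; have := Rabs_pos l; nra.
Qed.

(** A factor k with a finite cubic moment multiplies the constant by its value at 1: moving from m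
    to m - j costs at most a factor of order (j+1)^3, and the missing tail of k is O(1/m) by the
    same moment. *)
Lemma conv_asym a c k : asym a c -> wsum k -> asym (conv a k) (c * Series k).
Proof.
move=> /asym_pos[A A0 aA] wk; have exk := wsum_Rabs wk.
pose B := A + 3 * Rabs c + 2 * Rabs (a 0%N); pose S := Series (fun j => INR j.+1 ^ 3 * Rabs (k j)).
have B0 : 0 <= B by have := Rabs_pos c; have := Rabs_pos (a 0%N); rewrite /B; lra.
exists ((B + Rabs c) * S) => m m0.
have bm := bt_div_gt0 m0; have btm := bt_gt0 m0; have m1 := INR_ge1 m0.
pose X := bt m / INR m; have btX : bt m = X * INR m by rewrite /X; field; lra.
have X0 : 0 < X by [].
have term j : (j <= m)%N -> Rabs (a (m - j)%N - c * bt m) <= B * INR j.+1 ^ 3 * X.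
  have j3 : 1 <= INR j.+1 ^ 3 by apply: pow_R1_Rle; exact: INR_ge1.
  rewrite leq_eqVlt => /orP[/eqP ->|jm].
    (* For j = m the value is [a 0], which A does not control; 1 <= 2 m^2 bt m still fits it under
       (m+1)^3 bt m / m. *)
    rewrite subnn; apply: Rle_trans (Rabs_triang _ _) _.
    rewrite Rabs_Ropp Rabs_mult (Rabs_pos_eq (bt m)); last lra.
    have m3 : INR m ^ 3 <= INR m.+1 ^ 3.
      by apply: pow_incr; split; [lra | rewrite S_INR; lra].
    have E1 : INR m ^ 3 * X = INR m ^ 2 * bt m by rewrite btX; ring.
    have H1 := bt_half m0.
    have H2 : bt m <= INR m.+1 ^ 3 * X.
      rewrite btX Rmult_comm; apply: Rmult_le_compat_r; first lra.
      apply: Rle_trans m3; rewrite -{1}[INR m]Rmult_1_r /=; nra.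
    have H3 : 1 <= 2 * (INR m.+1 ^ 3 * X).
      apply: Rle_trans H1 _; have h : INR m ^ 3 * X <= INR m.+1 ^ 3 * X by nra.
      lra.
    have ca := Rabs_pos c; have aa := Rabs_pos (a 0%N).
    rewrite /B (Rmult_assoc _ (INR m.+1 ^ 3)).
    set Z := INR m.+1 ^ 3 * X in H2 H3 *; nra.
  have n0 : (0 < m - j)%N by rewrite subn_gt0.
  set n := (m - j)%N in n0 *; have n1 := INR_ge1 n0.
  have mE : INR m = INR n + INR j by rewrite -plus_INR; congr INR; rewrite /n; lia.
  have j0 := pos_INR j; have jS := S_INR j.
  have mn : INR m <= INR n * INR j.+1 by rewrite mE jS; nra.
  have bn := bt_gt0 n0.
  have nm : (n <= m)%N by rewrite /n leq_subr.
  have i1 := bt_incr n0 nm; have i2 := bt_decr n0 nm.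
  (* bt n <= (m/n)^2 bt m, and m/n <= j+1 *)
  have bn2 : bt n <= INR j.+1 ^ 2 * bt m.
    have : INR m ^ 2 <= (INR n * INR j.+1) ^ 2 by apply: pow_incr; lra.
    rewrite Rpow_mult_distr => h.
    apply: (Rmult_le_reg_l (INR n ^ 2)); first by apply: pow_lt; lra.
    apply: Rle_trans i1 _; rewrite -Rmult_assoc; apply: Rmult_le_compat_r; lra.
  have T1 : bt n / INR n <= INR j.+1 ^ 3 * X.
    have inv : / INR n <= INR j.+1 / INR m.
      apply: (Rmult_le_reg_l (INR n * INR m)); first by nra.
      have E1 : INR n * INR m * / INR n = INR m by field; lra.
      have E2 : INR n * INR m * (INR j.+1 / INR m) = INR n * INR j.+1 by field; lra.
      by rewrite E1 E2.
    rewrite (_ : INR j.+1 ^ 3 * X = (INR j.+1 ^ 2 * bt m) * (INR j.+1 / INR m)); last first.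
      by rewrite /X; field; lra.
    apply: Rmult_le_compat => //; [lra | left; apply: Rinv_0_lt_compat; lra].
  have T2 : 0 <= bt n - bt m <= 2 * INR j.+1 ^ 3 * X.
    split; first by nra.
    have h1 : INR n ^ 2 * (bt n - bt m) <= (INR m ^ 2 - INR n ^ 2) * bt m by lra.
    have h2 : (INR m ^ 2 - INR n ^ 2) <= 2 * INR j * INR m by rewrite mE; nra.
    have h3 : INR m * INR m <= INR n ^ 2 * INR j.+1 ^ 2.
      rewrite (_ : INR n ^ 2 * INR j.+1 ^ 2 = (INR n * INR j.+1) * (INR n * INR j.+1)); last by ring.
      by apply: Rmult_le_compat; lra.
    have h4 : INR n ^ 2 * (bt n - bt m) <= 2 * INR j * (INR m * INR m) * X.
      rewrite (_ : 2 * INR j * (INR m * INR m) * X = 2 * INR j * INR m * bt m); last by rewrite btX; ring.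
      by apply: Rle_trans h1 _; apply: Rmult_le_compat_r; lra.
    apply: (Rmult_le_reg_l (INR n ^ 2)); first by apply: pow_lt; lra.
    apply: Rle_trans h4 _.
    apply: Rle_trans (_ : 2 * INR j * (INR n ^ 2 * INR j.+1 ^ 2) * X <= _).
      apply: Rmult_le_compat_r; first lra.
      by apply: Rmult_le_compat_l; lra.
    have n2 : 0 < INR n ^ 2 by apply: pow_lt; lra.
    have j2 : 0 < INR j.+1 ^ 2 by apply: pow_lt; lra.
    rewrite (_ : INR n ^ 2 * (2 * INR j.+1 ^ 3 * X) = 2 * INR j.+1 * (INR n ^ 2 * INR j.+1 ^ 2) * X); last by ring.
    apply: Rmult_le_compat_r; first lra.
    apply: Rmult_le_compat_r; first by nra.
    lra.
  rewrite (_ : _ - _ = (a n - c * bt n) + c * (bt n - bt m)); last by ring.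
  apply: Rle_trans (Rabs_triang _ _) _; rewrite Rabs_mult (Rabs_pos_eq (bt n - bt m)); last lra.
  have := aA n n0; have ca := Rabs_pos c; have aa := Rabs_pos (a 0%N).
  have j3X : 0 < INR j.+1 ^ 3 * X by nra.
  rewrite /B (Rmult_assoc _ (INR j.+1 ^ 3)); rewrite (Rmult_assoc 2) in T2.
  set Z := INR j.+1 ^ 3 * X in T1 T2 j3X *; nra.
have E : conv a k m - c * Series k * bt m =
    \sum_(j < m.+1) k j * (a (m - j)%N - c * bt m) - c * bt m * (Series k - \sum_(j < m.+1) k j).
  rewrite convC /conv (eq_bigr (fun j : 'I_m.+1 => k j * (a (m - j)%N - c * bt m) + c * bt m * k j)).
    by rewrite big_split -big_distrr /=; ring.
  by move=> j _; ring.
rewrite E; apply: Rle_trans (Rabs_triang _ _) _; rewrite Rabs_Ropp.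
have P1 : Rabs (\sum_(j < m.+1) k j * (a (m - j)%N - c * bt m)) <= B * X * S.
  apply: Rle_trans (sum_abs _ _ _) _.
  apply: Rle_trans (_ : \sum_(j < m.+1) B * X * (INR j.+1 ^ 3 * Rabs (k j)) <= _).
    apply: sum_le => j _; rewrite Rabs_mult.
    have jm : (j <= m)%N by rewrite -ltnS.
    by have := term j jm; have := Rabs_pos (k j); nra.
  rewrite -big_distrr /=; apply: Rmult_le_compat_l; first by nra.
  apply: (@partial_le_Series (fun j => INR j.+1 ^ 3 * Rabs (k j))) => // j.
  by apply: Rmult_le_pos; [apply: pow_le; exact: pos_INR | exact: Rabs_pos].
have P2 : Rabs (Series k - \sum_(j < m.+1) k j) <= / INR m * S.
  rewrite /S -Series_scal_l; apply: Series_tail_le.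
  - exact: ex_series_Rabs.
  - exact: (@ex_series_scal_l R_AbsRing R_NormedModule (/ INR m) _ wk).
  - move=> j; apply: Rmult_le_pos; first by left; apply: Rinv_0_lt_compat; lra.
    by apply: Rmult_le_pos; [apply: pow_le; exact: pos_INR | exact: Rabs_pos].
  move=> j mj; rewrite -Rmult_assoc -{1}[Rabs _]Rmult_1_l.
  apply: Rmult_le_compat_r; first exact: Rabs_pos.
  apply: (Rmult_le_reg_l (INR m)); first lra.
  rewrite -Rmult_assoc Rinv_r ?Rmult_1_l ?Rmult_1_r; last lra.
  have mj' : INR m <= INR j.+1 by apply: le_INR; lia.
  set x := INR j.+1 in mj' *; have x2 : x <= x * x by nra.
  by rewrite (_ : x ^ 3 = x * (x * x)); [nra | ring].
rewrite Rabs_mult Rabs_mult (Rabs_pos_eq (bt m)); last lra.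
have -> : (B + Rabs c) * S * X = B * X * S + Rabs c * bt m * (/ INR m * S).
  by rewrite btX; field; lra.
apply: Rplus_le_compat => //; apply: Rmult_le_compat_l => //.
by apply: Rmult_le_pos; [exact: Rabs_pos | lra].
Qed.

Lemma geom_asym a M q : 0 < q < 1 -> (forall j, Rabs (a j) <= M * q ^ j) -> asym a 0.
Proof.
move=> q01 aM; have wa := wsum_geom q01 aM.
exists (2 * Series (fun j => INR j.+1 ^ 3 * Rabs (a j))) => m m0.
rewrite Rmult_0_l Rminus_0_r.
have pos j : 0 <= INR j.+1 ^ 3 * Rabs (a j).
  by apply: Rmult_le_pos; [apply: pow_le; exact: pos_INR | exact: Rabs_pos].
have H := Series_term_le m pos wa.
set S := Series _ in H *.
have m1 := INR_ge1 m0.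
have m3 : INR m ^ 3 <= INR m.+1 ^ 3 by apply: pow_incr; rewrite S_INR; lra.
have m3p : 0 < INR m ^ 3 by apply: pow_lt; lra.
have H' : INR m ^ 3 * Rabs (a m) <= S by have := Rabs_pos (a m); nra.
apply: (Rmult_le_reg_l (INR m ^ 3)) => //; apply: Rle_trans H' _.
rewrite (_ : _ * _ = S * (2 * INR m ^ 2 * bt m)); last by field; lra.
have := bt_half m0; have : 0 <= S by apply: Rle_trans (pos m) H.
nra.
Qed.

(** * Partial sums of nonnegative series *)

Lemma conv_fones a n : conv a fones n = \sum_(i < n.+1) a i.
Proof. by apply: eq_bigr => i _; rewrite /fones; ring. Qed.

Lemma partial_incr (a : nat -> R) m n : (forall i, 0 <= a i) -> (m <= n)%N ->
  \sum_(i < m) a i <= \sum_(i < n) a i.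
Proof.
move=> a0 mn; rewrite -!(big_mkord xpredT) [X in _ <= X](@big_cat_nat _ _ _ m) //=.
have : 0 <= \big[Rplus/0]_(m <= i < n) a i by apply: sum_ge0.
lra.
Qed.

Lemma partial_conv (a b : fps) J : (forall i, 0 <= a i) -> (forall i, 0 <= b i) ->
  \sum_(j < J.+1) conv a b j <= (\sum_(j < J.+1) a j) * (\sum_(j < J.+1) b j).
Proof.
move=> a0 b0; rewrite -conv_fones -convA big_distrl /=; apply: sum_le => i _.
rewrite conv_fones; apply: Rmult_le_compat_l => //; apply: partial_incr => //.
by rewrite ltnS leq_subr.
Qed.

Lemma partial_fpow (u : fps) W J n : (forall i, 0 <= u i) -> \sum_(j < J.+1) u j <= W ->
  \sum_(j < J.+1) fpow u n j <= W ^ n.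
Proof.
move=> u0 uW; elim: n => [|n IH] /=.
  rewrite /fone -[X in X <= _](_ : \sum_(j < J.+1) (if (j : nat) == 0%N then (fun=> 1) (j : nat) else 0) = _) //.
  by rewrite (sum_one (fun=> 1)) /=; lra.
apply: Rle_trans (partial_conv J u0 _) _ => [i|]; first exact: fpow_ge0.
apply: Rmult_le_compat => //; apply: sum_ord_ge0 => // i; exact: fpow_ge0.
Qed.

(** Cut at the same degree, the partial sums of f(u) are bounded by those of f at a bound for u.
    Convergence of compositions then follows without rearranging double series. *)
Lemma partial_comp (f u : fps) W J : u 0%N = 0 -> (forall i, 0 <= f i) -> (forall i, 0 <= u i) ->
  \sum_(j < J.+1) u j <= W ->
  \sum_(j < J.+1) comp f u j <= \sum_(n < J.+1) f n * W ^ n.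
Proof.
move=> u0 f0 up uW.
rewrite (eq_bigr (fun j : 'I_J.+1 => \sum_(n < J.+1) f n * fpow u n j)); last first.
  by move=> j _; apply: comp_box => //; rewrite -ltnS.
rewrite exchange_big /=; apply: sum_le => n _; rewrite -big_distrr /=.
by apply: Rmult_le_compat_l => //; exact: partial_fpow.
Qed.

Lemma sc_ge0 c a i : 0 <= c -> 0 <= a i -> 0 <= sc c a i.
Proof. by move=> c0 a0; apply: Rmult_le_pos => //; exact: pow_le. Qed.

Lemma sum_geom_le W n : 0 <= W < 1 -> \sum_(i < n) W ^ i <= / (1 - W).
Proof.
move=> W01; have -> : \sum_(i < n) W ^ i = (1 - W ^ n) / (1 - W).
  elim: n => [|n IH]; first by rewrite big_ord0 /=; field; lra.
  by rewrite big_ord_recr /= IH; field; lra.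
have : 0 <= W ^ n by apply: pow_le; lra.
have i0 : 0 < / (1 - W) by apply: Rinv_0_lt_compat; lra.
rewrite /Rdiv; nra.
Qed.

(** * Composition with a probability generating function *)

(* Writing 1 - Y = (1 - z)(1 + w), the bound on Y at r makes the coefficients
   of w sum to less than 1 at r, so that the square root of 1 + w has
   exponentially small coefficients. *)
Section Transfer.
Variables (Y : fps) (r : R).
Hypotheses (Y0 : Y 0%N = 0) (Yge0 : forall i, 0 <= Y i).
Hypotheses (exY : ex_series Y) (Y1 : Series Y = 1).
Hypotheses (r1 : 1 < r) (exYr : ex_series (sc r Y)) (Yr : Series (sc r Y) < 2 * r - 1).

(** The tails of Y, which sums to 1; as a series, v = (1 - Y)/(1 - z). *)
Let v : fps := fun n => 1 - \sum_(i < n.+1) Y i.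
Let w : fps := fsub v fone.

Lemma tail_eq : conv (fsub fone fX) v = fsub fone Y.
Proof.
rewrite (_ : conv _ v = fsub v (conv fX v)); last by ring.
apply: fps_ext => -[|n]; rewrite /fsub conv_fX /v.
  by rewrite (sum_recr Y 0) big_ord0 /fone /=; ring.
by rewrite (sum_recr Y n.+1) (_ : fone n.+1 = 0) //; ring.
Qed.

Lemma tail_ge0 n : 0 <= v n.
Proof. by rewrite /v -Y1; have := partial_le_Series n.+1 Yge0 exY; lra. Qed.

Lemma tail_w0 : w 0%N = 0.
Proof. by rewrite /w /fsub /v /fone big_ord1 Y0 /=; ring. Qed.

Lemma tail_w_ge0 n : 0 <= w n.
Proof.
case: n => [|n]; first by rewrite tail_w0; lra.
by rewrite /w /fsub /fone /=; have := tail_ge0 n.+1; lra.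
Qed.

(** The value (1 - Y(r))/(1 - r) - 1 of w at r; the hypothesis [Yr] says that W < 1. *)
Let W := (Series (sc r Y) - r) / (r - 1).

Lemma tail_WE : (r - 1) * W = Series (sc r Y) - r.
Proof. by rewrite /W; field; lra. Qed.

(** Summation by parts; the boundary term v_J r^(J+1) is at most the remainder of Y(r) beyond degree
    J. *)
Lemma tail_w_sum J : \sum_(j < J.+1) sc r w j <= W.
Proof.
have vJ : v J * r ^ J.+1 <= Series (sc r Y) - \sum_(j < J.+1) sc r Y j.
  rewrite (Series_split J.+1 exYr) (_ : _ + _ - _ = Series (fun k => sc r Y (J.+1 + k)%N)); last by ring.
  rewrite (_ : v J = Series (fun k => Y (J.+1 + k)%N)); last first.
    by rewrite /v -Y1 (Series_split J.+1 exY); ring.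
  rewrite Rmult_comm -Series_scal_l; apply: Series_le; last exact: ex_series_shift.
  move=> k; split; first by apply: Rmult_le_pos => //; apply: pow_le; lra.
  rewrite /sc Rmult_comm; apply: Rmult_le_compat_l => //.
  by apply: Rle_pow; [lra | lia].
have step K : (r - 1) * \sum_(j < K.+1) sc r v j = v K * r ^ K.+1 - 1 + \sum_(j < K.+1) sc r Y j.
  elim: K => [|K IH]; first by rewrite !big_ord1 /sc /v big_ord1 Y0 /=; ring.
  rewrite (sum_recr (sc r v)) (sum_recr (sc r Y)) Rmult_plus_distr_l IH.
  have vS : v K.+1 = v K - Y K.+1 by rewrite /v (sum_recr Y K.+1); ring.
  by rewrite /sc vS /=; ring.
have -> : \sum_(j < J.+1) sc r w j = \sum_(j < J.+1) sc r v j - 1.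
  rewrite (eq_bigr (fun j : 'I_J.+1 => sc r v j - (if (j : nat) == 0%N then (fun=> 1) (j : nat) else 0))).
    by rewrite sumB (sum_one (fun=> 1)).
  by move=> j _; rewrite /sc /w /fsub /fone; case: eqP => [->|_] /=; ring.
apply: (Rmult_le_reg_l (r - 1)); first lra.
rewrite Rmult_minus_distr_l step tail_WE; lra.
Qed.

Lemma tail_W : 0 <= W < 1.
Proof.
split.
  have := tail_w_sum 0; rewrite big_ord1 /sc tail_w0; lra.
apply: (Rmult_lt_reg_l (r - 1)); first lra.
rewrite tail_WE; lra.
Qed.

(** The square root of v = 1 + w, since [sqc] is sqrt(1 - z). *)
Let k : fps := comp sqc (fopp w).

Lemma rpow_gt0 j : 0 < r ^ j. Proof. by apply: pow_lt; lra. Qed.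

(** The coefficients of sqrt(1 - z) are at most 1 in absolute value and that of w^i at degree j is
    at most W^i / r^j, so the sum over i is geometric. *)
Lemma tail_k_le j : Rabs (k j) <= / (1 - W) * (/ r) ^ j.
Proof.
have rj := rpow_gt0 j.
apply: (Rmult_le_reg_r (r ^ j)) => //.
rewrite Rmult_assoc -Rpow_mult_distr Rinv_l ?pow1 ?Rmult_1_r; last lra.
apply: Rle_trans (sum_geom_le j.+1 tail_W).
rewrite /k /comp; apply: Rle_trans (Rmult_le_compat_r _ _ _ (Rlt_le _ _ rj) (sum_abs _ _ _)) _.
rewrite big_distrl /=; apply: sum_le => i _.
rewrite Rabs_mult (_ : fopp w = fscal (-1) w); last by apply: fps_ext => n; rewrite /fopp /fscal; ring.
rewrite fpow_scal /fscal Rabs_mult -RPow_abs Rabs_Ropp Rabs_R1 pow1 Rmult_1_l.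
have p0 : 0 <= fpow w i j by apply: fpow_ge0 => n _; exact: tail_w_ge0.
rewrite (Rabs_pos_eq (fpow w i j)) //.
have : fpow w i j * r ^ j <= W ^ i.
  rewrite -/(sc r (fpow w i) j) sc_fpow.
  have sw0 n : 0 <= sc r w n by apply: sc_ge0; [lra | exact: tail_w_ge0].
  apply: Rle_trans (partial_fpow i sw0 (tail_w_sum j)).
  rewrite (sum_recr (fpow (sc r w) i)).
  have : 0 <= \sum_(n < j) fpow (sc r w) i n.
    by apply: sum_ord_ge0 => n; apply: fpow_ge0.
  lra.
have := sqc_le1 i; have := Rabs_pos (sqc i).
have : 0 <= fpow w i j * r ^ j by apply: Rmult_le_pos; lra.
set X := fpow w i j * r ^ j; rewrite Rmult_assoc -/X; nra.
Qed.

Lemma r_inv : 0 < / r < 1.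
Proof.
split; first by apply: Rinv_0_lt_compat; lra.
by rewrite -Rinv_1; apply: Rinv_lt_contravar; lra.
Qed.

Lemma tail_k_wsum : wsum k.
Proof. exact: wsum_geom r_inv tail_k_le. Qed.

Lemma tail_v_wsum : wsum v.
Proof.
apply: (wsum_geom (M := W + 1) r_inv) => j; have rj := rpow_gt0 j.
apply: (Rmult_le_reg_r (r ^ j)) => //.
rewrite Rmult_assoc -Rpow_mult_distr Rinv_l ?pow1 ?Rmult_1_r; last lra.
rewrite Rabs_pos_eq; last exact: tail_ge0.
have := tail_w_sum j; rewrite sum_recr => H.
have sw : 0 <= \sum_(n < j) sc r w n.
  by apply: sum_ord_ge0 => n; apply: sc_ge0; [lra | exact: tail_w_ge0].
have : sc r w j <= W by lra.
rewrite /sc /w /fsub /fone; case: j {H sw rj} => [|j] /=; lra.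
Qed.

Lemma tail_k_square : conv k k = v.
Proof.
have w0 : fopp w 0%N = 0 by rewrite /fopp tail_w0; ring.
rewrite /k -comp_conv // sqc_square comp_sub comp_fone comp_fX //.
by apply: fps_ext => n; rewrite /fsub /fopp /w /fsub; ring.
Qed.

(** The square of k(1) is v(1), which is at least the constant term 1 of v. *)
Lemma Series_k_neq0 : Series k <> 0.
Proof.
have exk := wsum_Rabs tail_k_wsum.
have := Series_mult exk exk; rewrite tail_k_square => /is_series_unique E k0.
have := Series_term_le 0 tail_ge0 (ex_series_Rabs _ (wsum_Rabs tail_v_wsum)).
by rewrite E k0 /v big_ord1 Y0; lra.
Qed.

Lemma comp_sqcY : comp sqc Y = conv sqc k.
Proof.
apply: fps_sqrt_uniq.
- rewrite -comp_conv // sqc_square comp_sub comp_fone comp_fX // -tail_eq -tail_k_square -sqc_square.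
  ring.
- by rewrite comp0.
- by rewrite conv0 /k comp0 /=; ring.
Qed.

(** The majorant (1 - y)^(3/2) for error terms: from n = 2 on its coefficients are positive and
    comparable to bt n / n. *)
Let chi : fps := conv (fsub fone fX) sqc.

Lemma chiS n : chi n.+1 = bt n - bt n.+1.
Proof.
rewrite /chi (_ : conv _ sqc = fsub sqc (conv fX sqc)); last by ring.
by rewrite /fsub conv_fX /bt; ring.
Qed.

Lemma chi_ge n : (1 < n)%N -> bt n / INR n <= chi n <= 6 * (bt n / INR n).
Proof.
case: n => // n; rewrite ltnS => n0; rewrite chiS.
have n1 := INR_ge1 n0; have b0 := bt_gt0 n0; have b1 := bt_gt0 (ltn0Sn n).
have E := btS n.
have nS := S_INR n.
have E2 : bt n.+1 * (INR n + 1) = bt n * (INR n - / 2) by rewrite E nS; field; lra.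
rewrite nS; set X := bt n.+1 / _; have XE : bt n.+1 = X * (INR n + 1) by rewrite /X; field; lra.
have X0 : 0 < X by apply: Rdiv_lt_0_compat; lra.
rewrite XE in E2 *.
have E3 : bt n = X * (INR n + 1) ^ 2 / (INR n - / 2) by rewrite (_ : X * (INR n + 1) ^ 2 = bt n * (INR n - / 2)); [field; lra | rewrite -E2; ring].
have E4 : bt n - X * (INR n + 1) = X * ((INR n + 1) * (3 / 2) / (INR n - / 2)).
  by rewrite E3; field; lra.
rewrite E4 (Rmult_comm 6); split.
  rewrite -{1}[X]Rmult_1_r; apply: Rmult_le_compat_l; first lra.
  apply: (Rmult_le_reg_r (INR n - / 2)); first lra.
  by rewrite /Rdiv Rmult_assoc Rinv_l; lra.
apply: Rmult_le_compat_l; first lra.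
apply: (Rmult_le_reg_r (INR n - / 2)); first lra.
by rewrite /Rdiv Rmult_assoc Rinv_l; lra.
Qed.

Lemma chi_asym : asym chi 0.
Proof.
exists 6 => -[|[|m]] // _; rewrite Rmult_0_l Rminus_0_r.
  rewrite chiS /bt /= Rabs_left; lra.
have H := @chi_ge m.+2 isT; have := @bt_div_gt0 m.+2 isT => p.
by rewrite Rabs_pos_eq; lra.
Qed.

(** Here (1 - Y)^(3/2) = (1 - z)^(3/2) v k, and both v and k decay exponentially. *)
Lemma comp_chi_asym : asym (comp chi Y) 0.
Proof.
rewrite /chi comp_conv // comp_sub comp_fone comp_fX // comp_sqcY -tail_eq.
rewrite (_ : conv _ _ = conv (conv chi v) k); last by rewrite /chi; ring.
have := conv_asym (conv_asym chi_asym tail_v_wsum) tail_k_wsum.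
by rewrite !Rmult_0_l.
Qed.

Lemma Y_asym : asym Y 0.
Proof.
apply: (@geom_asym _ (Series (sc r Y)) (/ r) r_inv) => j; have rj := rpow_gt0 j.
apply: (Rmult_le_reg_r (r ^ j)) => //.
rewrite Rmult_assoc -Rpow_mult_distr Rinv_l ?pow1 ?Rmult_1_r; last lra.
rewrite Rabs_pos_eq //; apply: (Series_term_le j (a := sc r Y)) => // n.
by apply: sc_ge0 => //; lra.
Qed.

Lemma comp_asym_transfer : exists2 K, K <> 0 &
  forall a c, asym a c -> asym (comp a Y) (c * K).
Proof.
exists (Series k); first exact: Series_k_neq0.
move=> a c /asym_pos[A A0 aA].
have sq : asym (comp sqc Y) (- Series k).
  rewrite comp_sqcY (_ : - Series k = -1 * Series k); last by ring.
  apply: conv_asym tail_k_wsum; exists 0 => m m0.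
  rewrite (_ : sqc m - _ = 0) ?Rabs_R0; [lra | rewrite /bt; ring].
have [M1 M1p H1] := asym_pos comp_chi_asym; have [M2 M2p H2] := asym_pos Y_asym.
have [M3 H3] := sq.
exists (Rabs c * M3 + A * M1 + 3 * A * M2) => m m0.
pose e n := a n + c * sqc n.
have eE : comp a Y m = comp e Y m - c * comp sqc Y m.
  rewrite -/(fscal c (comp sqc Y) m) -comp_scal -/(fsub (comp e Y) _ m) -comp_sub.
  by congr (comp _ Y m); apply: fps_ext => n; rewrite /fsub /fscal /e; ring.
have pw n : 0 <= fpow Y n m by apply: fpow_ge0.
have eB n : (0 < n)%N -> Rabs (e n) <= A * (bt n / INR n).
  by move=> n0; have := aA n n0; rewrite /e /bt (_ : a n - c * - sqc n = a n + c * sqc n); [|ring].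
(* The term 3 A Y repairs degree 1, where chi takes the negative value -3/2. *)
have main : Rabs (comp e Y m) <= A * comp chi Y m + 3 * A * Y m.
  have E : A * comp chi Y m + 3 * A * Y m =
      \sum_(n < m.+1) (A * chi n + (if (n : nat) == 1%N then (fun=> 3 * A) (n : nat) else 0)) * fpow Y n m.
    have -> : 3 * A * Y m = \sum_(n < m.+1) (if (n : nat) == 1%N then (fun n => 3 * A * fpow Y n m) (n : nat) else 0).
      rewrite (sum_one (fun n => 3 * A * fpow Y n m)) ltnS m0 /= (_ : conv Y fone = Y) //.
      by rewrite convC conv1l.
    rewrite /comp big_distrr -big_split /=; apply: eq_bigr => n _.
    by case: eqP => _ /=; ring.
  rewrite E; apply: Rle_trans (sum_abs _ _ _) _; apply: sum_le => -[n nm] _ /=.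
  rewrite Rabs_mult (Rabs_pos_eq (fpow _ _ _)) //.
  case: n nm => [|[|n]] nm.
  - by rewrite /= /fone; case: m m0 {eE pw E nm} => // m _; rewrite /=; lra.
  - apply: Rmult_le_compat_r => //; apply: Rle_trans (eB 1%N isT) _.
    rewrite chiS bt1 /bt /=; lra.
  - apply: Rmult_le_compat_r => //; apply: Rle_trans (eB n.+2 isT) _.
    have := @chi_ge n.+2 isT; rewrite /=; nra.
rewrite (_ : _ - _ = comp e Y m - c * (comp sqc Y m - - Series k * bt m)); last by rewrite eE; ring.
apply: Rle_trans (Rabs_triang _ _) _; rewrite Rabs_Ropp Rabs_mult.
have := H1 m m0; have := H2 m m0; have := H3 m m0; rewrite !Rmult_0_l !Rminus_0_r.
have := Rle_abs (comp chi Y m); have := Rle_abs (Y m); have := Rabs_pos c.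
have := bt_div_gt0 m0; set X := bt m / INR m => X0 c0 h1 h2 h3 h4 h5.
have k1 : Rabs c * Rabs (comp sqc Y m - - Series k * bt m) <= Rabs c * (M3 * X) by apply: Rmult_le_compat_l.
have k2 : A * comp chi Y m <= A * (M1 * X) by apply: Rmult_le_compat_l; lra.
have k3 : 3 * A * Y m <= 3 * A * (M2 * X) by apply: Rmult_le_compat_l; lra.
lra.
Qed.

End Transfer.

(** * The tree function *)

(* The coefficients of exp (a C), where C = y exp C. *)
Definition cay (a : R) (n : nat) : R :=
  if n is n'.+1 then a * (INR n + a) ^ n' / INR (fact n) else 1.

(* e^-y (theta + a)^p e^y is a polynomial of degree p. *)
Lemma finite_diff a p N : (p < N)%N ->
  conv (fun n => (INR n + a) ^ p / INR (fact n)) (expc (-1)) N = 0.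
Proof.
pose F p : fps := fun n => (INR n + a) ^ p / INR (fact n).
have FS q : F q.+1 = fadd (theta (F q)) (fscal a (F q)).
  apply: fps_ext => n; rewrite /F /fadd /theta /fscal /=; field; exact: INR_fact_neq_0.
have thE : theta (expc (-1)) = fopp (conv fX (expc (-1))).
  rewrite -[expc (-1)]comp_id -Ex_scal theta_Ex; last by rewrite /fscal /fX /=; ring.
  rewrite (_ : theta (fscal (-1) fX) = fopp fX); first by ring.
  by apply: fps_ext => -[|[|n]]; rewrite /theta /fscal /fopp /fX /=; ring.
pose P q := conv (F q) (expc (-1)).
have PS q : P q.+1 = fadd (theta (P q)) (fadd (conv fX (P q)) (fscal a (P q))).
  rewrite /P FS convDl fscal_convl theta_conv thE.
  set Z := fscal a _; ring.
change ((p < N)%N -> P p N = 0).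
elim: p N => [|p IH] N pN.
  rewrite /P (_ : F 0%N = expc 1); last by apply: fps_ext => n; rewrite /F /expc pow1 /=.
  rewrite expc_conv (_ : 1 + -1 = 0); last ring.
  by rewrite expc0 /fone; case: N pN.
rewrite PS /fadd /theta /fscal conv_fX; case: N pN => // N; rewrite ltnS => pN.
by rewrite (IH N.+1) ?(IH N) ?ltnS //; [ring | exact: ltnW].
Qed.

Lemma fpow_comp f u n : u 0%N = 0 -> fpow (comp f u) n = comp (fpow f n) u.
Proof.
move=> u0; elim: n => [|n IH] /=; first by rewrite comp_fone.
by rewrite IH comp_conv.
Qed.

(** Lagrange inversion for T exp(-T). After multiplication by exp(-aT), the coefficient of T^k for k
    > 0 is, up to a constant factor, a k-th difference of a polynomial of degree k - 1. *)
Lemma comp_cay a (T : fps) : T 0%N = 0 ->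
  comp (cay a) (conv T (Ex (fscal (-1) T))) = Ex (fscal a T).
Proof.
move=> T0; set x := conv T _.
have x0 : x 0%N = 0 by rewrite /x conv0 T0; ring.
have sc0 c : fscal c T 0%N = 0 by rewrite /fscal T0; ring.
have key : conv (comp (cay a) x) (Ex (fscal (- a) T)) = fone.
  apply: fps_ext => m.
  transitivity (\sum_(n < m.+1) cay a n * conv (fpow x n) (Ex (fscal (- a) T)) m).
    rewrite -conv_sum; apply: conv_eq_le => // i im.
    by rewrite (comp_box _ x0 im).
  transitivity (\sum_(n < m.+1) \sum_(k < m.+1)
     cay a n * (conv (fpow fX n) (expc (- (INR n + a))) k * fpow T k m)).
    apply: eq_bigr => n _; rewrite -big_distrr /= -/(comp _ T m) comp_conv //.
    rewrite -Ex_scal -fpow_comp // comp_fX // /x fpow_conv -convA Ex_pow // -Ex_add; try by rewrite /fscal T0; ring.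
    by congr (_ * conv _ (Ex _) m); apply: fps_ext => i; rewrite /fadd /fscal; ring.
  rewrite exchange_big /=.
  rewrite (eq_bigr (fun k : 'I_m.+1 => if (k : nat) == 0%N then fpow T k m else 0)).
    by rewrite (sum_one (fun k => fpow T k m)).
  move=> k _; have km : (k < m.+1)%N by [].
  under eq_bigr => n _ do rewrite conv_fpowX -Rmult_assoc.
  rewrite -big_distrl /=.
  rewrite (@sum_wid k.+1 m.+1 (fun n => cay a n * (if (n <= k)%N then expc (- (INR n + a)) (k - n)%N else 0))) //; last first.
    by move=> i ki _; rewrite leqNgt ki /=; ring.
  case: eqP => [->|k0].
    by rewrite big_ord1 /= /expc /=; field.
  rewrite (_ : (\sum_(i < k.+1) _) = a * conv (fun n => (INR n + a) ^ k.-1 / INR (fact n)) (expc (-1)) k).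
    rewrite finite_diff; first by ring.
    by case: (nat_of_ord k) k0.
  rewrite /conv big_distrr /=; apply: eq_bigr => n _.
  have nk : (n <= k)%N by rewrite -ltnS.
  rewrite nk /expc (_ : - (INR n + a) = -1 * (INR n + a)); last by ring.
  rewrite Rpow_mult_distr; have f1 := INR_fact_neq_0 n; have f2 := INR_fact_neq_0 (k - n).
  case En : (nat_of_ord n) => [|n'].
    have [k' Ek] : exists k', nat_of_ord k = k'.+1 by case: (nat_of_ord k) k0 => // k'; exists k'.
    rewrite subn0 Ek.
    rewrite /cay [fact 0]/= [INR 1]/= [INR 0]/= [k'.+1.-1]/=.
    rewrite -[(0 + a) ^ k'.+1]/((0 + a) * (0 + a) ^ k'); field; exact: INR_fact_neq_0.
  rewrite -En /cay En -En; have -> : k.-1 = (n' + (k - n))%N by lia.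
  by rewrite pow_add En; field; rewrite -En.
rewrite -[LHS]conv1l -Ex_fzero (_ : fzero = fadd (fscal a T) (fscal (- a) T)); last first.
  by apply: fps_ext => i; rewrite /fzero /fadd /fscal; ring.
rewrite Ex_add // -convA [conv (Ex (fscal (- a) T)) _]convC key.
ring.
Qed.

Lemma cay_gt0 a n : 0 < a -> 0 < cay a n.
Proof.
move=> a0; case: n => [|n]; first by rewrite /=; lra.
apply: Rdiv_lt_0_compat; last exact: INR_fact_lt_0.
by apply: Rmult_lt_0_compat => //; apply: pow_lt; have := pos_INR n.+1; lra.
Qed.

(** * Logarithm bounds and the growth of the tree coefficients *)

Lemma nondecreasing_from0 (f g : R -> R) b : (forall x, 0 <= x <= b -> is_derive f x (g x)) ->
  (forall x, 0 <= x <= b -> 0 <= g x) -> forall x, 0 <= x <= b -> f 0 <= f x.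
Proof.
move=> fg g0 x [x0 xb]; case: (Req_dec x 0) => [->|xn0]; first exact: Rle_refl.
have mM : Rmin 0 x = 0 /\ Rmax 0 x = x by rewrite Rmin_left ?Rmax_right //; lra.
have [c [c1 c2]] : exists c, 0 <= c <= x /\ f x - f 0 = g c * (x - 0).
  have [||c] := MVT_gen f 0 x g; case: mM => -> ->.
  - by move=> y yx; apply: fg; lra.
  - move=> y yx; apply/continuity_pt_filterlim; apply: ex_derive_continuous.
    by exists (g y); apply: fg; lra.
  - by move=> H; exists c.
have gc : 0 <= g c by apply: g0; lra.
have : 0 <= g c * (x - 0) by apply: Rmult_le_pos; lra.
lra.
Qed.

Lemma ln1p_ge x : 0 <= x <= 1 -> x - x ^ 2 / 2 <= ln (1 + x).
Proof.
move=> x01; pose f x := ln (1 + x) - x + x ^ 2 / 2.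
have : f 0 <= f x.
  apply: (@nondecreasing_from0 f (fun x => x ^ 2 / (1 + x)) 1) => // y y01.
    by rewrite /f; auto_derive; [lra | field; lra].
  by apply: Rdiv_le_0_compat; [nra | lra].
by rewrite /f Rplus_0_r ln_1; lra.
Qed.

Lemma ln1p_le x : 0 <= x <= 1 -> ln (1 + x) <= x - x ^ 2 / 2 + x ^ 3 / 3.
Proof.
move=> x01; pose f x := x - x ^ 2 / 2 + x ^ 3 / 3 - ln (1 + x).
have : f 0 <= f x.
  apply: (@nondecreasing_from0 f (fun x => x ^ 3 / (1 + x)) 1) => // y y01.
    by rewrite /f; auto_derive; [lra | field; lra].
  by apply: Rdiv_le_0_compat; [apply: pow_le; lra | lra].
by rewrite /f Rplus_0_r ln_1; lra.
Qed.

Lemma ln1m_ge x : 0 <= x <= 1 / 2 -> - (x + x ^ 2) <= ln (1 - x).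
Proof.
move=> x01; pose f x := x + x ^ 2 + ln (1 - x).
have : f 0 <= f x.
  apply: (@nondecreasing_from0 f (fun x => x * (1 - 2 * x) / (1 - x)) (1 / 2)) => // y y01.
    by rewrite /f; auto_derive; [lra | field; lra].
  by apply: Rdiv_le_0_compat; [nra | lra].
by rewrite /f Rminus_0_r ln_1; lra.
Qed.

Lemma ln1m_le x : 0 <= x < 1 -> ln (1 - x) <= - x.
Proof.
move=> x01; rewrite -[X in _ <= X]ln_exp; apply: ln_le; first lra.
have := exp_ineq1_le (- x); lra.
Qed.

Lemma exp_mono x y : x <= y -> exp x <= exp y.
Proof. by case=> [/exp_increasing|->]; lra. Qed.

(* The ratio of consecutive quotients g(n)/bt(n) is exp(O(1/n^2)). *)
Lemma cay_ratio n : (1 < n)%N -> exists2 e, 0 <= e <= 2 / INR n - 2 / INR n.+1 &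
  cay (/ 2) n.+1 * exp (- INR n.+1) / bt n.+1 = cay (/ 2) n * exp (- INR n) / bt n * exp e.
Proof.
move=> n1; have n0 : (0 < n)%N by exact: ltnW.
have n2 : 2 <= INR n by apply: (le_INR 2); lia.
(* In terms of x the quotient of consecutive values g/bt is (1 + x)^n exp(-1) / (1 - x), whose
   logarithm is O(x^2). *)
pose x := / (INR n + / 2); have xN : x * (INR n + / 2) = 1 by rewrite /x; field; lra.
have x0 : 0 < x by apply: Rinv_0_lt_compat; lra.
have x12 : x <= 1 / 2 by nra.
exists (INR n * ln (1 + x) - 1 - ln (1 - x)).
  have h1 := ln1p_ge (conj (Rlt_le _ _ x0) (ltac:(lra) : x <= 1)).
  have h2 := ln1p_le (conj (Rlt_le _ _ x0) (ltac:(lra) : x <= 1)).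
  have h3 := ln1m_ge (conj (Rlt_le _ _ x0) x12).
  have h4 := ln1m_le (conj (Rlt_le _ _ x0) (ltac:(lra) : x < 1)).
  have nE : INR n = / x - / 2 by rewrite /x Rinv_inv; ring.
  have nx : INR n * x = 1 - x / 2 by lra.
  split.
    have : INR n * (x - x ^ 2 / 2) <= INR n * ln (1 + x) by apply: Rmult_le_compat_l; lra.
    rewrite (_ : INR n * _ = INR n * x - INR n * x * x / 2); last by field.
    rewrite nx; nra.
  have H : INR n * ln (1 + x) <= INR n * (x - x ^ 2 / 2 + x ^ 3 / 3) by apply: Rmult_le_compat_l; lra.
  move: H; rewrite (_ : INR n * (_ + _) = INR n * x - INR n * x * x / 2 + INR n * x * (x * x) / 3); last by field.
  rewrite nx => H.
  (* Since x^2 = 1/(n + 1/2)^2 is below 1/(n (n + 1)), this bound telescopes. *)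
  have up : INR n * ln (1 + x) - 1 - ln (1 - x) <= 2 * (x * x) by nra.
  apply: Rle_trans up _; rewrite S_INR.
  rewrite (_ : 2 / INR n - 2 / (INR n + 1) = 2 * / (INR n * (INR n + 1))); last by field; lra.
  apply: Rmult_le_compat_l; first lra.
  rewrite /x -Rinv_mult; apply: Rinv_le_contravar; nra.
have bn := bt_gt0 n0; have n1R : INR n + 1 <> 0 by lra.
have e1 : exp (- INR n.+1) = exp (- INR n) * exp (Ropp 1) by rewrite -exp_plus S_INR; congr exp; ring.
have e2 : exp (INR n * ln (1 + x) - 1 - ln (1 - x)) = (1 + x) ^ n * exp (Ropp 1) / (1 - x).
  rewrite /Rminus !exp_plus (exp_Ropp (ln _)) exp_ln; last lra.
  by rewrite -/(Rpower (1 + x) (INR n)) Rpower_pow //; lra.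
rewrite e1 e2 btS; case: n n0 n1 n2 x xN x0 x12 bn n1R e1 e2 => // n _ _ n2 x xN x0 x12 bn n1R _ _.
rewrite /cay; have f0 := INR_fact_neq_0 n.+1.
have -> : INR (fact n.+2) = INR n.+2 * INR (fact n.+1) by rewrite -mult_INR.
rewrite (S_INR n.+1); set N := INR n.+1 in n2 x xN x0 x12 n1R *.
have -> : N + 1 + / 2 = (N + / 2) * (1 + x) by rewrite Rmult_plus_distr_l (Rmult_comm _ x) xN; ring.
have -> : 1 - x = (N - / 2) / (N + / 2).
  apply: (Rmult_eq_reg_r (N + / 2)); last lra.
  by rewrite /Rdiv Rmult_assoc Rinv_l; lra.
rewrite Rpow_mult_distr [(N + / 2) ^ n.+1]/=.
have p0 : (N + / 2) ^ n <> 0 by apply: pow_nonzero; lra.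
field; repeat split => //; lra.
Qed.

(** From n = 2 on, q n increases while q n exp(2/n) decreases; they enclose the limit K with a gap
    of order 1/n. *)
Lemma cay_asym : exists2 K, K <> 0 &
  asym (fun n => cay (/ 2) n * exp (- INR n)) K.
Proof.
pose g n := cay (/ 2) n * exp (- INR n); pose q n := g n / bt n.
have g0 n : 0 < g n by apply: Rmult_lt_0_compat; [apply: cay_gt0; lra | exact: exp_pos].
have q0 n : (0 < n)%N -> 0 < q n by move=> n0; apply: Rdiv_lt_0_compat => //; exact: bt_gt0.
have qS n : q n.+2 <= q n.+3 /\ q n.+3 * exp (2 / INR n.+3) <= q n.+2 * exp (2 / INR n.+2).
  have [e e01 E] := @cay_ratio n.+2 isT; rewrite -/(g n.+3) -/(g n.+2) -/(q n.+3) -/(q n.+2) in E.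
  have p := q0 n.+2 isT; rewrite E; split.
    have : 1 <= exp e by have := exp_ineq1_le e; lra.
    by nra.
  rewrite Rmult_assoc -exp_plus; apply: Rmult_le_compat_l; first lra.
  by apply: exp_mono; lra.
have mon n j : q n.+2 <= q (n + j).+2.
  by elim: j => [|j IH]; [rewrite addn0; lra | rewrite addnS; have [] := qS (n + j)%N; lra].
have mon2 n j : q (n + j).+2 * exp (2 / INR (n + j).+2) <= q n.+2 * exp (2 / INR n.+2).
  by elim: j => [|j IH]; [rewrite addn0; lra | rewrite addnS; have [] := qS (n + j)%N; lra].
have ex1 n : 1 <= exp (2 / INR n.+2).
  have : 0 < 2 / INR n.+2 by apply: Rdiv_lt_0_compat; [lra | exact: lt_0_INR (Nat.lt_0_succ _)].
  by have := exp_ineq1_le (2 / INR n.+2); lra.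
have up n j : q (n + j).+2 <= q n.+2 * exp (2 / INR n.+2).
  apply: Rle_trans (mon2 n j); have := ex1 (n + j)%N; have := q0 (n + j).+2 isT; nra.
have [K KE] : ex_finite_lim_seq (fun n => q n.+2).
  apply: (ex_finite_lim_seq_incr _ (q 2%N * exp (2 / INR 2%N))) => n; last exact: (up 0%N n).
  by case: (qS n).
have lo n : q n.+2 <= K.
  have KE' : is_lim_seq (fun j => q (n + j).+2) K.
    by apply: is_lim_seq_ext ((is_lim_seq_incr_n (fun n => q n.+2) n K).1 KE) => j; rewrite -plusE Nat.add_comm.
  exact: (is_lim_seq_le _ _ (q n.+2) K (mon n) (is_lim_seq_const _) KE').
have hi n : K <= q n.+2 * exp (2 / INR n.+2).
  have KE' : is_lim_seq (fun j => q (n + j).+2) K.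
    by apply: is_lim_seq_ext ((is_lim_seq_incr_n (fun n => q n.+2) n K).1 KE) => j; rewrite -plusE Nat.add_comm.
  exact: (is_lim_seq_le _ _ K (q n.+2 * exp (2 / INR n.+2)) (up n) KE' (is_lim_seq_const _)).
have K0 : 0 < K by have := lo 0%N; have := q0 2%N isT; lra.
exists K; first lra.
(* The first summand is for m = 1, outside the range of [cay_ratio]; its factor 2 is 1 / bt 1. *)
exists (Rabs (g 1%N - K * bt 1) * 2 + 6 * K) => -[|[|n]] // _; rewrite -/(g _).
  rewrite bt1 /=; have := Rabs_pos (g 1%N - K * / 2); lra.
have b0 := @bt_gt0 n.+2 isT; have b1 := @bt_div_gt0 n.+2 isT.
have gq : g n.+2 = q n.+2 * bt n.+2 by rewrite /q; field; lra.
have y0 : 0 < 2 / INR n.+2 by apply: Rdiv_lt_0_compat; [lra | exact: lt_0_INR (Nat.lt_0_succ _)].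
have y1 : 2 / INR n.+2 <= 1.
  have h : 2 <= INR n.+2 by apply: (le_INR 2); lia.
  by apply: (Rmult_le_reg_r (INR n.+2)); [lra | rewrite /Rdiv Rmult_assoc Rinv_l; lra].
have ey : exp (2 / INR n.+2) - 1 <= 3 * (2 / INR n.+2).
  set y := 2 / INR n.+2 in y0 y1 *.
  have h := exp_ineq1_le (- y); have e := exp_pos y; have e1 : exp y <= 3.
    by apply: Rle_trans exp_le_3; apply: exp_mono.
  have : exp y * exp (- y) = 1 by rewrite -exp_plus Rplus_opp_r exp_0.
  nra.
have h1 := lo n; have h2 := hi n; have p := q0 n.+2 isT.
rewrite Rabs_left1; last by rewrite gq; nra.
have d : K - q n.+2 <= K * (6 / INR n.+2).
  have : K - q n.+2 <= q n.+2 * (3 * (2 / INR n.+2)) by nra.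
  by rewrite (_ : 6 / INR n.+2 = 3 * (2 / INR n.+2)); [nra | field; apply: not_0_INR].
have E : - (g n.+2 - K * bt n.+2) <= 6 * K * (bt n.+2 / INR n.+2).
  rewrite gq (_ : 6 * K * _ = K * (6 / INR n.+2) * bt n.+2); last by field; apply: not_0_INR.
  nra.
by apply: Rle_trans E _; have := Rabs_pos (g 1%N - K * bt 1); nra.
Qed.

(** The series y exp(3C/2) is C exp(C/2). Its coefficients differ from 3 times those of exp(C/2) by
    the factor n/(n + 1/2), that is, by a relative O(1/n). *)
Lemma cay_asym_shift K : asym (fun n => cay (/ 2) n * exp (- INR n)) K ->
  asym (fun n => conv fX (cay (3 / 2)) n * exp (- INR n)) (3 * K).
Proof.
move=> /[dup] aK [A aA].
pose g n := cay (/ 2) n * exp (- INR n).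
have -> : (fun n => conv fX (cay (3 / 2)) n * exp (- INR n)) =
    (fun n => 3 * g n + (conv fX (cay (3 / 2)) n * exp (- INR n) - 3 * g n)).
  by apply: fps_ext => n; ring.
rewrite -[3 * K]Rplus_0_r; apply: asym_add; first exact: asym_scal.
exists (3 / 2 * (Rabs A + Rabs K)) => m m0; rewrite Rmult_0_l Rminus_0_r.
have m1 := INR_ge1 m0.
have E : conv fX (cay (3 / 2)) m = 3 * cay (/ 2) m - 3 / 2 * cay (/ 2) m / (INR m + / 2).
  case: m m0 m1 => // m _ m1; rewrite conv_fX; case: m m1 => [|m] m1.
    by rewrite /cay /=; field.
  rewrite /cay; have -> : INR (fact m.+2) = INR m.+2 * INR (fact m.+1) by rewrite -mult_INR.
  have f0 := INR_fact_neq_0 m.+1; have -> : INR m.+1 + 3 / 2 = INR m.+2 + / 2 by rewrite (S_INR m.+1); field.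
  rewrite (_ : (INR m.+2 + / 2) ^ m.+1 = (INR m.+2 + / 2) * (INR m.+2 + / 2) ^ m) //.
  field; repeat split => //; lra.
rewrite E (_ : _ - _ = - (3 / 2 * (g m / (INR m + / 2)))); last by rewrite /g; field; lra.
rewrite Rabs_Ropp Rabs_mult (Rabs_pos_eq (3 / 2)); last lra.
rewrite Rmult_assoc; apply: Rmult_le_compat_l; first lra.
have gp : 0 < g m by apply: Rmult_lt_0_compat; [apply: cay_gt0; lra | exact: exp_pos].
have b0 := bt_gt0 m0.
have bA : g m <= (Rabs A + Rabs K) * bt m.
  have H1 := aA m m0; have H2 := Rle_abs (g m - K * bt m); have H3 := Rle_abs K; have H4 := Rle_abs A.
  rewrite -/(g m) in H1.
  have H5 : bt m / INR m <= bt m.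
    apply: (Rmult_le_reg_r (INR m)); first lra.
    by rewrite /Rdiv Rmult_assoc Rinv_l; nra.
  have H6 : A * (bt m / INR m) <= Rabs A * bt m.
    have := bt_div_gt0 m0; have := Rabs_pos A; nra.
  nra.
rewrite Rabs_pos_eq; last by left; apply: Rdiv_lt_0_compat; lra.
rewrite /Rdiv -Rmult_assoc; apply: Rmult_le_compat => //; first lra.
  by left; apply: Rinv_0_lt_compat; lra.
by apply: Rinv_le_contravar; lra.
Qed.

(** * Power series with nonnegative coefficients *)

Definition psum (a : fps) (y : R) (N : nat) : R := \sum_(n < N.+1) sc y a n.

Lemma PSeriesE a x : PSeries a x = Series (sc x a).
Proof. by []. Qed.

Lemma psum_bounded a y B : 0 <= y -> (forall n, 0 <= a n) ->
  (forall N, psum a y N <= B) -> ex_series (sc y a) /\ PSeries a y <= B.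
Proof.
move=> y0 a0 aB; apply: ex_series_bounded => [n|[|n]]; first exact: sc_ge0.
  have := aB 0%N; rewrite big_ord0 /psum sum_recr big_ord0.
  by have := sc_ge0 y0 (a0 0%N); lra.
exact: aB.
Qed.

Lemma psum_le_PSeries a y N : 0 <= y -> (forall n, 0 <= a n) -> ex_series (sc y a) ->
  psum a y N <= PSeries a y.
Proof. by move=> y0 a0; apply: partial_le_Series => n; exact: sc_ge0. Qed.

Lemma psum_mono a x y N : 0 <= x <= y -> (forall n, 0 <= a n) -> psum a x N <= psum a y N.
Proof.
move=> xy a0; apply: sum_le => n _; apply: Rmult_le_compat_l => //.
exact: pow_incr.
Qed.

Lemma ex_series_sc_le a x y : (forall n, 0 <= a n) -> Rabs x <= y -> ex_series (sc y a) ->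
  ex_series (fun n => Rabs (sc x a n)).
Proof.
move=> a0 xy; apply: ex_series_leR => n; rewrite Rabs_Rabsolu /sc Rabs_mult -RPow_abs.
rewrite Rabs_pos_eq //; apply: Rmult_le_compat_l => //.
by apply: pow_incr; split => //; exact: Rabs_pos.
Qed.

Lemma CV_radius_ge a y : 0 <= y -> ex_series (fun n => Rabs (sc y a n)) -> Rbar_le y (CV_radius a).
Proof.
move=> y0 exa; apply: (CV_radius_bounded a).1.
exists (Series (fun n => Rabs (sc y a n))) => n.
by apply: (Series_term_le n (a := fun n => Rabs (sc y a n))) => // m; exact: Rabs_pos.
Qed.

Lemma PSeries_mono a x y : (forall n, 0 <= a n) -> 0 <= x <= y -> ex_series (sc y a) ->
  PSeries a x <= PSeries a y.
Proof.
move=> a0 xy exa; apply: Series_le => // n; split; first by apply: sc_ge0 => //; lra.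
by apply: Rmult_le_compat_l => //; exact: pow_incr.
Qed.

Lemma PSeries_conv a b x : ex_series (fun n => Rabs (sc x a n)) ->
  ex_series (fun n => Rabs (sc x b n)) ->
  PSeries (conv a b) x = PSeries a x * PSeries b x.
Proof.
move=> exa exb; rewrite PSeriesE sc_conv.
exact: is_series_unique (Series_mult exa exb).
Qed.

Lemma ex_series_conv a b y : 0 <= y -> (forall n, 0 <= a n) -> (forall n, 0 <= b n) ->
  ex_series (sc y a) -> ex_series (sc y b) -> ex_series (sc y (conv a b)).
Proof.
move=> y0 a0 b0 exa exb; rewrite sc_conv; eexists.
have H c : (forall n, 0 <= c n) -> ex_series (sc y c) -> ex_series (fun n => Rabs (sc y c n)).
  move=> c0; apply: ex_series_leR => n; rewrite Rabs_Rabsolu Rabs_pos_eq; first lra.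
  exact: sc_ge0.
exact: (Series_mult (H a a0 exa) (H b b0 exb)).
Qed.

Lemma exp_partial U n : 0 <= U -> \sum_(i < n) expc 1 i * U ^ i <= exp U.
Proof.
move=> U0; have /is_pseries_R H := is_exp_Reals U.
rewrite -(is_series_unique _ _ H).
rewrite (eq_bigr (fun i : 'I_n => / INR (fact i) * U ^ i)); last first.
  by move=> i _; rewrite /expc pow1 /Rdiv Rmult_1_l.
apply: (@partial_le_Series (fun i => / INR (fact i) * U ^ i)); last by exists (exp U).
move=> i; apply: Rmult_le_pos; last exact: pow_le.
by left; apply: Rinv_0_lt_compat; exact: INR_fact_lt_0.
Qed.

Lemma expc1_ge0 n : 0 <= expc 1 n.
Proof.
rewrite /expc pow1 /Rdiv Rmult_1_l; left; apply: Rinv_0_lt_compat; exact: INR_fact_lt_0.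
Qed.

Lemma comp_ge0 f u n : (forall i, 0 <= f i) -> (forall i, 0 <= u i) -> 0 <= comp f u n.
Proof.
by move=> f0 u0; apply: sum_ge0 => i _; apply: Rmult_le_pos => //; exact: fpow_ge0.
Qed.

Lemma Ex_ge0 u n : (forall i, 0 <= u i) -> 0 <= Ex u n.
Proof. by move=> u0; apply: comp_ge0 => // i; exact: expc1_ge0. Qed.

Lemma psum_Ex u y N U : u 0%N = 0 -> (forall i, 0 <= u i) -> 0 <= y ->
  psum u y N <= U -> psum (Ex u) y N <= exp U.
Proof.
move=> u0 up y0 uU; have scu n : 0 <= sc y u n by exact: sc_ge0.
have U0 : 0 <= U by apply: Rle_trans uU; exact: sum_ord_ge0.
apply: Rle_trans (exp_partial N.+1 U0); rewrite /psum /Ex sc_comp.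
by apply: partial_comp => //; [rewrite /sc u0; ring | exact: expc1_ge0].
Qed.

Lemma ex_series_Ex u y : u 0%N = 0 -> (forall i, 0 <= u i) -> 0 <= y ->
  ex_series (sc y u) -> ex_series (sc y (Ex u)).
Proof.
move=> u0 up y0 exu.
have [] := @psum_bounded (Ex u) y (exp (PSeries u y)) y0 => //.
  by move=> n; exact: Ex_ge0.
by move=> N; apply: psum_Ex => //; exact: psum_le_PSeries.
Qed.

Lemma PS_derive_Ex u : u 0%N = 0 -> PS_derive (Ex u) = conv (PS_derive u) (Ex u).
Proof.
move=> u0; have shift a : theta a = conv fX (PS_derive a).
  by apply: fps_ext => -[|n]; rewrite conv_fX /theta /PS_derive //=; ring.
have := theta_Ex u0; rewrite !shift -convA => E; apply: fps_ext => n.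
by have := congr1 (fun a : fps => a n.+1) E; rewrite !conv_fX.
Qed.

(* Both sides solve F' = u' F on (-y, y). *)
Lemma PSeries_Ex u y x : u 0%N = 0 -> (forall i, 0 <= u i) -> ex_series (sc y u) ->
  Rabs x < y -> PSeries (Ex u) x = exp (PSeries u x).
Proof.
move=> u0 up exu xy.
have y0 : 0 <= y by have := Rabs_pos x; lra.
have yy : Rabs y <= y by rewrite Rabs_pos_eq; lra.
have cvu : Rbar_le y (CV_radius u) by apply: CV_radius_ge => //; exact: ex_series_sc_le yy exu.
have exE := ex_series_Ex u0 up y0 exu.
have cvE : Rbar_le y (CV_radius (Ex u)).
  by apply: CV_radius_ge => //; apply: ex_series_sc_le yy exE => n; exact: Ex_ge0.
pose f z := PSeries (Ex u) z * exp (- PSeries u z).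
have df z : Rabs z < y -> is_derive f z 0.
  move=> zy.
  have ltu : Rbar_lt (Rabs z) (CV_radius u) by apply: Rbar_lt_le_trans cvu.
  have ltE : Rbar_lt (Rabs z) (CV_radius (Ex u)) by apply: Rbar_lt_le_trans cvE.
  have d1 := is_derive_PSeries _ _ ltu; have d2 := is_derive_PSeries _ _ ltE.
  have E : PSeries (PS_derive (Ex u)) z = PSeries (PS_derive u) z * PSeries (Ex u) z.
    rewrite PS_derive_Ex // -PSeries_mult ?CV_radius_derive //.
    by apply: Series_ext => n; rewrite /PS_mult sum_f_R0E.
  rewrite /f; evar_last.
    apply: (is_derive_mult (PSeries (Ex u)) (fun z => exp (- PSeries u z))); first exact: d2.
      apply: (is_derive_comp exp (fun z => - PSeries u z)); first exact: is_derive_exp.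
      exact: (is_derive_opp (PSeries u) _ _ d1).
    by move=> n m; exact: Rmult_comm.
  rewrite E /plus /mult /scal /opp /= /mult /=; ring.
have fx : f x = f 0.
  have [||c [_ H]] := MVT_gen f 0 x (fun=> 0).
  - move=> z [z1 z2]; apply: df; apply: Rle_lt_trans xy.
    by move: z1 z2; rewrite /Rmin /Rmax; case: Rle_dec => ? ? ?; split_Rabs; lra.
  - move=> z [z1 z2]; apply/continuity_pt_filterlim; apply: ex_derive_continuous.
    exists 0; apply: df; apply: Rle_lt_trans xy.
    by move: z1 z2; rewrite /Rmin /Rmax; case: Rle_dec => ? ? ?; split_Rabs; lra.
  - by lra.
have f0 : f 0 = 1 by rewrite /f !PSeries_0 Ex0 u0 Ropp_0 exp_0; ring.
have : f x * exp (PSeries u x) = exp (PSeries u x) by rewrite fx f0; ring.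
by rewrite /f Rmult_assoc -exp_plus Rplus_opp_l exp_0 Rmult_1_r.
Qed.

(** * The series of T(z^i) *)

Lemma t_ge0 n : 0 <= t n.
Proof. exact: pos_INR. Qed.

Lemma dil_ge0 i a n : (forall k, 0 <= a k) -> 0 <= dil i a n.
Proof. by move=> a0; rewrite /dil; case: ifP => _ //; lra. Qed.

Lemma dil_sum_div i a N (b : nat -> R) : (0 < i)%N ->
  \sum_(j < N.+1) dil i a j * b j = \sum_(j < (N %/ i).+1) a j * b (i * j)%N.
Proof.
move=> i0; rewrite -(dil_sum a (N %/ i) b i0).
have le : ((i * (N %/ i)).+1 <= N.+1)%N by rewrite ltnS mulnC leq_trunc_div.
apply: (sum_wid (F := fun j => dil i a j * b j) le) => j j1 j2.
rewrite /dil; case: ifP => [/dvdnP[k jE]|_]; last by ring.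
exfalso; have h1 : (N %/ i < k)%N by move: j1; rewrite jE; nia.
have : (k <= N %/ i)%N by rewrite leq_divRL // -jE.
by rewrite leqNgt h1.
Qed.

Lemma pow_anti x m n : 0 <= x <= 1 -> (m <= n)%N -> x ^ n <= x ^ m.
Proof.
move=> x01 /subnK <-; elim: (n - m)%N => [|k IH]; first by rewrite add0n; lra.
have p : 0 <= x ^ (k + m) by apply: pow_le; lra.
by rewrite addSn /=; nra.
Qed.

(** Since [t 0 = 0], T(y^i) is at most y^(i-s) T(y^s) for i >= s, and the sum over i becomes
    geometric. *)
Lemma psum_Lam (omega : nat -> R) c s y B N : 0 <= y < 1 ->
  (forall i, 0 <= omega i <= c) -> (forall i, (i < s)%N -> omega i = 0) -> (0 < s)%N ->
  psum t (y ^ s) N <= B -> psum (Lam omega) y N <= c * B / (1 - y).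
Proof.
move=> y01 om0 oms s0 tB.
have c0 : 0 <= c by have := om0 0%N; lra.
have B0 : 0 <= B.
  apply: Rle_trans tB; apply: sum_ord_ge0 => n; apply: sc_ge0; first by apply: pow_le; lra.
  exact: t_ge0.
have tsum i : (s <= i)%N -> \sum_(n < N.+1) dil i t n * y ^ n <= B * y ^ (i - s).
  move=> si; have i0 : (0 < i)%N by apply: leq_trans si.
  rewrite (dil_sum_div t N (fun n => y ^ n) i0).
  have yis : 0 <= y ^ (i - s) by apply: pow_le; lra.
  apply: Rle_trans (_ : (\sum_(j < (N %/ i).+1) sc (y ^ s) t j) * y ^ (i - s) <= _).
    rewrite big_distrl /=; apply: sum_le => -[j jN] _ /=; rewrite /sc.
    case: j jN => [|j] jN; first by rewrite t0; lra.
    rewrite Rmult_assoc; apply: Rmult_le_compat_l; first exact: t_ge0.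
    rewrite -pow_mult -pow_add; apply: pow_anti; first lra.
    by rewrite plusE multE; nia.
  apply: Rmult_le_compat_r => //; apply: Rle_trans tB.
  apply: partial_incr; last by rewrite ltnS leq_div.
  by move=> j; apply: sc_ge0; [apply: pow_le; lra | exact: t_ge0].
rewrite /psum.
have -> : \sum_(n < N.+1) sc y (Lam omega) n =
    \sum_(i < N.+1) omega i * \sum_(n < N.+1) dil i t n * y ^ n.
  rewrite (eq_bigr (fun n : 'I_N.+1 => \sum_(i < N.+1) omega i * (dil i t n * y ^ n))).
    by rewrite exchange_big /=; apply: eq_bigr => i _; rewrite big_distrr.
  move=> n _; rewrite /sc /Lam big_distrl /=.
  rewrite -(@sum_wid n.+1 N.+1 (fun i => omega i * dil i t n * y ^ n)) //.
    by apply: eq_bigr => i _; ring.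
  move=> i ni _; rewrite /dil; case: ifP => [/dvdnP[[|k] E]|_]; try by ring.
    by rewrite E mul0n div0n t0; ring.
  by exfalso; nia.
apply: Rle_trans (_ : \sum_(i < N.+1) c * B * (if (s <= i)%N then y ^ (i - s) else 0) <= _).
  apply: sum_le => i _; case: ifP => si; last by rewrite oms ?ltnNge ?si //; lra.
  rewrite Rmult_assoc; apply: Rmult_le_compat; try exact: (om0 i).1.
  - by apply: sum_ge0 => n _; apply: Rmult_le_pos; [apply: dil_ge0; exact: t_ge0 | apply: pow_le; lra].
  - exact: (om0 i).2.
  - exact: tsum.
rewrite -big_distrr /=; apply: Rmult_le_compat_l; first exact: Rmult_le_pos.
apply: Rle_trans (sum_geom_le N.+1 y01).
case: (leqP s N.+1) => sN.
  rewrite -(big_mkord xpredT (fun i => if (s <= i)%N then y ^ (i - s) else 0)).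
  rewrite (@big_cat_nat _ _ _ s) //= [X in X + _]big1_seq ?Rplus_0_l; last first.
    by move=> i /andP[_]; rewrite mem_index_iota => /andP[_ ilt]; rewrite leqNgt ilt.
  rewrite -{1}[s]add0n big_addn (eq_bigr (fun i => y ^ i)); last first.
    by move=> i _; rewrite leq_addl addnK.
  rewrite big_mkord; apply: (partial_incr (a := fun i => y ^ i)); last by rewrite leq_subr.
  by move=> i; apply: pow_le; lra.
rewrite big1 => [|i _]; last by case: ifP => // si; have := ltn_ord i; lia.
by apply: sum_ord_ge0 => i; apply: pow_le; lra.
Qed.

Lemma Lam_ge0 omega n : (forall i, 0 <= omega i) -> 0 <= Lam omega n.
Proof.
by move=> om0; apply: sum_ge0 => i _; apply: Rmult_le_pos => //; apply: dil_ge0; exact: t_ge0.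
Qed.

Lemma ex_series_Lam (omega : nat -> R) c s y : 0 <= y < 1 ->
  (forall i, 0 <= omega i <= c) -> (forall i, (i < s)%N -> omega i = 0) -> (0 < s)%N ->
  ex_series (sc (y ^ s) t) -> ex_series (sc y (Lam omega)).
Proof.
move=> y01 om0 oms s0 ext.
have [] // := @psum_bounded (Lam omega) y (c * PSeries t (y ^ s) / (1 - y)); first lra.
  by move=> n; apply: Lam_ge0 => i; exact: (om0 i).1.
move=> N; apply: psum_Lam om0 oms s0 _ => //.
by apply: psum_le_PSeries ext; [apply: pow_le; lra | exact: t_ge0].
Qed.

Lemma is_series_dil i a x : (0 < i)%N -> ex_series (sc (x ^ i) a) ->
  is_series (sc x (dil i a)) (PSeries a (x ^ i)).
Proof.
move=> i0 exa; have lim := Series_correct _ exa.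
have div_inf : filterlim (fun N => (N %/ i)%N) eventually eventually.
  move=> P [M PM]; exists (M * i)%N => N MN; apply: PM.
  by apply/leP; rewrite leq_divRL //; apply/leP.
have := filterlim_comp _ _ _ _ _ _ _ _ div_inf lim.
apply: filterlim_ext => N; rewrite !sum_nE.
rewrite (eq_bigr (fun j : 'I_N.+1 => dil i a j * x ^ j)) // (dil_sum_div a N (fun n => x ^ n) i0).
by apply: eq_bigr => j _; rewrite /sc -pow_mult multE.
Qed.

Lemma is_series_zero : is_series (fun _ : nat => 0) 0.
Proof. by apply: filterlim_ext (filterlim_const 0) => n; rewrite sum_nE big1. Qed.

(** Interchange of summations. Coefficientwise, the sum over i < I agrees with Lam below degree I
    and lies between 0 and Lam above, so the error at x is at most a tail of Lam at y. *)
Lemma PSeries_Lam (omega : nat -> R) c s y x : 0 <= y < 1 ->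
  (forall i, 0 <= omega i <= c) -> (forall i, (i < s)%N -> omega i = 0) -> (0 < s)%N ->
  ex_series (sc (y ^ s) t) -> Rabs x <= y ->
  PSeries (Lam omega) x = Series (fun i => omega i * T (x ^ i)).
Proof.
move=> y01 om0 oms s0 ext xy.
have exL := ex_series_Lam y01 om0 oms s0 ext.
have Lp n : 0 <= Lam omega n by apply: Lam_ge0 => i; exact: (om0 i).1.
have term0 i n : (n < i)%N -> dil i t n = 0.
  move=> ni; rewrite /dil; case: ifP => // /dvdnP[[|k] E]; last by exfalso; nia.
  by rewrite E mul0n div0n t0.
pose P I : fps := fun n => \sum_(i < I) omega i * dil i t n.
have PE I : is_series (sc x (P I)) (\sum_(i < I) omega i * T (x ^ i)).
  elim: I => [|I IH].
    rewrite big_ord0 (_ : sc x (P 0%N) = fun=> 0); first exact: is_series_zero.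
    by apply: fps_ext => n; rewrite /sc /P big_ord0; ring.
  have last : is_series (fun n => omega I * sc x (dil I t) n) (omega I * T (x ^ I)).
    case: (ltnP I s) => Is.
      rewrite oms // Rmult_0_l (_ : (fun n => _) = fun=> 0); first exact: is_series_zero.
      by apply: fps_ext => n; ring.
    apply: (@is_series_scal_l R_AbsRing R_NormedModule).
    apply: is_series_dil; first exact: leq_trans Is.
    apply: ex_series_Rabs; apply: ex_series_sc_le t_ge0 _ ext.
    rewrite -RPow_abs; apply: Rle_trans (pow_incr _ y _ _) _; first by split => //; exact: Rabs_pos.
    by apply: pow_anti => //; lra.
  rewrite (sum_recr (fun i => omega i * T (x ^ i))).
  rewrite (_ : sc x (P I.+1) = fun n => sc x (P I) n + omega I * sc x (dil I t) n).
    exact: is_series_plus IH last.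
  apply: fps_ext => n; rewrite /P /sc (sum_recr (fun i => omega i * dil i t n)); ring.
symmetry; apply: is_series_unique.
pose tail I := PSeries (Lam omega) y - \sum_(n < I) sc y (Lam omega) n.
have close I : Rabs (PSeries (Lam omega) x - \sum_(i < I.+1) omega i * T (x ^ i)) <= tail I.+1.
  have exx := ex_series_sc_le Lp xy exL.
  have exP : ex_series (sc x (P I.+1)) by eexists; exact: PE.
  rewrite -(is_series_unique _ _ (PE I.+1)) PSeriesE -Series_minus //; last exact: ex_series_Rabs.
  have low n : (n < I.+1)%N -> sc x (Lam omega) n - sc x (P I.+1) n = 0.
    move=> nI; rewrite /sc /P /Lam (@sum_wid n.+1 I.+1 (fun i => omega i * dil i t n)) //; first by ring.
    by move=> i ni _; rewrite term0 //; ring.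
  have exd : ex_series (fun n => sc x (Lam omega) n - sc x (P I.+1) n).
    by apply: ex_series_minus => //; exact: ex_series_Rabs.
  rewrite (Series_split I.+1 exd) big1 ?Rplus_0_l => [|n _]; last exact: low.
  rewrite /tail PSeriesE (Series_split I.+1 exL) (_ : forall a b, a + b - a = b); last by move=> a b; ring.
  have bound k : Rabs (sc x (Lam omega) (I.+1 + k)%N - sc x (P I.+1) (I.+1 + k)%N)
      <= sc y (Lam omega) (I.+1 + k)%N.
    rewrite /sc -Rmult_minus_distr_r Rabs_mult -RPow_abs.
    have PL : 0 <= P I.+1 (I.+1 + k)%N <= Lam omega (I.+1 + k)%N.
      have h i : 0 <= omega i * dil i t (I.+1 + k)%N.
        by apply: Rmult_le_pos; [exact: (om0 i).1 | apply: dil_ge0; exact: t_ge0].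
      split; first exact: (sum_ord_ge0 I.+1 h).
      by apply: (partial_incr (a := fun i => omega i * dil i t (I.+1 + k)%N)) => //; lia.
    rewrite Rabs_pos_eq; last lra.
    apply: Rmult_le_compat; [lra | exact: pow_le (Rabs_pos _) | lra |].
    by apply: pow_incr; split => //; exact: Rabs_pos.
  have exs := ex_series_shift I.+1 exL.
  apply: Rle_trans (Series_Rabs _ _) _.
    by apply: ex_series_leR exs => k; rewrite Rabs_Rabsolu.
  by apply: Series_le => // k; split; [exact: Rabs_pos | exact: bound].
have tail0 : is_lim_seq (fun I => tail I.+1) 0.
  have -> : Rbar.Finite 0 = Rbar.Finite (PSeries (Lam omega) y - PSeries (Lam omega) y) by congr Rbar.Finite; ring.
  apply: is_lim_seq_minus'; first exact: is_lim_seq_const.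
  have H : is_lim_seq (sum_n (sc y (Lam omega))) (PSeries (Lam omega) y) := Series_correct _ exL.
  by apply: is_lim_seq_ext H => I; rewrite sum_nE.
change (is_lim_seq (sum_n (fun i => omega i * T (x ^ i))) (PSeries (Lam omega) x)).
apply: (is_lim_seq_le_le (fun I => PSeries (Lam omega) x - tail I.+1) _
  (fun I => PSeries (Lam omega) x + tail I.+1)).
- by move=> I; rewrite sum_nE; have := close I; split_Rabs; lra.
- have -> : Rbar.Finite (PSeries (Lam omega) x) = Rbar.Finite (PSeries (Lam omega) x - 0) by congr Rbar.Finite; ring.
  by apply: is_lim_seq_minus' tail0; exact: is_lim_seq_const.
- have -> : Rbar.Finite (PSeries (Lam omega) x) = Rbar.Finite (PSeries (Lam omega) x + 0) by congr Rbar.Finite; ring.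
  by apply: is_lim_seq_plus' tail0; exact: is_lim_seq_const.
Qed.

Lemma Lam_from s (g : nat -> R) : (0 < s)%N ->
  Lam (fun i => from s i * g i) =
  fadd (fscal (g s) (dil s t)) (Lam (fun i => from s.+1 i * g i)).
Proof.
move=> s0; apply: fps_ext => n; rewrite /fadd /fscal /Lam.
have -> : g s * dil s t n =
    \sum_(i < n.+1) (if (i : nat) == s then (fun i => g i * dil i t n) (i : nat) else 0).
  rewrite (sum_one (fun i => g i * dil i t n)); case: ifP => // /negbT; rewrite -leqNgt => ns.
  rewrite /dil; case: ifP => [/dvdnP[[|k] E]|_]; try by ring.
    by rewrite E mul0n div0n t0; ring.
  by exfalso; nia.
rewrite -big_split /=; apply: eq_bigr => i _; rewrite /from.
by case: (ltngtP i s) => [h|h|->]; rewrite ?ltnn ?leqnn /=; ring.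
Qed.

Lemma from_ge0 s i : 0 <= from s i <= 1.
Proof. by rewrite /from; case: ifP => _; lra. Qed.

Lemma from_lt s i : (i < s)%N -> from s i = 0.
Proof. by rewrite /from ltnNge => /negbTE ->. Qed.

Lemma from_inv s i : (0 < s)%N -> 0 <= from s i / INR i <= / INR s.
Proof.
move=> s0; have s1 := INR_ge1 s0.
have i0 : 0 < / INR s by apply: Rinv_0_lt_compat; lra.
rewrite /from; case: ifP => si; last by rewrite /Rdiv Rmult_0_l; lra.
have si' : INR s <= INR i by apply: le_INR; apply/leP.
rewrite /Rdiv Rmult_1_l; split; first by left; apply: Rinv_0_lt_compat; lra.
by apply: Rinv_le_contravar; lra.
Qed.

Lemma from_inv_lt s i : (i < s)%N -> from s i / INR i = 0.
Proof. by move=> /from_lt ->; rewrite /Rdiv Rmult_0_l. Qed.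

(** * The radius of convergence *)

(** The logarithm of D. *)
Definition L2 : fps := Lam (fun i => from 2 i / INR i).

Lemma L2_0 : L2 0%N = 0. Proof. exact: Lam0. Qed.

Lemma L2_ge0 n : 0 <= L2 n.
Proof. by apply: Lam_ge0 => i; exact: (@from_inv 2 i isT).1. Qed.

Lemma t_fps : t = conv fX (Ex (fadd t L2)).
Proof.
apply: fps_ext => -[|n]; rewrite conv_fX; first exact: t0.
have := congr1 (fun a : fps => a n) t_shift => /= ->; congr (Ex _ n).
rewrite (@Lam_from 1 (fun i => / INR i) isT) Rinv_1.
by apply: fps_ext => k; rewrite /fadd /fscal /dil dvd1n divn1 /L2; congr (_ + _); ring.
Qed.

(* Bootstrap: T(y) <= 1 propagates through T = z exp (T + L2). *)
Lemma psum_t_le1 y B : 0 <= y ->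
  (forall N, psum t y N <= 1 -> psum L2 y N <= B) -> y * exp (1 + B) <= 1 ->
  forall N, psum t y N <= 1.
Proof.
move=> y0 HB Hy; elim=> [|N IH].
  by rewrite /psum sum_recr big_ord0 /sc t0; lra.
rewrite /psum t_fps sc_conv.
have -> : \sum_(n < N.+2) conv (sc y fX) (sc y (Ex (fadd t L2))) n = y * psum (Ex (fadd t L2)) y N.
  have -> : sc y fX = fscal y fX.
    by apply: fps_ext => -[|[|n]]; rewrite /sc /fscal /fX /=; ring.
  rewrite big_ord_recl fscal_convl {1}/fscal conv_fX Rmult_0_r Rplus_0_l /psum big_distrr /=.
  by apply: eq_bigr => n _; rewrite /fscal conv_fX /bump leq0n add1n.
apply: Rle_trans Hy; apply: Rmult_le_compat_l => //; apply: psum_Ex => //.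
- by rewrite /fadd t0 L2_0; ring.
- by move=> n; rewrite /fadd; have := t_ge0 n; have := L2_ge0 n; lra.
have -> : psum (fadd t L2) y N = psum t y N + psum L2 y N.
  by rewrite /psum -big_split /=; apply: eq_bigr => n _; rewrite /sc /fadd; ring.
by have := HB N IH; lra.
Qed.

Lemma psum_L2_le y B N : 0 <= y < 1 -> psum t (y ^ 2) N <= B ->
  psum L2 y N <= / 2 * B / (1 - y).
Proof.
move=> y01 tB; have := @psum_Lam (fun i => from 2 i / INR i) (/ 2) 2 y B N y01.
by apply=> //; [move=> i; exact: (@from_inv 2 i isT) | exact: from_inv_lt].
Qed.

Lemma exp_le_inv x : 0 <= x < 1 -> exp x <= / (1 - x).
Proof.
move=> x01; have h := exp_ineq1_le (- x); have e := exp_pos x.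
have e1 : exp x * exp (- x) = 1 by rewrite -exp_plus Rplus_opp_r exp_0.
apply: (Rmult_le_reg_r (1 - x)); first lra.
rewrite Rinv_l; last lra.
nra.
Qed.

(** A first foothold for the bootstrap: T(1/16) <= T(1/4)/4 because [t 0 = 0], so L2(1/4) <= 1/6,
    and exp(7/6)/4 <= 1. As L2 involves T only at z^2 and higher powers, L2 then converges at 1/2,
    beyond rho. *)
Lemma psum_t_quarter N : psum t (/ 4) N <= 1.
Proof.
apply: (@psum_t_le1 (/ 4) (1 / 6)); first lra.
  move=> {}N H; apply: Rle_trans (@psum_L2_le (/ 4) (/ 4) N _ _) _; [lra | | lra].
  apply: Rle_trans (_ : / 4 * psum t (/ 4) N <= _); last lra.
  rewrite /psum big_distrr /=; apply: sum_le => -[n nN] _; rewrite [nat_of_ord _]/= /sc.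
  case: n nN => [|n] nN; first by rewrite t0; lra.
  have tn := t_ge0 n.+1.
  have h : ((/ 4) ^ 2) ^ n.+1 <= / 4 * (/ 4) ^ n.+1.
    rewrite -pow_mult -[_ * _]/((/ 4) ^ n.+2); apply: pow_anti; first lra.
    by rewrite multE; lia.
  set A := ((/ 4) ^ 2) ^ n.+1 in h *; set B := (/ 4) ^ n.+1 in h *; nra.
rewrite exp_plus; have e1 := exp_le_3; have e2 := @exp_le_inv (1 / 6) (ltac:(lra)).
have := exp_pos 1; have := exp_pos (1 / 6); nra.
Qed.

Lemma ex_t_quarter : ex_series (sc (/ 4) t) /\ PSeries t (/ 4) <= 1.
Proof. by apply: psum_bounded psum_t_quarter; [lra | exact: t_ge0]. Qed.

Lemma ex_t_le y : 0 <= y <= / 4 -> ex_series (sc y t).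
Proof.
move=> y4; apply: ex_series_Rabs; apply: ex_series_sc_le t_ge0 _ ex_t_quarter.1.
by rewrite Rabs_pos_eq; lra.
Qed.

Lemma ex_L2_half : ex_series (sc (/ 2) L2) /\ PSeries L2 (/ 2) <= 1.
Proof.
apply: psum_bounded; [lra | exact: L2_ge0 | move=> N].
apply: Rle_trans (@psum_L2_le (/ 2) 1 N _ _) _; [lra | | lra].
by rewrite (_ : (/ 2) ^ 2 = / 4); [exact: psum_t_quarter | field].
Qed.

Lemma ex_L2 y : 0 <= y <= / 2 -> ex_series (sc y L2).
Proof.
move=> y2; apply: ex_series_Rabs; apply: ex_series_sc_le L2_ge0 _ ex_L2_half.1.
by rewrite Rabs_pos_eq; lra.
Qed.

Lemma PSeries_d x : Rabs x < / 2 -> PSeries d x = exp (PSeries L2 x).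
Proof. by rewrite d_Ex => x2; exact: PSeries_Ex L2_0 L2_ge0 ex_L2_half.1 x2. Qed.

Lemma ex_d_half : ex_series (sc (/ 2) d).
Proof. by rewrite d_Ex; apply: ex_series_Ex ex_L2_half.1; [exact: L2_0 | exact: L2_ge0 | lra]. Qed.

(** With u = T(z) the left side is u exp(1 - u), which never exceeds 1. [t_equation_ge] is the
    converse, and together they locate rho. *)
Lemma t_equation_le z : 0 <= z < / 2 -> Rbar_lt z (CV_radius t) ->
  z * exp (1 + PSeries L2 z) <= 1.
Proof.
move=> z2 zt.
have [y [y1 y2]] : exists y, z < y < / 2 /\ Rbar_lt y (CV_radius t).
  move: zt; case: (CV_radius t) => [r| |] //= zr.
    exists ((z + Rmin r (/ 2)) / 2); have := Rmin_l r (/ 2); have := Rmin_r r (/ 2).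
    have : z < Rmin r (/ 2) by apply: Rmin_glb_lt; lra.
    lra.
  by exists ((z + / 2) / 2); split=> //; lra.
have ext : ex_series (sc y t).
  by apply/ex_pseries_R; apply: CV_radius_inside; rewrite Rabs_pos_eq; [exact: y2 | lra].
have exL : ex_series (sc y L2) by apply: ex_L2; lra.
have zy : Rabs z < y by rewrite Rabs_pos_eq; lra.
have exs : ex_series (sc y (fadd t L2)).
  rewrite (_ : sc y (fadd t L2) = fun n => sc y t n + sc y L2 n); first exact: ex_series_plus ext exL.
  by apply: fps_ext => n; rewrite /sc /fadd; ring.
have exz a : (forall n, 0 <= a n) -> ex_series (sc y a) -> ex_series (sc z a).
  by move=> a0 exa; apply: ex_series_Rabs; apply: ex_series_sc_le a0 (Rlt_le _ _ zy) exa.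
have E : PSeries t z = z * exp (PSeries t z + PSeries L2 z).
  rewrite {1}t_fps.
  have -> : PSeries (conv fX (Ex (fadd t L2))) z = z * PSeries (Ex (fadd t L2)) z.
    by rewrite -PSeries_incr_1; apply: Series_ext => -[|n]; rewrite conv_fX.
  congr (z * _); rewrite (@PSeries_Ex (fadd t L2) y z) //.
  - congr exp; rewrite PSeriesE -Series_plus; try by apply: exz => //; [exact: t_ge0 || exact: L2_ge0].
    by apply: Series_ext => n; rewrite /sc /fadd; ring.
  - by rewrite /fadd t0 L2_0; ring.
  - by move=> n; rewrite /fadd; have := t_ge0 n; have := L2_ge0 n; lra.
set u := PSeries t z in E *.
have h : z * exp (1 + PSeries L2 z) = u * exp (1 - u).
  rewrite {1}E (_ : 1 + PSeries L2 z = (u + PSeries L2 z) + (1 - u)); last by ring.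
  by rewrite exp_plus; ring.
rewrite h; have e := exp_pos (1 - u); have := exp_ineq1_le (- (1 - u)).
have e1 : exp (1 - u) * exp (- (1 - u)) = 1 by rewrite -exp_plus Rplus_opp_r exp_0.
nra.
Qed.

Lemma t_equation_ge z : 0 <= z < / 2 -> z * exp (1 + PSeries L2 z) <= 1 ->
  (forall N, psum t z N <= 1) /\ Rbar_le z (CV_radius t).
Proof.
move=> z2 zE.
have H : forall N, psum t z N <= 1.
  apply: (@psum_t_le1 z (PSeries L2 z)) => //; first lra.
  by move=> N _; apply: psum_le_PSeries; [lra | exact: L2_ge0 | apply: ex_L2; lra].
split=> //; have [ext _] := @psum_bounded t z 1 (proj1 z2) t_ge0 H.
apply: CV_radius_ge; first lra.
by apply: ex_series_sc_le t_ge0 _ ext; rewrite Rabs_pos_eq; lra.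
Qed.

(* The only numerical input at this stage is a point hi beyond the radius. *)
Section Radius.
Variables (hi : R) (K : nat).
Hypotheses (hi_lt : 0 <= hi < / 2) (hi_gt : 1 < hi * exp (1 + psum L2 hi K)).

Lemma not_hi_lt : ~ Rbar_lt hi (CV_radius t).
Proof.
move=> /(t_equation_le hi_lt) H.
have : psum L2 hi K <= PSeries L2 hi.
  by apply: psum_le_PSeries; [lra | exact: L2_ge0 | apply: ex_L2; lra].
move=> h; have : exp (1 + psum L2 hi K) <= exp (1 + PSeries L2 hi) by apply: exp_mono; lra.
have := exp_pos (1 + psum L2 hi K); nra.
Qed.

Lemma CV_radius_t : CV_radius t = Rbar.Finite rho.
Proof.
have := not_hi_lt; rewrite /rho; case E : (CV_radius t) => [r| |] //= H.
have : Rbar_le (/ 4) (CV_radius t).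
  apply: CV_radius_ge; first lra.
  by apply: ex_series_sc_le t_ge0 _ ex_t_quarter.1; rewrite Rabs_pos_eq; lra.
by rewrite E.
Qed.

Lemma rho_bounds : / 4 <= rho <= hi.
Proof.
split.
  have : Rbar_le (/ 4) (CV_radius t).
    apply: CV_radius_ge; first lra.
    by apply: ex_series_sc_le t_ge0 _ ex_t_quarter.1; rewrite Rabs_pos_eq; lra.
  by rewrite CV_radius_t.
by have := not_hi_lt; rewrite CV_radius_t /= => H; lra.
Qed.

Lemma rho_ge lo U : 0 <= lo < / 2 -> PSeries L2 lo <= U -> lo * exp (1 + U) <= 1 -> lo <= rho.
Proof.
move=> lo2 LU H; have [|_] := @t_equation_ge lo lo2; last by rewrite CV_radius_t.
have : exp (1 + PSeries L2 lo) <= exp (1 + U) by apply: exp_mono; lra.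
nra.
Qed.

(** By continuity: a value below 1 would let [t_equation_ge] extend the radius, and a value above 1
    would contradict [t_equation_le] just before rho. *)
Lemma rho_eq : rho * exp (1 + PSeries L2 rho) = 1.
Proof.
have rb := rho_bounds.
pose f z := z * exp (1 + PSeries L2 z).
have cv : Rbar_lt (Rabs rho) (CV_radius L2).
  apply: (Rbar_lt_le_trans _ (/ 2)); first by rewrite /= Rabs_pos_eq; lra.
  apply: CV_radius_ge; first lra.
  by apply: ex_series_sc_le L2_ge0 _ ex_L2_half.1; rewrite Rabs_pos_eq; lra.
have cf : continuity_pt f rho.
  apply: continuity_pt_mult; first exact: continuity_pt_id.
  apply: (continuity_pt_comp (fun z => 1 + PSeries L2 z) exp).
    apply: continuity_pt_plus; first exact: continuity_pt_const.
    exact: PSeries_continuity.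
  exact: derivable_continuous_pt (derivable_pt_exp _).
have near e : 0 < e -> exists2 a, 0 < a & forall z, Rabs (z - rho) < a -> Rabs (f z - f rho) < e.
  move=> e0; have /continuity_pt_locally H := cf.
  by have [a Ha] := H (mkposreal e e0); exists a; [exact: cond_pos | move=> z; exact: Ha].
rewrite -/(f rho); case: (Rtotal_order (f rho) 1) => [lt1|[//|gt1]].
  have [a a0 H] := near (1 - f rho) (ltac:(lra)).
  pose z := rho + Rmin a (/ 2 - rho) / 2.
  have m0 : 0 < Rmin a (/ 2 - rho) by apply: Rmin_glb_lt; lra.
  have m1 := Rmin_l a (/ 2 - rho); have m2 := Rmin_r a (/ 2 - rho).
  have z2 : 0 <= z < / 2 by rewrite /z; lra.
  have fz : f z <= 1.
    have : Rabs (f z - f rho) < 1 - f rho by apply: H; rewrite /z Rabs_pos_eq; lra.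
    by move/Rabs_def2; lra.
  by have [_] := t_equation_ge z2 fz; rewrite CV_radius_t /z /=; lra.
have [a a0 H] := near (f rho - 1) (ltac:(lra)).
pose z := rho - Rmin a (/ 4) / 2.
have m0 : 0 < Rmin a (/ 4) by apply: Rmin_glb_lt; lra.
have m1 := Rmin_l a (/ 4); have m2 := Rmin_r a (/ 4).
have z2 : 0 <= z < / 2 by rewrite /z; lra.
have fz : f z <= 1 by apply: t_equation_le z2 _; rewrite CV_radius_t /z /=; lra.
have : Rabs (f z - f rho) < f rho - 1 by apply: H; rewrite /z; split_Rabs; lra.
by move/Rabs_def2; lra.
Qed.

Lemma psum_t_rho N : psum t rho N <= 1.
Proof.
have rb := rho_bounds.
have H : rho * exp (1 + PSeries L2 rho) <= 1 by rewrite rho_eq; lra.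
have r2 : 0 <= rho < / 2 by lra.
by have [P _] := t_equation_ge r2 H; exact: P.
Qed.

End Radius.

(** * Asymptotics of the mean *)

(** [L3], [Gam] and [Xi] are the series of log xi, gamma and xi. *)
Definition L3 : fps := Lam (fun i => from 3 i / INR i).
Definition Gam : fps := Lam (from 3).
Definition Xi : fps := Ex L3.

(** The coefficients of b of parity e, read as a series in z^2. *)
Definition part (e : nat) (b : fps) : fps := fun j => b (j.*2 + e)%N.

Lemma L3_0 : L3 0%N = 0. Proof. exact: Lam0. Qed.

Lemma L3_ge0 n : 0 <= L3 n.
Proof. by apply: Lam_ge0 => i; exact: (@from_inv 3 i isT).1. Qed.

Lemma Gam_ge0 n : 0 <= Gam n.
Proof. by apply: Lam_ge0 => i; exact: (@from_ge0 3 i).1. Qed.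

Lemma Xi_ge0 n : 0 <= Xi n.
Proof. exact: Ex_ge0 L3_ge0. Qed.

Lemma d_Xi : d = conv (dil 2 (Ex (fscal (/ 2) t))) Xi.
Proof.
have t0' : fscal (/ 2) t 0%N = 0 by rewrite /fscal t0; ring.
rewrite d_Ex (@Lam_from 2 (fun i => / INR i) isT) Ex_add; last exact: Lam0.
  rewrite /Ex dil_comp //; congr (conv (comp _ _) _).
  have -> : INR 2 = 2 by rewrite /=; ring.
  by apply: fps_ext => n; rewrite /fscal /dil; case: ifP => _; ring.
by rewrite /fscal /dil dvdn0 div0n t0; ring.
Qed.

Lemma Lam2_Gam : Lam (from 2) = fadd (dil 2 t) Gam.
Proof.
have E s : from s = fun i => from s i * (fun=> 1) i by apply: fps_ext => i; ring.
have := @Lam_from 2 (fun=> 1) isT; rewrite -!E => ->.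
by apply: fps_ext => n; rewrite /fadd /fscal /Gam; ring.
Qed.

Lemma num_Xi : conv (Lam (from 2)) d =
  fadd (conv (dil 2 (conv t (Ex (fscal (/ 2) t)))) Xi)
       (conv (dil 2 (Ex (fscal (/ 2) t))) (conv Gam Xi)).
Proof. by rewrite Lam2_Gam d_Xi dil_conv //; ring. Qed.

(** A series in z^2 preserves parity, so only the part of b of parity e meets a at index 2m + e.
    From here on, rho is the only dominant singularity. *)
Lemma conv_dil2 a b m e : (e < 2)%N ->
  conv (dil 2 a) b (m.*2 + e)%N = conv a (part e b) m.
Proof.
move=> e2; rewrite /conv.
rewrite (dil_sum_div a (m.*2 + e) (fun j => b (m.*2 + e - j)%N) (isT : (0 < 2)%N)).
have -> : ((m.*2 + e) %/ 2 = m)%N by lia.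
apply: eq_bigr => i _; rewrite /part; congr (_ * b _).
by have := ltn_ord i; rewrite ltnS => im; lia.
Qed.

Lemma finite_Series (a : nat -> R) N : (forall k, (N <= k)%N -> a k = 0) ->
  Series a = \sum_(k < N) a k.
Proof.
move=> aN; have E : (fun k => a (N + k)%N) = fun=> 0.
  by apply: fps_ext => k; rewrite aN // leq_addr.
have exa : ex_series a by apply/(ex_series_incr_n a N); rewrite E; eexists; exact: is_series_zero.
by rewrite (Series_split N exa) E (is_series_unique _ _ is_series_zero); ring.
Qed.

Lemma mean_XE n : mean_X n = conv (Lam (from 2)) d n / d n.
Proof.
rewrite /mean_X (@finite_Series _ n.+1) => [|k nk]; last first.
  by rewrite /prob_X d2_big // /Rdiv; ring.
rewrite -(@sum_d2 n n.+1) // /Rdiv big_distrl /=.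
by apply: eq_bigr => k _; rewrite /prob_X; rewrite /Rdiv; ring.
Qed.

Lemma exp1_pow n : exp (- INR n) * exp 1 ^ n = 1.
Proof.
elim: n => [|n IH]; first by rewrite /= Ropp_0 exp_0; ring.
rewrite S_INR Ropp_plus_distr exp_plus -tech_pow_Rmult.
have : exp (- (1)) * exp 1 = 1 by rewrite -exp_plus Rplus_opp_l exp_0.
move=> E; transitivity ((exp (- INR n) * exp 1 ^ n) * (exp (- (1)) * exp 1)); first by ring.
by rewrite IH E; ring.
Qed.

(** Rescaling moves the singularity of the tree function from 1/e to 1, where [asym] applies. *)
Lemma comp_rescale f u : comp f u = comp (fun n => f n * exp (- INR n)) (fscal (exp 1) u).
Proof.
apply: fps_ext => m; apply: eq_bigr => n _; rewrite fpow_scal /fscal.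
transitivity ((exp (- INR n) * exp 1 ^ n) * (f n * fpow u n m)); last by ring.
by rewrite exp1_pow; ring.
Qed.

Lemma asym_ratio a b c e : asym a c -> asym b e -> e <> 0 ->
  exists C, eventually (fun m => Rabs (a m / b m - c / e) <= C / INR m).
Proof.
move=> /asym_pos[A A0 aA] /asym_pos[B B0 bB] e0.
have ep := Rabs_pos_lt e e0.
exists (2 * (A * Rabs e + Rabs c * B) / Rabs e ^ 2).
(* From M on, |b m| is at least half of its leading term. *)
have [M [M0 MB]] : exists M, (0 < M)%N /\ 2 * B <= Rabs e * INR M.
  have [M HM] := INR_unbounded (2 * B / Rabs e).
  exists M.+1; split=> //; rewrite S_INR.
  have : 2 * B / Rabs e * Rabs e = 2 * B by field; lra.
  nra.
exists M => m /leP Mm; have m0 : (0 < m)%N by apply: leq_trans Mm.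
have m1 := INR_ge1 m0; have b0 := bt_gt0 m0.
have mM : INR M <= INR m by apply: le_INR; apply/leP.
have ha := aA m m0; have hb := bB m m0.
have bm : Rabs e * bt m / 2 <= Rabs (b m).
  have h1 : B * (bt m / INR m) <= Rabs e * bt m / 2.
    apply: (Rmult_le_reg_r (INR m)); first lra.
    rewrite (_ : B * (bt m / INR m) * INR m = B * bt m); last by field; lra.
    have : 2 * B <= Rabs e * INR m by apply: Rle_trans MB _; apply: Rmult_le_compat_l; lra.
    nra.
  have h2 : Rabs (e * bt m) = Rabs e * bt m by rewrite Rabs_mult (Rabs_pos_eq (bt m)); lra.
  have := Rabs_triang_inv (e * bt m) (b m); rewrite Rabs_minus_sym h2; lra.
have bm0 : 0 < Rabs (b m) by apply: Rlt_le_trans bm; nra.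
have bn0 : b m <> 0 by move=> E; rewrite E Rabs_R0 in bm0; lra.
rewrite (_ : a m / b m - c / e = ((a m - c * bt m) * e - c * (b m - e * bt m)) / (b m * e)); last by field.
rewrite Rabs_div ?Rabs_mult; last exact: Rmult_integral_contrapositive.
have num : Rabs ((a m - c * bt m) * e - c * (b m - e * bt m)) <= (A * Rabs e + Rabs c * B) * (bt m / INR m).
  apply: Rle_trans (Rabs_triang _ _) _; rewrite Rabs_Ropp !Rabs_mult.
  have := Rabs_pos c; nra.
apply: (Rmult_le_reg_r (Rabs (b m) * Rabs e)); first by nra.
rewrite {1}/Rdiv Rmult_assoc Rinv_l ?Rmult_1_r; last by nra.
apply: Rle_trans num _.
rewrite (_ : _ / _ / INR m * _ = (A * Rabs e + Rabs c * B) * (2 * Rabs (b m) / (Rabs e * INR m))); last by field; lra.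
apply: Rmult_le_compat_l; first by have := Rabs_pos c; nra.
apply: (Rmult_le_reg_r (Rabs e * INR m)); first by nra.
rewrite (_ : bt m / INR m * _ = Rabs e * bt m); last by field; lra.
rewrite (_ : 2 * _ / _ * _ = 2 * Rabs (b m)); last by field; lra.
lra.
Qed.

(** * The mean along each parity class *)

Section Mean.
Hypotheses (rho_lo : / 4 <= rho) (rho_hi : rho <= 34 / 100).
Hypothesis rhoE : rho * exp (1 + PSeries L2 rho) = 1.
Hypothesis L2_step : PSeries L2 (6 / 5 * rho) <= PSeries L2 rho + / 8.

(** The series z D; then Y(z) = e x(rho z), and [rhoE] says that Y sums to 1. *)
Let x : fps := conv fX d.
Let Y : fps := fscal (exp 1) (sc rho x).

Lemma x_t : x = conv t (Ex (fscal (-1) t)).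
Proof.
have E1 : conv (Ex t) (Ex (fscal (-1) t)) = fone.
  rewrite -Ex_add ?t0 //; last by rewrite /fscal t0; ring.
  rewrite -Ex_fzero; congr Ex; apply: fps_ext => n; rewrite /fadd /fscal /fzero; ring.
rewrite {1}t_fps Ex_add ?t0 ?L2_0 // -d_Ex -/L2.
have E2 z : conv (conv fX (conv (Ex t) d)) z = conv (conv (Ex t) z) (conv fX d) by ring.
by rewrite E2 E1 conv1l.
Qed.

Lemma d_ge0 n : 0 <= d n.
Proof. by rewrite d_Ex; exact: Ex_ge0 L2_ge0. Qed.

Lemma x_ge0 n : 0 <= x n.
Proof. by rewrite /x conv_fX; case: n => [|n]; [lra | exact: d_ge0]. Qed.

Lemma scY_series z : 0 <= z < / 2 ->
  ex_series (fscal (exp 1) (sc z x)) /\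
  Series (fscal (exp 1) (sc z x)) = z * exp (1 + PSeries L2 z).
Proof.
move=> z2; have exd : ex_series (sc z d).
  apply: ex_series_Rabs; apply: ex_series_sc_le d_ge0 _ ex_d_half.
  by rewrite Rabs_pos_eq; lra.
have exx : ex_series (sc z x).
  apply/(ex_series_incr_1 (sc z x)).
  rewrite (_ : (fun k => _) = fun k => scal z (sc z d k)).
    exact: (@ex_series_scal_l R_AbsRing R_NormedModule).
  by apply: fps_ext => n; rewrite /sc /x conv_fX /scal /= /mult /=; ring.
split; first exact: (@ex_series_scal_l R_AbsRing R_NormedModule).
rewrite Series_scal_l -PSeriesE.
have -> : PSeries x z = z * PSeries d z.
  by rewrite -PSeries_incr_1; apply: Series_ext => -[|n]; rewrite /x conv_fX.
rewrite PSeries_d ?exp_plus; first by ring.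
by rewrite Rabs_pos_eq; lra.
Qed.

(** The radius 6/5 fits: [L2_step] and exp(1/8) <= 8/7 give Y(6/5) <= 48/35, which is below 2 (6/5)
    - 1 = 7/5. *)
Lemma Y_transfer : exists2 K, K <> 0 & forall a c, asym a c -> asym (comp a Y) (c * K).
Proof.
have [exY Y1] := @scY_series rho (ltac:(lra)).
have scE : sc (6 / 5) Y = fscal (exp 1) (sc (6 / 5 * rho) x).
  by apply: fps_ext => n; rewrite /Y /fscal /sc Rpow_mult_distr; ring.
have [exYr Yr] := @scY_series (6 / 5 * rho) (ltac:(lra)).
apply: (@comp_asym_transfer Y (6 / 5)).
- by rewrite /Y /fscal /sc /x conv_fX; ring.
- move=> n; apply: Rmult_le_pos; first by left; exact: exp_pos.
  by apply: sc_ge0; [lra | exact: x_ge0].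
- exact: exY.
- by rewrite Y1.
- lra.
- by rewrite scE.
rewrite scE Yr.
have h : exp (1 + PSeries L2 (6 / 5 * rho)) <= exp (1 + PSeries L2 rho) * (8 / 7).
  apply: Rle_trans (_ : exp (1 + PSeries L2 rho + / 8) <= _); first by apply: exp_mono; lra.
  rewrite exp_plus; apply: Rmult_le_compat_l; first by left; exact: exp_pos.
  by apply: Rle_trans (@exp_le_inv (/ 8) _) _; lra.
have : 6 / 5 * rho * exp (1 + PSeries L2 (6 / 5 * rho)) <= 6 / 5 * (8 / 7) * (rho * exp (1 + PSeries L2 rho)).
  have := exp_pos (1 + PSeries L2 rho); nra.
rewrite rhoE; lra.
Qed.

Lemma T_asym : exists2 K, K <> 0 &
  asym (sc rho (Ex (fscal (/ 2) t))) K /\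
  asym (sc rho (conv t (Ex (fscal (/ 2) t)))) (3 * K).
Proof.
have [K K0 trans] := Y_transfer; have [K' K'0 aK'] := cay_asym.
exists (K' * K); first exact: Rmult_integral_contrapositive.
have x0 : x 0%N = 0 by rewrite /x conv_fX.
have st0 c : fscal c t 0%N = 0 by rewrite /fscal t0; ring.
split.
  rewrite -(comp_cay (/ 2) t0) -x_t sc_comp comp_rescale; exact: trans.
have -> : conv t (Ex (fscal (/ 2) t)) = comp (conv fX (cay (3 / 2))) x.
  rewrite comp_conv // comp_fX // {2}x_t comp_cay ?t0 // x_t -convA -Ex_add //.
  by congr (conv t (Ex _)); apply: fps_ext => n; rewrite /fadd /fscal; field.
rewrite sc_comp comp_rescale -Rmult_assoc; apply: trans.
exact: cay_asym_shift.
Qed.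

(** The bound 62/100 lies beyond sqrt rho, as its square exceeds 34/100, while its cube is at most
    1/4, where T converges. *)
Lemma ex_Xi y : 0 <= y <= 62 / 100 -> ex_series (sc y L3) /\ ex_series (sc y Gam).
Proof.
move=> y62; have y3 : 0 <= y ^ 3 <= / 4.
  split; first by apply: pow_le; lra.
  apply: Rle_trans (_ : (62 / 100) ^ 3 <= _); first by apply: pow_incr; lra.
  by rewrite /=; lra.
have ext := ex_t_le y3; have y1 : 0 <= y < 1 by lra.
split.
  by apply: (ex_series_Lam (s := 3) y1) ext => // i; [exact: from_inv | exact: from_inv_lt].
by apply: (ex_series_Lam (s := 3) y1) ext => // i; [exact: from_ge0 | exact: from_lt].
Qed.

(** With y = 62/100 the terms are O((rho / y^2)^j), and rho < y^2. *)
Lemma part_wsum e b : (forall n, 0 <= b n) -> ex_series (sc (62 / 100) b) -> (e < 2)%N ->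
  wsum (sc rho (part e b)).
Proof.
move=> b0 exb e2; set y := 62 / 100 in exb.
pose q := rho / y ^ 2; have q01 : 0 < q < 1.
  rewrite /q; split; first by apply: Rdiv_lt_0_compat; rewrite /y /=; lra.
  apply: (Rmult_lt_reg_r (y ^ 2)); first by rewrite /y /=; lra.
  by rewrite /Rdiv Rmult_assoc Rinv_l /y /=; lra.
apply: (@wsum_geom _ (Series (sc y b) * / y) q q01) => j.
have rj : 0 <= rho ^ j by apply: pow_le; lra.
have yj : 0 < y ^ (j.*2 + e) by apply: pow_lt; rewrite /y; lra.
rewrite Rabs_pos_eq; last by apply: Rmult_le_pos => //; exact: b0.
have H : b (j.*2 + e)%N * y ^ (j.*2 + e) <= Series (sc y b).
  by apply: (Series_term_le (j.*2 + e) (a := sc y b)) exb => n; apply: sc_ge0; [rewrite /y; lra | exact: b0].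
have rE : rho ^ j = q ^ j * y ^ (j.*2).
  have -> : y ^ (j.*2) = (y ^ 2) ^ j by rewrite -pow_mult; congr (y ^ _); lia.
  by rewrite -Rpow_mult_distr; congr (_ ^ j); rewrite /q; field; rewrite /y; lra.
have qj : 0 < q ^ j by apply: pow_lt; lra.
rewrite -[sc rho (part e b) j]/(b (j.*2 + e)%N * rho ^ j) rE (Rmult_comm (q ^ j)) -Rmult_assoc; apply: Rmult_le_compat_r; first lra.
have ye : 1 <= y ^ e * / y.
  case: e e2 {yj H} => [|[|//]] _; first by rewrite /y /=; lra.
  by rewrite /y /=; lra.
have S0 : 0 <= b (j.*2 + e)%N * y ^ j.*2.
  by apply: Rmult_le_pos => //; apply: pow_le; rewrite /y; lra.
move: H; rewrite pow_add -Rmult_assoc => H.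
have yi : 0 < / y by apply: Rinv_0_lt_compat; rewrite /y; lra.
apply: Rle_trans (_ : b (j.*2 + e)%N * y ^ j.*2 * (y ^ e * / y) <= _); first nra.
rewrite -Rmult_assoc; apply: Rmult_le_compat_r; lra.
Qed.

Lemma sc_part_even a m e : (e < 2)%N -> forall b, conv (dil 2 a) b (m.*2 + e)%N * rho ^ m =
  conv (sc rho a) (sc rho (part e b)) m.
Proof. by move=> e2 b; rewrite conv_dil2 // -sc_conv. Qed.

(** The unknown constant K of [T_asym] multiplies the numerator 3 X + G and the denominator X
    alike. *)
Lemma mean_asym e : (e < 2)%N -> PSeries (part e Xi) rho <> 0 ->
  exists C, eventually (fun m => Rabs (mean_X (m.*2 + e) -
    (3 + PSeries (part e (conv Gam Xi)) rho / PSeries (part e Xi) rho)) <= C / INR m).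
Proof.
move=> e2 X0; have [K K0 [aG aH]] := T_asym.
have [exL exG] := @ex_Xi (62 / 100) (ltac:(lra)).
have exX : ex_series (sc (62 / 100) Xi) by apply: ex_series_Ex exL; [exact: L3_0 | exact: L3_ge0 | lra].
have wX := part_wsum Xi_ge0 exX e2.
have GX0 n : 0 <= conv Gam Xi n by apply: conv_ge0 => i _; [exact: Gam_ge0 | exact: Xi_ge0].
have exGX : ex_series (sc (62 / 100) (conv Gam Xi)).
  by apply: ex_series_conv exG exX; [lra | exact: Gam_ge0 | exact: Xi_ge0].
have wGX := part_wsum GX0 exGX e2.
have aD := conv_asym aG wX; have aN := asym_add (conv_asym aH wX) (conv_asym aG wGX).
rewrite -PSeriesE in aD; rewrite -!PSeriesE in aN.
set X := PSeries (part e Xi) rho in X0 aD aN *; set G := PSeries (part e (conv Gam Xi)) rho in aN *.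
have [|C HC] := asym_ratio aN aD; first exact: Rmult_integral_contrapositive.
exists C; have [M HM] := HC; exists M => m Mm.
have := HM m Mm; rewrite -!sc_part_even // -Rmult_plus_distr_r mean_XE {2}d_Xi num_Xi.
rewrite (_ : (3 * K * X + K * G) / (K * X) = 3 + G / X); last by field.
have rm : rho ^ m <> 0 by apply: pow_nonzero; lra.
rewrite (_ : forall u v, u * rho ^ m / (v * rho ^ m) = u / v) //.
move=> u v; rewrite /Rdiv Rinv_mult; transitivity (u * / v * (rho ^ m * / rho ^ m)); first by ring.
by rewrite Rinv_r //; ring.
Qed.

Lemma xi_PSeries z : Rabs z < 62 / 100 -> xi z = PSeries Xi z /\ gamma z = PSeries Gam z.
Proof.
move=> z62; have [exL exG] := @ex_Xi (62 / 100) (ltac:(lra)).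
have ext : ex_series (sc ((62 / 100) ^ 3) t) by apply: ex_t_le; rewrite /=; lra.
have shift (a : nat -> R) : (forall i, (i < 3)%N -> a i = 0) -> Series a = Series (fun j => a (j + 3)%N).
  move=> a0; rewrite (Series_incr_n_aux a 3) => [|k k3]; last by apply: a0; apply/ltP.
  by apply: Series_ext => j; rewrite plusE addnC.
split.
  rewrite /Xi (PSeries_Ex L3_0 L3_ge0 exL z62) /xi; congr exp.
  have E := @PSeries_Lam (fun i => from 3 i / INR i) (/ INR 3) 3 (62 / 100) z (ltac:(lra))
    (fun i => @from_inv 3 i isT) (@from_inv_lt 3) isT ext (Rlt_le _ _ z62).
  have E3 i : (i < 3)%N -> from 3 i / INR i * T (z ^ i) = 0 by move=> i3; rewrite from_inv_lt //; ring.
  rewrite (etrans E (shift _ E3)).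
  by apply: Series_ext => j; rewrite /from leq_addl /Rdiv; ring.
have E := @PSeries_Lam (from 3) 1 3 (62 / 100) z (ltac:(lra))
  (@from_ge0 3) (@from_lt 3) isT ext (Rlt_le _ _ z62).
have E3 i : (i < 3)%N -> from 3 i * T (z ^ i) = 0 by move=> i3; rewrite from_lt //; ring.
rewrite (etrans E (shift _ E3)).
by apply: Series_ext => j; rewrite /from leq_addl; ring.
Qed.

Let s := sqrt rho.

Lemma s_bounds : s ^ 2 = rho /\ 0 < s < 62 / 100.
Proof.
have s2 : s ^ 2 = rho by rewrite /s pow2_sqrt //; lra.
split=> //; split; first by apply: sqrt_lt_R0; lra.
rewrite /s -(sqrt_Rsqr (62 / 100)); last lra.
by apply: sqrt_lt_1; rewrite /Rsqr; lra.
Qed.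

Lemma PSeries_parts b : (forall n, 0 <= b n) -> ex_series (sc (62 / 100) b) ->
  PSeries b s = PSeries (part 0 b) rho + s * PSeries (part 1 b) rho /\
  PSeries b (- s) = PSeries (part 0 b) rho - s * PSeries (part 1 b) rho.
Proof.
move=> b0 exb; have [s2 _] := s_bounds.
have ex e : (e < 2)%N -> ex_pseries (part e b) rho.
  by move=> e2; apply/ex_pseries_R; apply: ex_series_Rabs; apply: wsum_Rabs; exact: part_wsum.
have E0 : (fun n => b (2 * n)%coq_nat) = part 0 b.
  by apply: fps_ext => n; rewrite /part addn0 -mul2n.
have E1 : (fun n => b ((2 * n)%coq_nat + 1)%coq_nat) = part 1 b.
  by apply: fps_ext => n; rewrite /part -mul2n.
have e0 := ex 0%N isT; have e1 := ex 1%N isT.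
have ns2 : (- s) ^ 2 = rho by rewrite -s2; ring.
split; rewrite PSeries_odd_even ?E0 ?E1 ?s2 ?ns2 //; ring.
Qed.

(** Xi_0 = 1, and three copies of the one-node tree make Xi_3 >= 1/3, so neither denominator
    vanishes. *)
Lemma parts_pos : 0 < PSeries (part 0 Xi) rho /\ 0 < PSeries (part 1 Xi) rho.
Proof.
have [exL _] := @ex_Xi (62 / 100) (ltac:(lra)).
have exX : ex_series (sc (62 / 100) Xi) by apply: ex_series_Ex exL; [exact: L3_0 | exact: L3_ge0 | lra].
have term e j : (e < 2)%N -> Xi (j.*2 + e)%N * rho ^ j <= PSeries (part e Xi) rho.
  move=> e2; apply: (Series_term_le j (a := sc rho (part e Xi))).
    by move=> n; apply: sc_ge0; [lra | exact: Xi_ge0].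
  by apply: ex_series_Rabs; apply: wsum_Rabs; exact: part_wsum Xi_ge0 exX e2.
split.
  have := term 0%N 0%N isT; rewrite /Xi Ex0 /=; lra.
have := term 1%N 1%N isT; rewrite -[(1.*2 + 1)%N]/3%N pow_1 => H.
apply: Rlt_le_trans H; apply: Rmult_lt_0_compat; last lra.
have L33 : 0 < L3 3%N.
  rewrite /L3 (@Lam_from 3 (fun i => / INR i) isT) /fadd.
  have : 0 <= Lam (fun i => from 4 i * / INR i) 3%N.
    by apply: Lam_ge0 => i; exact: (@from_inv 4 i isT).1.
  have t1 : t 1%N = 1.
    by rewrite t_fps conv_fX Ex0.
  rewrite /fscal /dil /= -[(3 %/ 3)%N]/1%N t1; lra.
have : 1 * L3 3%N <= Xi 3%N.
  pose F n := expc 1 n * fpow L3 n 3%N.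
  have h n : 0 <= F n.
    by apply: Rmult_le_pos; [exact: expc1_ge0 | apply: fpow_ge0 => i _; exact: L3_ge0].
  have := partial_incr (a := F) h (isT : (2 <= 4)%N).
  rewrite (sum_recr F 1) (sum_recr F 0) big_ord0 => H; apply: Rle_trans H.
  have -> : F 1%N = L3 3%N.
    by rewrite /F [fpow L3 1]/= convC conv1l /expc /=; field.
  by have := h 0%N; lra.
lra.
Qed.

(** The sum xi(s) + xi(-s) is twice the even part and the difference is 2 s times the odd part. The
    same holds for gamma xi, so the factors cancel. *)
Lemma mu_parts :
  mu0 = PSeries (part 0 (conv Gam Xi)) rho / PSeries (part 0 Xi) rho /\
  mu1 = PSeries (part 1 (conv Gam Xi)) rho / PSeries (part 1 Xi) rho.
Proof.
have [s2 s62] := s_bounds; have [p0 p1] := parts_pos.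
have [exL exG] := @ex_Xi (62 / 100) (ltac:(lra)).
have exX : ex_series (sc (62 / 100) Xi) by apply: ex_series_Ex exL; [exact: L3_0 | exact: L3_ge0 | lra].
have GX0 n : 0 <= conv Gam Xi n by apply: conv_ge0 => i _; [exact: Gam_ge0 | exact: Xi_ge0].
have exGX : ex_series (sc (62 / 100) (conv Gam Xi)).
  by apply: ex_series_conv exG exX; [lra | exact: Gam_ge0 | exact: Xi_ge0].
have zs : Rabs s < 62 / 100 by rewrite Rabs_pos_eq; lra.
have zn : Rabs (- s) < 62 / 100 by rewrite Rabs_Ropp.
have [x1 x2] := PSeries_parts Xi_ge0 exX; have [g1 g2] := PSeries_parts GX0 exGX.
have mul z : Rabs z < 62 / 100 -> PSeries (conv Gam Xi) z = gamma z * xi z.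
  move=> z62; have [-> ->] := xi_PSeries z62; apply: PSeries_conv.
    exact: ex_series_sc_le Gam_ge0 (Rlt_le _ _ z62) exG.
  exact: ex_series_sc_le Xi_ge0 (Rlt_le _ _ z62) exX.
rewrite mul // in g1; rewrite mul // in g2.
have [e1 _] := xi_PSeries zs; have [e2 _] := xi_PSeries zn.
rewrite -e1 in x1; rewrite -e2 in x2.
rewrite /mu0 /mu1 -/s.
rewrite (Rmult_comm (xi s)) (Rmult_comm (xi (- s))) g1 g2 x1 x2.
set X0 := PSeries (part 0 Xi) rho in p0 *; set X1 := PSeries (part 1 Xi) rho in p1 *.
have sX : 0 < s * X1 by apply: Rmult_lt_0_compat; lra.
split; field; split; lra.
Qed.

Lemma mean_parity e : (e < 2)%N ->
  exists C, eventually (fun n => odd n = (e == 1%N) ->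
    Rabs (mean_X n - (3 + (if e == 1%N then mu1 else mu0))) <= C / INR n).
Proof.
move=> e2; have [p0 p1] := parts_pos; have [m0E m1E] := mu_parts.
have X0 : PSeries (part e Xi) rho <> 0 by case: e e2 => [|[|//]] _; lra.
have [C [M HM]] := mean_asym e2 X0.
(* For n = 2m + e with m >= 1, 1/m <= 3/n; starting at 3 + 2M ensures both m >= 1 and m >= M. *)
exists (3 * Rabs C); exists (3 + M.*2)%N => n /leP nM on.
have nE : n = (n./2.*2 + e)%N.
  by rewrite -[LHS]odd_double_half on addnC; case: e e2 {X0 HM on} => [|[|//]].
set m := n./2 in nE; have mM : (M <= m)%N by rewrite /m; lia.
have m1 : (0 < m)%N by rewrite /m; lia.
have := HM m (elimT leP mM); rewrite -nE.
have -> : 3 + (if e == 1%N then mu1 else mu0) =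
    3 + PSeries (part e (conv Gam Xi)) rho / PSeries (part e Xi) rho.
  by case: e e2 {X0 HM on nE} => [|[|//]] _ /=; rewrite ?m0E ?m1E.
move=> H; apply: Rle_trans H _.
have hm := INR_ge1 m1; have hn : INR n <= 3 * INR m.
  rewrite (_ : 3 * INR m = INR (3 * m)); last by rewrite mult_INR /=; ring.
  by apply: le_INR; rewrite nE; move: e2 m1; clear; lia.
have n0 : 0 < INR n by apply: lt_0_INR; lia.
apply: Rle_trans (_ : Rabs C / INR m <= _).
  by apply: Rmult_le_compat_r; [left; apply: Rinv_0_lt_compat; lra | exact: Rle_abs].
rewrite /Rdiv (Rmult_comm 3) Rmult_assoc; apply: Rmult_le_compat_l; first exact: Rabs_pos.
apply: (Rmult_le_reg_r (INR m * INR n)); first by apply: Rmult_lt_0_compat; lra.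
rewrite (_ : / INR m * _ = INR n); last by field; lra.
by rewrite (_ : 3 * / INR n * _ = 3 * INR m); [lra | field; lra].
Qed.

End Mean.

(** * Certified evaluation of power series *)

(** Beyond degree K the terms at x are at most q^(K+1) times those at y. *)
Lemma psum_tail a x y q B K : (forall n, 0 <= a n) -> 0 <= x -> x <= q * y -> 0 <= q <= 1 -> 0 <= y ->
  (forall N, psum a y N <= B) -> PSeries a x <= psum a x K + B * q ^ K.+1.
Proof.
move=> a0 x0 xy q01 y0 aB.
have B0 : 0 <= B.
  by apply: Rle_trans (aB 0%N); apply: sum_ge0 => n _; apply: sc_ge0.
have qK : 0 <= q ^ K.+1 by apply: pow_le; lra.
apply: (proj2 (@psum_bounded a x _ x0 a0 _)) => N.
case: (leqP N K) => [NK|KN].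
  have : psum a x N <= psum a x K.
    by apply: (@partial_incr (sc x a)); [move=> i; exact: sc_ge0 | rewrite ltnS].
  have := Rmult_le_pos _ _ B0 qK; lra.
apply: Rle_trans (_ : \sum_(n < N.+1) ((if (n <= K)%N then sc x a n else 0) + sc y a n * q ^ K.+1) <= _).
  apply: sum_le => -[n nN] _ /=; rewrite /sc.
  have yn : 0 <= y ^ n by exact: pow_le.
  have an := a0 n; have ay := Rmult_le_pos _ _ an yn.
  have := Rmult_le_pos _ _ ay qK => /= h.
  case: ifP => nK; first by lra.
  rewrite Rplus_0_l Rmult_assoc; apply: Rmult_le_compat_l => //.
  apply: Rle_trans (_ : (q * y) ^ n <= _); first by apply: pow_incr.
  rewrite Rpow_mult_distr Rmult_comm; apply: Rmult_le_compat_l => //.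
  by apply: (@pow_anti q K.+1 n) => //; rewrite ltnNge nK.
rewrite big_split /= -big_distrl /=; apply: Rplus_le_compat.
  have -> := @sum_wid K.+1 N.+1 (fun n => if (n <= K)%N then sc x a n else 0).
  - by apply: Req_le; apply: eq_bigr => -[n nK] _ /=; rewrite -ltnS nK.
  - exact: ltnW.
  by move=> i Ki _; rewrite leqNgt Ki.
by apply: Rmult_le_compat_r; [|exact: aB].
Qed.

Lemma psum_mask (e : bool) a y N B : 0 <= y -> (forall n, 0 <= a n) -> psum a y N <= B ->
  psum (fun n => if odd n == e then a n else 0) y N <= B.
Proof.
move=> y0 a0; apply: Rle_trans; apply: sum_le => n _; rewrite /sc.
by have := sc_ge0 y0 (a0 n); rewrite /sc; case: ifP => _ //; lra.
Qed.

Lemma PSeries_parity a x : ex_series (sc (Rabs x) a) -> (forall n, 0 <= a n) ->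
  let p e := PSeries (fun n => if odd n == e then a n else 0) x in
  PSeries a x = p false + p true /\ PSeries a (- x) = p false - p true.
Proof.
move=> exa a0 p.
have exm e : ex_series (sc x (fun n => if odd n == e then a n else 0)).
  apply: ex_series_Rabs; apply: (@ex_series_sc_le _ x (Rabs x)); [|lra|].
    by move=> n; case: ifP => _ //; lra.
  have [] // := @psum_bounded (fun n => if odd n == e then a n else 0) (Rabs x) (PSeries a (Rabs x)) (Rabs_pos x).
    by move=> n; case: ifP => _ //; lra.
  move=> N; apply: psum_mask => //; first exact: Rabs_pos.
  by apply: psum_le_PSeries => //; exact: Rabs_pos.
rewrite /p !PSeriesE -Series_plus // -Series_minus //; split; congr Series; apply: fps_ext => n.
  by rewrite /sc; case: (odd n) => /=; ring.
rewrite /sc (_ : - x = -1 * x); last by ring.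
rewrite Rpow_mult_distr (_ : (-1) ^ n = if odd n then -1 else 1); last first.
  by elim: n => [|n IH] //=; rewrite IH; case: (odd n) => /=; ring.
by case: (odd n) => /=; ring.
Qed.

Definition Zq (c : Z * Z) : R := IZR c.1 / IZR c.2.

Definition cdiv (a b : Z) : Z := (- (- a / b))%Z.

Definition scale : Z := 100000000000000000000%Z.

(* Fixed point arithmetic at Y / scale; dv is a division rounding up or down. *)
Fixpoint horner_fix (dv : Z -> Z -> Z) (Y : Z) (cs : seq (Z * Z)) : Z :=
  if cs is c :: cs' then (dv (c.1 * scale) c.2 + dv (Y * horner_fix dv Y cs') scale)%Z
  else 0%Z.

Fixpoint horner_R (y : R) (cs : seq (Z * Z)) : R :=
  if cs is c :: cs' then Zq c + y * horner_R y cs' else 0.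

Definition coef_ok (c : Z * Z) : bool := (0 <=? c.1)%Z && (0 <? c.2)%Z.

Lemma div_le a b : (0 < b)%Z -> IZR (a / b) <= IZR a / IZR b.
Proof.
move=> b0; have b0' := IZR_lt _ _ b0.
apply: (Rmult_le_reg_r (IZR b)) => //; rewrite /Rdiv Rmult_assoc Rinv_l; last lra.
by rewrite Rmult_1_r -mult_IZR; apply: IZR_le; have := Z.mul_div_le a b b0; lia.
Qed.

Lemma cdiv_ge a b : (0 < b)%Z -> IZR a / IZR b <= IZR (cdiv a b).
Proof. by move=> b0; rewrite /cdiv opp_IZR; have := div_le (- a) b0; rewrite opp_IZR; lra. Qed.

Lemma scale_gt0 : 0 < IZR scale.
Proof. exact: IZR_lt. Qed.

Lemma Zq_ge0 c : coef_ok c -> 0 <= Zq c.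
Proof.
case: c => a b /andP[/Z.leb_le/IZR_le /= h /Z.ltb_lt/IZR_lt /= h'].
by apply: Rmult_le_pos => //; left; exact: Rinv_0_lt_compat.
Qed.

Lemma horner_R_ge0 y cs : 0 <= y -> all coef_ok cs -> 0 <= horner_R y cs.
Proof.
move=> y0; elim: cs => [|c cs IH] /=; first by lra.
by move=> /andP[/Zq_ge0 h /IH h']; have := Rmult_le_pos _ _ y0 h'; lra.
Qed.

(** All quantities are nonnegative, so rounding every division up keeps the evaluation an upper
    bound. *)
Lemma horner_ub y Y cs : 0 <= y <= IZR Y / IZR scale -> all coef_ok cs ->
  horner_R y cs * IZR scale <= IZR (horner_fix cdiv Y cs).
Proof.
move=> yY; have s0 := scale_gt0; elim: cs => [|c cs IH] //=; first by lra.
move=> /andP[ok oks]; rewrite plus_IZR Rmult_plus_distr_r; apply: Rplus_le_compat.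
  apply: Rle_trans (cdiv_ge _ _); last by case/andP: ok => _ /Z.ltb_lt.
  by rewrite mult_IZR /Zq; apply: Req_le; rewrite /Rdiv; ring.
apply: Rle_trans (cdiv_ge _ _); last exact: lt_IZR.
have h := horner_R_ge0 (proj1 yY) oks; have {}IH := IH oks.
rewrite mult_IZR (_ : IZR Y * _ / _ = IZR Y / IZR scale * IZR (horner_fix cdiv Y cs)); last first.
  by rewrite /Rdiv; ring.
rewrite Rmult_assoc; apply: Rmult_le_compat; try lra.
by apply: Rmult_le_pos; lra.
Qed.

Lemma horner_lb y Y cs : (0 <= Y)%Z -> IZR Y / IZR scale <= y -> all coef_ok cs ->
  IZR (horner_fix Z.div Y cs) <= horner_R y cs * IZR scale.
Proof.
move=> Y0 yY; have s0 := scale_gt0; have Y0' := IZR_le _ _ Y0.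
have Y1 : 0 <= IZR Y / IZR scale by apply: Rmult_le_pos => //; left; exact: Rinv_0_lt_compat.
have y0 : 0 <= y by lra.
elim: cs => [|c cs IH] //=; first by lra.
move=> /andP[ok oks]; rewrite plus_IZR Rmult_plus_distr_r; apply: Rplus_le_compat.
  apply: Rle_trans (div_le _ _) _; first by case/andP: ok => _ /Z.ltb_lt.
  by rewrite mult_IZR /Zq; apply: Req_le; rewrite /Rdiv; ring.
apply: Rle_trans (div_le _ _) _; first exact: lt_IZR.
have h := horner_R_ge0 y0 oks; have {}IH := IH oks.
rewrite mult_IZR (_ : IZR Y * _ / _ = IZR Y / IZR scale * IZR (horner_fix Z.div Y cs)); last first.
  by rewrite /Rdiv; ring.
apply: Rle_trans (_ : IZR Y / IZR scale * (horner_R y cs * IZR scale) <= _).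
  exact: Rmult_le_compat_l.
rewrite Rmult_assoc; apply: Rmult_le_compat_r => //.
by apply: Rmult_le_pos; lra.
Qed.

Lemma psum_horner a y f K : (forall k, (k <= K)%N -> a k = Zq (f k)) ->
  psum a y K = horner_R y [seq f k | k <- iota 0 K.+1].
Proof.
move=> af.
have H n m : (m + n = K.+1)%N -> horner_R y [seq f k | k <- iota m n] = \sum_(i < n) a (m + i)%N * y ^ i.
  elim: n m => [|n IH] m mn; first by rewrite big_ord0.
  rewrite [LHS]/= IH; last by lia.
  rewrite -af; last by lia.
  rewrite big_ord_recl /= addn0 Rmult_1_r big_distrr /=; congr (_ + _); apply: eq_bigr => i _.
  by rewrite /bump leq0n add1n add0n addnS addSn; ring.
by rewrite (H K.+1 0%N).
Qed.

Definition horner_le f K Y V :=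
  let cs := [seq f k | k <- iota 0 K.+1] in
  all coef_ok cs && (horner_fix cdiv Y cs <=? V)%Z.

Definition horner_ge f K Y V :=
  let cs := [seq f k | k <- iota 0 K.+1] in
  [&& (0 <=? Y)%Z, all coef_ok cs & (V <=? horner_fix Z.div Y cs)%Z].

Lemma psum_ub a f y K Y V : (forall k, (k <= K)%N -> a k = Zq (f k)) ->
  horner_le f K Y V -> 0 <= y <= IZR Y / IZR scale -> psum a y K <= IZR V / IZR scale.
Proof.
move=> af /andP[ok /Z.leb_le V1] yY; have s0 := scale_gt0.
apply: (Rmult_le_reg_r (IZR scale)) => //.
rewrite /Rdiv Rmult_assoc Rinv_l; last lra.
rewrite Rmult_1_r (psum_horner _ af).
by apply: Rle_trans (horner_ub yY ok) _; exact: IZR_le.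
Qed.

Lemma psum_lb a f y K Y V : (forall k, (k <= K)%N -> a k = Zq (f k)) ->
  horner_ge f K Y V -> IZR Y / IZR scale <= y -> IZR V / IZR scale <= psum a y K.
Proof.
move=> af /and3P[/Z.leb_le Y0 ok /Z.leb_le V1] yY; have s0 := scale_gt0.
apply: (Rmult_le_reg_r (IZR scale)) => //.
rewrite /Rdiv Rmult_assoc Rinv_l; last lra.
rewrite Rmult_1_r (psum_horner _ af).
by apply: Rle_trans (horner_lb Y0 yY ok); exact: IZR_le.
Qed.

Lemma pow_cert a b c e n : (0 < b)%Z -> (0 < e)%Z -> (a ^ Z.of_nat n * e <=? b ^ Z.of_nat n * c)%Z ->
  (IZR a / IZR b) ^ n <= IZR c / IZR e.
Proof.
move=> b0 e0 /Z.leb_le/IZR_le; rewrite !mult_IZR -!pow_IZR => H.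
have b0' := IZR_lt _ _ b0; have e0' := IZR_lt _ _ e0; have bn := pow_lt _ n b0'.
rewrite /Rdiv Rpow_mult_distr pow_inv; apply: (Rmult_le_reg_r (IZR b ^ n * IZR e)).
  exact: Rmult_lt_0_compat.
rewrite (_ : _ * / _ * _ = IZR a ^ n * IZR e); last by field; lra.
by rewrite (_ : _ * / _ * _ = IZR b ^ n * IZR c) //; field; lra.
Qed.

Fixpoint factZ (k : nat) : Z := if k is k'.+1 then (Z.of_nat k * factZ k')%Z else 1%Z.

Definition expc_Z (k : nat) : Z * Z := (1%Z, factZ k).

Lemma expc_Zq k : expc 1 k = Zq (expc_Z k).
Proof.
rewrite /expc /Zq /expc_Z [fst _]/= [snd _]/= pow1; congr (1 / _).
by elim: k => [|k IH] //; rewrite fact_simpl mult_INR IH -[factZ k.+1]/(Z.of_nat k.+1 * factZ k)%Z mult_IZR -INR_IZR_INZ.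
Qed.

Lemma expE x : exp x = PSeries (expc 1) x.
Proof.
rewrite /exp; case: (exist_exp x) => l Hl /=; symmetry; apply: is_series_unique.
apply/is_series_Reals => e e0; have [N HN] := Hl e e0; exists N => n nN.
rewrite (_ : sum_f_R0 _ n = sum_f_R0 (fun i => / INR (fact i) * x ^ i) n); first exact: HN.
by congr sum_f_R0; apply: fps_ext => i; rewrite /expc pow1 /Rdiv; ring.
Qed.

Lemma exp_lb x X V : horner_ge expc_Z 20 X V -> IZR X / IZR scale <= x -> 0 <= x ->
  IZR V / IZR scale <= exp x.
Proof.
move=> H Xx x0; apply: Rle_trans (psum_lb (fun k _ => expc_Zq k) H Xx) _.
exact: exp_partial.
Qed.

(** The tail is compared with exp 4 <= 3^4 = 81: x <= (3/10) 4, and 81 (3/10)^31 is below 10^6 /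
    [scale]. *)
Lemma exp_ub x X V : horner_le expc_Z 30 X V -> 0 <= x <= IZR X / IZR scale -> x <= 6 / 5 ->
  exp x <= (IZR V + 10 ^ 6) / IZR scale.
Proof.
move=> H Xx x4; rewrite expE.
have e4 N : psum (expc 1) 4 N <= 81.
  apply: Rle_trans (_ : exp 4 <= _); first by apply: exp_partial; lra.
  rewrite (_ : 4 = 1 + 1 + (1 + 1)); last by ring.
  have e2 : 0 < exp (1 + 1) <= 9.
    by rewrite exp_plus; have := exp_le_3; have := exp_pos 1; nra.
  by rewrite exp_plus; nra.
apply: Rle_trans (@psum_tail (expc 1) x 4 (3 / 10) 81 30 expc1_ge0 _ _ _ _ e4) _; try lra.
have h := psum_ub (fun k _ => expc_Zq k) H Xx.
have p : (3 / 10) ^ 31 <= 1 / 10 ^ 16.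
  have := @pow_cert 3 10 1 (10 ^ 16) 31 erefl erefl erefl; rewrite -[(10 ^ 16)%Z]/(10000000000000000)%Z.
  lra.
rewrite /scale in h *; lra.
Qed.

(** * Numerical values *)

Definition zsum (n : nat) (F : nat -> Z) : Z := foldr (fun i => Z.add (F i)) 0%Z (iota 0 n).

Lemma IZR_zsum n F : IZR (zsum n F) = \sum_(i < n) IZR (F i).
Proof.
rewrite -(big_mkord xpredT (fun i => IZR (F i))) /zsum unlock /index_iota subn0 /=.
by elim: (iota 0 n) => //= i s <-; rewrite plus_IZR.
Qed.

(** Initial values of [t], certified by [t_tZ]. They determine [L2] up to degree 63 and [L3], [Gam]
    up to degree 95. *)
Definition t_list : seq Z := [:: 0; 1; 1; 2; 4; 9; 20; 48; 115; 286; 719; 1842; 4766; 12486;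
  32973; 87811; 235381; 634847; 1721159; 4688676; 12826228; 35221832; 97055181; 268282855;
  743724984; 2067174645; 5759636510; 16083734329; 45007066269; 126186554308; 354426847597;
  997171512998]%Z.

Definition tZ (n : nat) : Z := nth 0%Z t_list n.

(** In integers: for w the identity, k times the coefficient of z^k in the sum of T(z^i)/i over i >=
    j; for w = 1, the coefficient in the sum of T(z^i). *)
Definition lamZ (j : nat) (w : nat -> Z) (k : nat) : Z :=
  zsum k.+1 (fun i => if (j <= i)%N && (i %| k)%N then (w (k %/ i) * tZ (k %/ i))%Z else 0%Z).

Lemma lamZ_sum j w k : (0 < j)%N -> (forall m, (m <= k %/ j)%N -> t m = IZR (tZ m)) ->
  \sum_(i < k.+1) from j i * dil i (fun n => IZR (w n) * t n) k = IZR (lamZ j w k).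
Proof.
move=> j0 tE; rewrite IZR_zsum; apply: eq_bigr => i _; rewrite /from /dil.
case: leqP => ji /=; last by ring.
case: ifP => _; last by ring.
by rewrite mult_IZR -tE; [ring | exact: leq_div2l].
Qed.

Lemma theta_lamZ j k : (0 < j)%N -> (forall m, (m <= k %/ j)%N -> t m = IZR (tZ m)) ->
  theta (Lam (fun i => from j i / INR i)) k = IZR (lamZ j Z.of_nat k).
Proof.
move=> j0 tE; rewrite -lamZ_sum // theta_Lam; last by rewrite from_lt.
by apply: eq_bigr => i _; congr (_ * dil _ _ _); apply: fps_ext => n; rewrite INR_IZR_INZ.
Qed.

Lemma t_1 : t 1%N = 1.
Proof. by rewrite t_fps conv_fX Ex0. Qed.

(** The shifted series of t is an exponential, so its Euler derivative gives a recursion for n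
    t_(n+1); one computation checks the list against it. *)
Lemma t_tZ n : (n < 32)%N -> t n = IZR (tZ n).
Proof.
elim/ltn_ind: n => -[|[|n]] IH n32; [exact: t0 | exact: t_1 |].
have := theta_Ex (Lam0 (fun i => from 1 i / INR i)).
rewrite -t_shift => /(congr1 (fun a : fps => a n.+1)) E.
have cert : all (fun n => Z.of_nat n.+1 * tZ n.+2 =?
    zsum n.+2 (fun i => lamZ 1 Z.of_nat i * tZ (n.+1 - i).+1))%Z (iota 0 30) by vm_cast_no_check (erefl true).
have /(allP cert)/Z.eqb_eq/(congr1 IZR) : n \in iota 0 30 by rewrite mem_iota add0n -ltnS.
rewrite mult_IZR IZR_zsum -INR_IZR_INZ => {cert} C.
apply: (Rmult_eq_reg_l (INR n.+1)); last exact: not_0_INR.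
rewrite C; move: E; rewrite {1}/theta => ->; apply: eq_bigr => -[i i2] _.
rewrite [nat_of_ord _]/= mult_IZR theta_lamZ //; last first.
  by move=> m; rewrite divn1 => mi; apply: IH; lia.
case: i i2 => [|i] i2; last by rewrite IH //; lia.
by rewrite (_ : lamZ 1 Z.of_nat 0 = 0%Z) // !Rmult_0_l.
Qed.

(** [k.-1.+1] is k for k > 0 and avoids the denominator 0 at k = 0. *)
Definition coefL (j k : nat) : Z * Z := (lamZ j Z.of_nat k, Z.of_nat k.-1.+1).
Definition coefG (k : nat) : Z * Z := (lamZ 3 (fun=> 1%Z) k, 1%Z).
Definition maskZ (e : bool) (f : nat -> Z * Z) (k : nat) : Z * Z :=
  if odd k == e then f k else (0%Z, 1%Z).

Lemma maskZ_Zq e f a k : a k = Zq (f k) ->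
  (if odd k == e then a k else 0) = Zq (maskZ e f k).
Proof. by rewrite /maskZ; case: ifP => // _ _; rewrite /Zq /=; field. Qed.

Lemma coefL_Zq j k : (0 < j)%N -> (k < 32 * j)%N ->
  Lam (fun i => from j i / INR i) k = Zq (coefL j k).
Proof.
move=> j0 k32; rewrite /Zq /= -theta_lamZ // => [|m mk]; last first.
  by apply: t_tZ; apply: leq_ltn_trans mk _; rewrite ltn_divLR.
case: k k32 => [|k] _; first by rewrite Lam0 theta_0 /Rdiv Rmult_0_l.
rewrite -[IZR _]/(IZR (Z.of_nat k.+1)) -INR_IZR_INZ /theta; field; exact: not_0_INR.
Qed.

Lemma coefG_Zq k : (k < 96)%N -> Gam k = Zq (coefG k).
Proof.
move=> k96; rewrite /Zq [fst _]/= [snd _]/= -lamZ_sum //.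
  by rewrite Rdiv_1_r; apply: eq_bigr => i _; congr (_ * dil _ _ _); apply: fps_ext => n; ring.
by move=> m mk; apply: t_tZ; apply: leq_ltn_trans mk _; rewrite ltn_divLR.
Qed.

Lemma L2_coef k : (k <= 60)%N -> L2 k = Zq (coefL 2 k).
Proof. by move=> k60; apply: (@coefL_Zq 2) => //; apply: leq_ltn_trans k60 _. Qed.

Definition rho_lb : R := 338321856 / 10 ^ 9.
Definition rho_ub : R := 338321858 / 10 ^ 9.

Lemma rho_ub_gt : 0 <= rho_ub < / 2 /\ 1 < rho_ub * exp (1 + psum L2 rho_ub 60).
Proof.
split; first by rewrite /rho_ub; lra.
have h := @psum_lb L2 (coefL 2) rho_ub 60 33832185800000000000 8375759780000000000 L2_coef
  (ltac:(vm_cast_no_check (erefl true))) (ltac:(rewrite /scale /rho_ub; lra)).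
have e := @exp_lb (1 + 837575978 / 10 ^ 10) 108375759780000000000 295576528000000000000
  (ltac:(vm_cast_no_check (erefl true))) (ltac:(rewrite /scale; lra)) (ltac:(lra)).
have : exp (1 + 837575978 / 10 ^ 10) <= exp (1 + psum L2 rho_ub 60).
  by apply: exp_mono; rewrite /scale in h; lra.
by rewrite /scale in e => m; rewrite /rho_ub in m *; lra.
Qed.

Lemma L2_tail x q : 0 <= x <= q / 2 -> 0 <= q <= 1 -> PSeries L2 x <= psum L2 x 60 + q ^ 61.
Proof.
move=> xq q1; rewrite -[q ^ 61]Rmult_1_l; apply: (@psum_tail L2 x (/ 2)); try lra.
  exact: L2_ge0.
move=> N; apply: Rle_trans ex_L2_half.2.
by apply: psum_le_PSeries; [lra | exact: L2_ge0 | exact: ex_L2_half.1].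
Qed.

Lemma rho_near : rho_lb <= rho <= rho_ub.
Proof.
have [ub2 ubE] := rho_ub_gt; split; last exact: (rho_bounds ub2 ubE).2.
apply: (@rho_ge _ 60 ub2 ubE rho_lb (83757597 / 10 ^ 9)); first by rewrite /rho_lb; lra.
  apply: Rle_trans (@L2_tail rho_lb (677 / 1000) _ _) _; try (rewrite /rho_lb; lra).
  have h := @psum_ub L2 (coefL 2) rho_lb 60 33832185600000000000 8375759680000000000 L2_coef
    (ltac:(vm_cast_no_check (erefl true))) (ltac:(rewrite /scale /rho_lb; lra)).
  have := @pow_cert 677 1000 1 10000000000 61 erefl erefl (ltac:(vm_cast_no_check (erefl true))).
  rewrite /scale in h; rewrite /rho_lb in h *; lra.
have e := @exp_ub (1 + 83757597 / 10 ^ 9) 108375759700000000000 295576528600000000000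
  (ltac:(vm_cast_no_check (erefl true))) (ltac:(rewrite /scale; lra)) (ltac:(lra)).
rewrite /scale in e; rewrite /rho_lb; lra.
Qed.

Lemma rho_le34 : / 4 <= rho <= 34 / 100.
Proof. by have := rho_near; rewrite /rho_lb /rho_ub; lra. Qed.

Lemma rho_E : rho * exp (1 + PSeries L2 rho) = 1.
Proof. by have [ub2 ubE] := rho_ub_gt; exact: rho_eq ub2 ubE. Qed.

(** As 6/5 rho < 407/1000, the left side is below 0.1401, whereas L2(rho) is at least 0.083. *)
Lemma L2_step_rho : PSeries L2 (6 / 5 * rho) <= PSeries L2 rho + / 8.
Proof.
have := rho_near; rewrite /rho_lb /rho_ub => rn.
have m : PSeries L2 (6 / 5 * rho) <= PSeries L2 (407 / 1000).
  by apply: PSeries_mono; [exact: L2_ge0 | lra | apply: ex_L2; lra].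
have tl := @L2_tail (407 / 1000) (814 / 1000) (ltac:(lra)) (ltac:(lra)).
have h := @psum_ub L2 (coefL 2) (407 / 1000) 60 40700000000000000000 14000000000000000000 L2_coef
  (ltac:(vm_cast_no_check (erefl true))) (ltac:(rewrite /scale; lra)).
have p := @pow_cert 814 1000 1 100000 61 erefl erefl (ltac:(vm_cast_no_check (erefl true))).
have h' := @psum_lb L2 (coefL 2) rho 60 33800000000000000000 8300000000000000000 L2_coef
  (ltac:(vm_cast_no_check (erefl true))) (ltac:(rewrite /scale; lra)).
have := @psum_le_PSeries L2 rho 60 (ltac:(lra)) L2_ge0 (@ex_L2 rho (ltac:(lra))).
rewrite /scale in h h'; lra.
Qed.

(** * Enclosures of gamma, log xi and the two limits at sqrt rho *)

Section Values.
Let s := sqrt rho.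

Lemma s_near : 58165441 / 10 ^ 8 <= s <= 58165442 / 10 ^ 8.
Proof.
have := rho_near; rewrite /rho_lb /rho_ub => rn.
have [s2 s0] := s_bounds rho_le34.1 rho_le34.2; rewrite -/s in s2 s0; split; nra.
Qed.

(** The cube of 6967/10000 is just below rho, where the partial sums of T are at most 1, and 1/(1 -
    6967/10000) <= 10/3. *)
Lemma Lam3_psum (omega : nat -> R) c N : (forall i, 0 <= omega i <= c) ->
  (forall i, (i < 3)%N -> omega i = 0) -> psum (Lam omega) (6967 / 10000) N <= c * (10 / 3).
Proof.
move=> om0 om3; have [ub2 ubE] := rho_ub_gt; have c0 : 0 <= c by have := om0 0%N; lra.
apply: Rle_trans (@psum_Lam omega c 3 _ 1 N _ om0 om3 isT _) _; first lra.
  apply: Rle_trans (psum_t_rho ub2 ubE N); apply: psum_mono t_ge0.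
  by have := rho_near; rewrite /rho_lb; lra.
by rewrite /Rdiv Rmult_assoc; apply: Rmult_le_compat_l; lra.
Qed.

(** The tail beyond degree 92 is compared with the value at 6967/10000: s is at most 8349/10000 of
    that point, and (10/3) (8349/10000)^93 <= 2/10^7. *)
Lemma mask_bounds (omega : nat -> R) c f e Vl Vu : (forall i, 0 <= omega i <= c) ->
  (forall i, (i < 3)%N -> omega i = 0) ->
  (forall k, (k <= 92)%N -> Lam omega k = Zq (f k)) ->
  horner_ge (maskZ e f) 92 58165441000000000000 Vl ->
  horner_le (maskZ e f) 92 58165442000000000000 Vu ->
  IZR Vl / IZR scale <= PSeries (fun n => if odd n == e then Lam omega n else 0) s
    <= IZR Vu / IZR scale + c * (2 / 10 ^ 7).
Proof.
move=> om0 om3 fE hl hu; have sn := s_near.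
set b := fun n => _; have b0 n : 0 <= b n.
  by rewrite /b; case: ifP => _; [apply: Lam_ge0 => i; exact: (om0 i).1 | lra].
have bE k : (k <= 92)%N -> b k = Zq (maskZ e f k) by move=> k92; apply: maskZ_Zq; exact: fE.
have bB N : psum b (6967 / 10000) N <= c * (10 / 3).
  apply: psum_mask; [lra | | exact: Lam3_psum].
  by move=> n; apply: Lam_ge0 => i; exact: (om0 i).1.
have c0 : 0 <= c by have := om0 0%N; lra.
split.
  apply: Rle_trans (@psum_lb b _ s 92 _ _ bE hl _) _; first by rewrite /scale; lra.
  apply: psum_le_PSeries => //; first lra.
  have [exb _] := @psum_bounded b (6967 / 10000) _ (ltac:(lra)) b0 bB.
  by apply: ex_series_Rabs; apply: ex_series_sc_le b0 _ exb; rewrite Rabs_pos_eq; lra.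
apply: Rle_trans (@psum_tail b s (6967 / 10000) (8349 / 10000) _ 92 b0 _ _ _ _ bB) _; try lra.
have h := psum_ub bE hu (_ : 0 <= s <= _).
have := @pow_cert 8349 10000 6 100000000 93 erefl erefl (ltac:(vm_cast_no_check (erefl true))).
have := h (ltac:(rewrite /scale; lra)); rewrite -/s; move: (_ ^ 93) => p; nra.
Qed.

Let P := PSeries (fun n => if odd n == false then Gam n else 0) s.
Let Q := PSeries (fun n => if odd n == true then Gam n else 0) s.
Let O := PSeries (fun n => if odd n == true then L3 n else 0) s.

Lemma P_near : 2431523 / 10 ^ 7 <= P <= 2431527 / 10 ^ 7.
Proof.
have := @mask_bounds (from 3) 1 coefG false 24315230000000000000 24315240000000000000
  (@from_ge0 3) (@from_lt 3) (fun k k92 => @coefG_Zq k (leq_ltn_trans k92 (isT : 92 < 96)%N))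
  (ltac:(vm_cast_no_check (erefl true))) (ltac:(vm_cast_no_check (erefl true))).
by rewrite -/Gam -/P /scale; lra.
Qed.

Lemma Q_near : 3166462 / 10 ^ 7 <= Q <= 3166465 / 10 ^ 7.
Proof.
have := @mask_bounds (from 3) 1 coefG true 31664620000000000000 31664628000000000000
  (@from_ge0 3) (@from_lt 3) (fun k k92 => @coefG_Zq k (leq_ltn_trans k92 (isT : 92 < 96)%N))
  (ltac:(vm_cast_no_check (erefl true))) (ltac:(vm_cast_no_check (erefl true))).
by rewrite -/Gam -/Q /scale; lra.
Qed.

Lemma O_near : 896338 / 10 ^ 7 <= O <= 896340 / 10 ^ 7.
Proof.
have := @mask_bounds (fun i => from 3 i / INR i) (/ INR 3) (coefL 3) true 8963380000000000000 8963390000000000000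
  (fun i => @from_inv 3 i isT) (@from_inv_lt 3) (fun k k92 => @coefL_Zq 3 k isT (leq_ltn_trans k92 (isT : 92 < 96)%N))
  (ltac:(vm_cast_no_check (erefl true))) (ltac:(vm_cast_no_check (erefl true))).
by rewrite -/L3 -/O /scale [INR 3]/=; lra.
Qed.

Lemma exp_2O : 11963408 / 10 ^ 7 <= exp (2 * O) <= 11963414 / 10 ^ 7.
Proof.
have on := O_near; split.
  have e := @exp_lb (2 * O) 17926760000000000000 119634080000000000000
    (ltac:(vm_cast_no_check (erefl true))) (ltac:(rewrite /scale; lra)) (ltac:(lra)).
  by rewrite /scale in e; lra.
have e := @exp_ub (2 * O) 17926800000000000000 119634139000000000000
  (ltac:(vm_cast_no_check (erefl true))) (ltac:(rewrite /scale; lra)) (ltac:(lra)).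
by rewrite /scale in e; lra.
Qed.

(** With E the even part of log xi, xi(s) = exp(E - O) q and xi(-s) = exp(E - O); the common factor
    cancels and leaves tanh O and coth O in terms of q. *)
Lemma mu_tanh (q := exp (2 * O)) :
  mu0 = P + Q * ((q - 1) / (q + 1)) /\ mu1 = P + Q * ((q + 1) / (q - 1)).
Proof.
have [r1 r2] := rho_le34; have [_ s0] := s_bounds r1 r2; rewrite -/s in s0.
have [exL exG] := @ex_Xi (62 / 100) (ltac:(lra)).
have conv b : (forall n, 0 <= b n) -> ex_series (sc (62 / 100) b) -> ex_series (sc (Rabs s) b).
  move=> b0 exb; apply: ex_series_Rabs; apply: ex_series_sc_le b0 _ exb.
  by rewrite !Rabs_pos_eq; lra.
have [g1 g2] := PSeries_parity (conv _ Gam_ge0 exG) Gam_ge0.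
have [l1 l2] := PSeries_parity (conv _ L3_ge0 exL) L3_ge0.
have xi_exp z : Rabs z <= s -> xi z = exp (PSeries L3 z) /\ gamma z = PSeries Gam z.
  move=> zs; have [-> ->] := @xi_PSeries z (ltac:(lra)); split=> //.
  by apply: PSeries_Ex exL _; [exact: L3_0 | exact: L3_ge0 | lra].
have [x1 y1] := xi_exp s (ltac:(rewrite Rabs_pos_eq; lra)).
have [x2 y2] := xi_exp (- s) (ltac:(rewrite Rabs_Ropp Rabs_pos_eq; lra)).
rewrite /mu0 /mu1 -/s x1 x2 y1 y2 g1 g2 l1 l2 -/P -/Q -/O.
set E := PSeries _ s.
have E1 : exp (E + O) = exp (E - O) * q by rewrite /q -exp_plus; congr exp; ring.
have q1 : 1 < q by have := exp_2O; rewrite -/q; lra.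
have e0 := exp_pos (E - O); rewrite E1.
by split; field; repeat split; nra.
Qed.

Lemma mu_near : Rabs (3 + mu0 - 32715 / 10000) < 1 / 10000 /\
  Rabs (3 + mu1 - 67852 / 10000) < 1 / 10000.
Proof.
have [-> ->] := mu_tanh; have pn := P_near; have qn := Q_near.
move: exp_2O; set q := exp _ => en.
have r0 : 89394 / 10 ^ 6 <= (q - 1) / (q + 1) <= 89395 / 10 ^ 6.
  have i0 : 0 < / (q + 1) by apply: Rinv_0_lt_compat; lra.
  have : (q + 1) * / (q + 1) = 1 by apply: Rinv_r; lra.
  by rewrite /Rdiv; nra.
have r1 : 1118633 / 10 ^ 5 <= (q + 1) / (q - 1) <= 1118638 / 10 ^ 5.
  have i0 : 0 < / (q - 1) by apply: Rinv_0_lt_compat; lra.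
  have : (q - 1) * / (q - 1) = 1 by apply: Rinv_r; lra.
  by rewrite /Rdiv; nra.
by split; apply: Rabs_def1; nra.
Qed.

End Values.

Theorem theorem9 :
  (exists C : R, eventually (fun n : nat =>
     ~~ odd n -> Rabs (mean_X n - (3 + mu0)) <= C / INR n)) /\
  (exists C : R, eventually (fun n : nat =>
     odd n -> Rabs (mean_X n - (3 + mu1)) <= C / INR n)) /\
  Rabs (3 + mu0 - 32715 / 10000) < 1 / 10000 /\
  Rabs (3 + mu1 - 67852 / 10000) < 1 / 10000.
Proof.
have [r1 r2] := rho_le34; have mean := mean_parity r1 r2 rho_E L2_step_rho.
split.
  have [C [M HM]] := mean 0%N isT; exists C, M => n Mn /negbTE on.
  exact: (HM n Mn on).
split; last exact: mu_near.
have [C [M HM]] := mean 1%N isT; exists C, M => n Mn on.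
exact: (HM n Mn on).
Qed.
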